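(* For all $f,g\in C^\infty(M)$ and any $Z\in\mathbb{H}$, with $I=I(Z)$, \[ \langle f,g\rangle=\lim_{k\to\infty}k^{-n}\big\langle T^{(k)}_{E_I(f)},T^{(k)}_{E_I(g)}\big\rangle , \] where the inner product on the right is the Hilbert--Schmidt inner product of operators on $H^0(M_Z,\mathcal{L}_Z^k)$.
   Context: **Abelian variety.** $V$ is a real vector space of dimension $2n$ with symplectic form $\omega$, $\Lambda\subset V$ is a lattice of maximal rank on which $\omega$ is integral and unimodular, and $M=V/\Lambda$. Choose a symplectic basis $(\lambda_1,\dots,\lambda_{2n})$ of $\Lambda$ over $\mathbb{Z}$, with dual coordinates $(x_1,\dots,x_n,y_1,\dots,y_n)$ on $V$, so $\omega=\sum_{i=1}^n dx_i\wedge dy_i$. Let $\mathbb{H}=\{Z\in M_{n,n}(\mathbb{C}) : Z=Z^T,\ \operatorname{Im}Z>0\}$. For $Z=X+iY\in\mathbb{H}$ ($X=\operatorname{Re}Z$, $Y=\operatorname{Im}Z$), $I(Z)$ is the complex structure on $V$ (hence on $M$) for which $z=x+Zy$ are complex linear coordinates, and $M_Z=(M,\omega,I(Z))$. **Line bundle.** $\mathcal{L}_Z\to M_Z$ is the quotient of $V\times\mathbb{C}$ by the $\Lambda$-action $\lambda\cdot(v,w)=(v+\lambda,e_\lambda(v)w)$, with multipliers determined by $e_{\lambda_i}(z)=1$, $e_{\lambda_{n+i}}(z)=e^{-2\pi i z_i-\pi i Z_{ii}}$ ($i=1,\dots,n$) and $e_{\lambda'}(v+\lambda)e_\lambda(v)=e_{\lambda+\lambda'}(v)$.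 Its Hermitian structure is induced by $h(z)\langle\cdot,\cdot\rangle_{\mathbb{C}}$ with $h(z)=e^{-2\pi y\cdot Yy}$. For a positive integer $k$, sections of $\mathcal{L}_Z^k$ carry the inner product $(s_1,s_2)=\int_M s_1\overline{s_2}\,h^k\,dx\,dy$. $H^0(M_Z,\mathcal{L}_Z^k)$ is the space of holomorphic sections, of dimension $k^n$. **Toeplitz operators.** For $f\in C^\infty(M)$, $T^{(k)}_{f}=T^{(k)}_{f,I(Z)}:H^0(M_Z,\mathcal{L}_Z^k)\to H^0(M_Z,\mathcal{L}_Z^k)$ is $s\mapsto\pi(fs)$ with $\pi$ the orthogonal projection onto $H^0(M_Z,\mathcal{L}_Z^k)$. The Hilbert--Schmidt inner product of operators is $\langle A,B\rangle=\operatorname{Tr}(AB^* )$. For functions, $\langle f,g\rangle=\int_M f\bar g\,dx\,dy$. **The operators $T^{(k)}_{E_I(f)}$.** For $r,s\in\mathbb{Z}^n$ let $F_{r,s}(x,y)=e^{2\pi i(x\cdot r+s\cdot y)}$. Let \[ \Delta_{I(Z)}=\frac1{2\pi}\Big(\big(\tfrac{\partial}{\partial y}-X\tfrac{\partial}{\partial x}\big)\cdot Y^{-1}\big(\tfrac{\partial}{\partial y}-X\tfrac{\partial}{\partial x}\big)+\tfrac{\partial}{\partial x}\cdot Y\tfrac{\partial}{\partial x}\Big) \] be the Laplace operator of the metric $2\pi\omega(\cdot,I(Z)\cdot)$, and $E_{I(Z)}=e^{-\frac h4\Delta_{I(Z)}}$ acting on $C^\infty(M)[[h]]$ ($h$ here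 being the formal variable). In $T^{(k)}_{E_I(f)}$ the formal variable is evaluated at $h=1/k$. On the Fourier basis this means $T^{(k)}_{E_I(F_{r,s})}=T^{(k)}_{\eta_k(r,s)^{-1}F_{r,s}}$ with \[ \eta_k(r,s)=e^{-\frac{\pi}{2k}\left((s-Xr)\cdot Y^{-1}(s-Xr)+r\cdot Yr\right)}. \] For a general smooth $f=\sum_{(r,s)\in\mathbb{Z}^{2n}}\lambda_{r,s}F_{r,s}$ one sets $T^{(k)}_{E_I(f)}=\sum_{(r,s)}\lambda_{r,s}T^{(k)}_{E_I(F_{r,s})}$. *)

(* Defs.v *)
(* MathComp-Analysis over an arbitrary realType R; complex numbers are R[i]. *)
From HB Require Import structures.
From mathcomp Require Import all_boot all_order all_algebra.
From mathcomp Require Import finmap complex ring.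
From mathcomp Require Import all_classical all_reals all_analysis.
From mathcomp Require Import showcase.summability.

Set Implicit Arguments.
Unset Strict Implicit.
Unset Printing Implicit Defensive.

Import Order.TTheory GRing.Theory Num.Theory.
Import numFieldNormedType.Exports.

Local Open Scope classical_set_scope.
Local Open Scope complex_scope.
Local Open Scope ring_scope.

Definition cexp (R : realType) (z : R[i]) : R[i] :=
  expR (complex.Re z) * cos (complex.Im z)
  +i* (expR (complex.Re z) * sin (complex.Im z)).

Definition dot (R : pzRingType) (n : nat) (u v : 'cV[R]_n) : R :=
  (u^T *m v) 0 0.

Definition re_mx (R : realType) (m n : nat) (Z : 'M[R[i]]_(m, n)) :
    'M[R]_(m, n) :=
  map_mx (@complex.Re R) Z.

Definition im_mx (R : realType) (m n : nat) (Z : 'M[R[i]]_(m, n)) :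
    'M[R]_(m, n) :=
  map_mx (@complex.Im R) Z.

Definition complex_mx (R : realType) (m n : nat) (A : 'M[R]_(m, n)) :
    'M[R[i]]_(m, n) :=
  map_mx (real_complex R) A.

Definition siegel (R : realType) (n : nat) (Z : 'M[R[i]]_n) : Prop :=
  Z^T = Z /\
  forall u : 'cV[R]_n, u != 0 -> 0 < dot u (im_mx Z *m u).

(* The basis is ordered (x-directions, y-directions), so that in the dual
   coordinates omega = sum_i dx_i /\ dy_i; nondegeneracy of omega and its being
   integral and unimodular on Lambda follow from the last three fields. *)
Record symplectic_lattice_basis (R : realType) (n : nat) (V : vectType R)
    (omega : V -> V -> R) (Lambda : set V) (lam : 'I_(n + n) -> V) : Prop := {
  omega_linearl : forall v, scalar (omega^~ v);
  omega_linearr : forall u, scalar (omega u);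
  omega_alternating : forall u, omega u u = 0;
  lam_basis : basis_of fullv [seq lam i | i <- enum 'I_(n + n)];
  lam_lattice : Lambda =
    [set v | exists m : 'I_(n + n) -> int, v = \sum_i (m i)%:~R *: lam i];
  omega_xx : forall i j : 'I_n, omega (lam (lshift n i)) (lam (lshift n j)) = 0;
  omega_yy : forall i j : 'I_n, omega (lam (rshift n i)) (lam (rshift n j)) = 0;
  omega_xy : forall i j : 'I_n,
    omega (lam (lshift n i)) (lam (rshift n j)) = (i == j)%:R
}.

(* A function on V read in the coordinates (x, y) dual to lam.  All analysis
   below takes place in these coordinates: points are v : 'cV[R]_(n + n) with
   x = usubmx v and y = dsubmx v, and Lambda becomes the integer lattice. *)
Definition in_coords (R : realType) (d : nat) (V : vectType R)
    (lam : 'I_d -> V) (f : V -> R[i]) : 'cV[R]_d -> R[i] :=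
  fun v => f (\sum_i v i 0 *: lam i).

Fixpoint is_Ck (R : realType) (d m : nat) (u : 'cV[R]_d -> R) : Prop :=
  continuous u /\
  if m is m'.+1 then
    forall i : 'I_d, (forall v, derivable u v (delta_mx i 0)) /\
      is_Ck m' ('D_(delta_mx i 0) u)
  else True.

Definition smooth (R : realType) (d : nat) (u : 'cV[R]_d -> R[i]) : Prop :=
  forall m, is_Ck m (fun v => complex.Re (u v)) /\
            is_Ck m (fun v => complex.Im (u v)).

(* C^oo(V / Lambda): Lambda-periodic smooth functions on V. *)
Definition Cinfty_torus (R : realType) (d : nat) (V : vectType R)
    (Lambda : set V) (lam : 'I_d -> V) (f : V -> R[i]) : Prop :=
  (forall l v, Lambda l -> f (v + l) = f v) /\ smooth (in_coords lam f).

(* Iterated Lebesgue integral over the unit cube, a fundamental domain of the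
   integer lattice; only ever applied to continuous integrands. *)
Fixpoint cube_int (R : realType) (d : nat) : ('cV[R]_d -> R) -> R :=
  match d return ('cV[R]_d -> R) -> R with
  | 0 => fun u => u 0
  | d'.+1 => fun u =>
      \int[@lebesgue_measure R]_(t in `[0, 1])
        cube_int (fun v : 'cV[R]_d' => u (col_mx (t%:M : 'cV_1) v))
  end.

Definition torus_int (R : realType) (d : nat) (u : 'cV[R]_d -> R[i]) : R[i] :=
  cube_int (fun v => complex.Re (u v)) +i* cube_int (fun v => complex.Im (u v)).

Definition torus_ip (R : realType) (d : nat) (f g : 'cV[R]_d -> R[i]) : R[i] :=
  torus_int (fun v => f v * (g v)^*%C).

Section LineBundle.
Context {R : realType} {n : nat}.
Variables (Z : 'M[R[i]]_n) (k : nat).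
Implicit Types (s t : 'cV[R]_(n + n) -> R[i]).

Definition zcoord (v : 'cV[R]_(n + n)) : 'cV[R[i]]_n :=
  complex_mx (usubmx v) + Z *m complex_mx (dsubmx v).

(* The multiplier e_l at the point with complex coordinate z, for a lattice
   vector l = (a, b); multiplier_x, multiplier_y and multiplierD below show that
   this is the solution of the conditions on the generators and the cocycle
   relation. *)
Definition multiplier (l : 'cV[int]_(n + n)) (z : 'cV[R[i]]_n) : R[i] :=
  let b : 'cV[R[i]]_n := map_mx intr (dsubmx l) in
  cexp (- (2 * pi%:C * 'i%C * dot b z) - pi%:C * 'i%C * dot b (Z *m b)).

Definition holomorphic s : Prop :=
  exists2 phi : 'cV[R[i]]_n -> R[i],
    (forall z, differentiable (phi : _ -> R[i]^o) z) & (forall v, s v = phi (zcoord v)).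

(* Sections of the k-th power of the bundle are functions on V that are
   equivariant for the k-th powers of the multipliers. *)
Definition H0 : set ('cV[R]_(n + n) -> R[i]) :=
  [set s | holomorphic s /\
    forall (l : 'cV[int]_(n + n)) v,
      s (v + map_mx intr l) = multiplier l (zcoord v) ^+ k * s v].

Definition hermitian_weight (v : 'cV[R]_(n + n)) : R :=
  expR (- (2 * pi * dot (dsubmx v) (im_mx Z *m dsubmx v))).

Definition section_ip s t : R[i] :=
  torus_int (fun v => s v * (t v)^*%C * ((hermitian_weight v) ^+ k)%:C).

End LineBundle.

Section Operators.
Context {R : realType} {T : Type}.
Variables (H : set (T -> R[i])) (ip : (T -> R[i]) -> (T -> R[i]) -> R[i]).
Implicit Types (A B : (T -> R[i]) -> (T -> R[i])).

(* Here H is a subspace of T -> R[i] and ip is an inner product on it.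
   An operator on H is a map A of which only the values on H matter.  The
   choice operator xget returns the unique element of the set, when there is
   one, and its first argument otherwise. *)

Definition orth_proj (s : T -> R[i]) : T -> R[i] :=
  xget (fun=> 0) [set p | H p /\ forall t, H t -> ip (s \- p) t = 0].

Definition adjoint B : (T -> R[i]) -> (T -> R[i]) := fun t =>
  xget (fun=> 0) [set p | H p /\ forall s, H s -> ip (B s) t = ip s p].

Definition lincomb (N : nat) (b : 'I_N -> T -> R[i]) (c : 'I_N -> R[i]) :
    T -> R[i] :=
  fun v => \sum_i c i * b i v.

Definition is_basis (N : nat) (b : 'I_N -> T -> R[i]) : Prop :=
  (forall i, H (b i)) /\
  (forall s, H s -> exists! c : 'I_N -> R[i], s = lincomb b c).

Definition op_trace A : R[i] :=
  xget 0 [set t | exists N (b : 'I_N -> T -> R[i]) (M : 'M[R[i]]_N),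
    [/\ is_basis b, forall j, A (b j) = lincomb b (M^~ j) & t = \tr M]].

Definition hilbert_schmidt A B : R[i] := op_trace (A \o adjoint B).

End Operators.

Section Toeplitz.
Context {R : realType} {n : nat}.
Variables (Z : 'M[R[i]]_n).
Implicit Types (f u s : 'cV[R]_(n + n) -> R[i]).

Definition toeplitz (k : nat) f :
    ('cV[R]_(n + n) -> R[i]) -> ('cV[R]_(n + n) -> R[i]) :=
  fun s => orth_proj (H0 Z k) (section_ip Z k) (f \* s).

Definition fourier_mode (rs : 'cV[int]_n * 'cV[int]_n) : 'cV[R]_(n + n) -> R[i] :=
  fun v => cexp ('i%C *
    (2 * pi * (dot (usubmx v) (map_mx intr rs.1)
               + dot (map_mx intr rs.2) (dsubmx v)))%:C).

Definition partial_deriv (j : 'I_(n + n)) u : 'cV[R]_(n + n) -> R[i] :=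
  fun v => 'D_(delta_mx j 0) (fun w => complex.Re (u w)) v
           +i* 'D_(delta_mx j 0) (fun w => complex.Im (u w)) v.

Definition dx (i : 'I_n) u := partial_deriv (lshift n i) u.

(* the i-th component of d/dy - X d/dx *)
Definition dy_Xdx (i : 'I_n) u : 'cV[R]_(n + n) -> R[i] := fun v =>
  partial_deriv (rshift n i) u v - \sum_j (re_mx Z i j)%:C * dx j u v.

Definition laplace u : 'cV[R]_(n + n) -> R[i] := fun v =>
  ((2 * pi)^-1)%:C *
  (\sum_i \sum_j (invmx (im_mx Z) i j)%:C * dy_Xdx i (dy_Xdx j u) v
   + \sum_i \sum_j (im_mx Z i j)%:C * dx i (dx j u) v).

(* coefficient of h^m in the formal power series E_I(u) = exp (- h/4 Delta) u *)
Definition E_coef (m : nat) u : 'cV[R]_(n + n) -> R[i] := fun v =>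
  ((- 4^-1) ^+ m / m`!%:R) * iter m laplace u v.

(* E_I(u) with the formal variable evaluated at h; E_eval_fourier_mode below
   computes this on the Fourier modes. *)
Definition E_eval (h : R) u : 'cV[R]_(n + n) -> R[i] := fun v =>
  lim (series (fun m => ((h ^+ m)%:C * E_coef m u v : R[i]^o)) @ \oo).

Definition fourier_coef f (rs : 'cV[int]_n * 'cV[int]_n) : R[i] :=
  torus_ip f (fourier_mode rs).

(* T_{E_I(f)} for f = sum_{r,s} lambda_{r,s} F_{r,s}: on the finite-dimensional
   space H0 this is the unconditional sum over Z^n x Z^n of the operators
   lambda_{r,s} T_{E_I(F_{r,s})} with the formal variable evaluated at 1/k. *)
Definition toeplitz_E (k : nat) f :
    ('cV[R]_(n + n) -> R[i]) -> ('cV[R]_(n + n) -> R[i]) :=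
  fun s => xget (fun=> 0) [set p | H0 Z k p /\
    (fun A : {fset 'cV[int]_n * 'cV[int]_n} =>
       let e := p \- (fun v => partial_sum (fun rs => fourier_coef f rs *
                   toeplitz k (E_eval (k%:R^-1) (fourier_mode rs)) s v) A) in
       section_ip Z k e e : R[i]^o) @ totally --> (0 : R[i]^o)].

Definition HS_ip (k : nat)
    (A B : ('cV[R]_(n + n) -> R[i]) -> ('cV[R]_(n + n) -> R[i])) : R[i] :=
  hilbert_schmidt (H0 Z k) (section_ip Z k) A B.

End Toeplitz.

Lemma cexpD (R : realType) (z w : R[i]) : cexp (z + w) = cexp z * cexp w.
Proof.
case: z w => a b [c d]; rewrite /cexp /= expRD cosD sinD.
by apply/eqP; rewrite eq_complex /=; apply/andP; split; apply/eqP; ring.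
Qed.

Lemma cexp0 (R : realType) : cexp (0 : R[i]) = 1.
Proof. by rewrite /cexp /= expR0 cos0 sin0 mulr1 mulr0. Qed.

Lemma cexp_periodic (R : realType) (m : int) :
  cexp (2 * pi%:C * 'i%C * m%:~R : R[i]) = 1.
Proof.
have H (p : nat) : cexp (2 * pi%:C * 'i%C * p%:R : R[i]) = 1.
  elim: p => [|p IH]; first by rewrite mulr0 cexp0.
  rewrite -[p.+1]addn1 natrD mulrDr cexpD IH mul1r mulr1 /cexp.
  have -> : (2 * pi%:C * 'i%C : R[i]) = 0 +i* (pi *+ 2).
    apply/eqP; rewrite eq_complex /=; apply/andP; split; apply/eqP; ring.
  by rewrite /= cos2pi sin2pi expR0 mul1r mulr0.
case: m => p; first exact: H.
rewrite NegzE mulrNz mulrN.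
apply: (mulrI (x := cexp (2 * pi%:C * 'i%C * p.+1%:R))).
  by rewrite H unitr1.
by rewrite -cexpD subrr cexp0 H mulr1.
Qed.

Lemma dotDl (R : pzRingType) n (u u' v : 'cV[R]_n) :
  dot (u + u') v = dot u v + dot u' v.
Proof. by rewrite /dot linearD mulmxDl mxE. Qed.

Lemma dotDr (R : pzRingType) n (u v v' : 'cV[R]_n) :
  dot u (v + v') = dot u v + dot u v'.
Proof. by rewrite /dot mulmxDr mxE. Qed.

Lemma dotE (R : pzRingType) n (u v : 'cV[R]_n) :
  dot u v = \sum_i u i 0 * v i 0.
Proof. by rewrite /dot mxE; apply: eq_bigr => i _; rewrite mxE. Qed.

Lemma dotC (R : comPzRingType) n (u v : 'cV[R]_n) : dot u v = dot v u.
Proof. by rewrite !dotE; apply: eq_bigr => i _; rewrite mulrC. Qed.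

Section Multipliers.
Context {R : realType} {n : nat}.
Variables (Z : 'M[R[i]]_n).

Lemma multiplier_x (i : 'I_n) z : multiplier Z (delta_mx (lshift n i) 0) z = 1.
Proof.
rewrite /multiplier; set b := map_mx _ _.
have -> : b = 0.
  by apply/colP => j; rewrite !mxE eq_rlshift.
by rewrite mulmx0 /dot trmx0 !mul0mx !mxE !mulr0 oppr0 addr0 cexp0.
Qed.

Lemma multiplier_y (i : 'I_n) z : multiplier Z (delta_mx (rshift n i) 0) z =
  cexp (- (2 * pi%:C * 'i%C * z i 0) - pi%:C * 'i%C * Z i i).
Proof.
rewrite /multiplier; set b := map_mx _ _.
have -> : b = delta_mx i 0.
  by apply/colP => j; rewrite !mxE eq_rshift andbT; case: eqP.
rewrite /dot trmx_delta -!rowE -colE !mxE. by [].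
Qed.

Lemma multiplierD (l l' : 'cV[int]_(n + n)) (v : 'cV[R]_(n + n)) : Z^T = Z ->
  multiplier Z (l + l') (zcoord Z v) =
  multiplier Z l' (zcoord Z (v + map_mx intr l)) * multiplier Z l (zcoord Z v).
Proof.
move=> ZT; rewrite /multiplier -cexpD.
set b := map_mx intr (dsubmx l); set b' := map_mx intr (dsubmx l').
have -> : map_mx intr (dsubmx (l + l')) = b + b' :> 'cV[R[i]]_n.
  by rewrite linearD map_mxD.
set z := zcoord Z v.
have -> : zcoord Z (v + map_mx intr l) = z + map_mx intr (usubmx l) + Z *m b.
  have E m (A : 'cV[int]_m) : complex_mx (map_mx intr A) = map_mx intr A :> 'cV[R[i]]_m.
    by apply/colP => j; rewrite !mxE rmorph_int.
  rewrite /z /zcoord !linearD /= -map_usubmx -map_dsubmx /complex_mx !map_mxD.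
  by rewrite mulmxDr -!/(complex_mx _) !E !addrA; congr (_ + _); rewrite addrAC.
have Eint : dot b' (map_mx intr (usubmx l))
    = (dot (dsubmx l') (usubmx l))%:~R :> R[i].
  rewrite !dotE rmorph_sum; apply: eq_bigr => j _.
  by rewrite /b' [LHS]mulrC !mxE -intrM mulrC.
have Esym : dot b (Z *m b') = dot b' (Z *m b).
  by rewrite dotC /dot trmx_mul ZT mulmxA.
have P := cexp_periodic R (- dot (dsubmx l') (usubmx l)).
rewrite -[LHS]mulr1 -[X in _ * X]P -cexpD; congr cexp.
rewrite mulmxDr !dotDl !dotDr Eint Esym mulrNz.
move: (dot b z) (dot b' z) (dot b (Z *m b)) (dot b' (Z *m b)) (dot b' (Z *m b'))
  (_%:~R) (pi%:C) ('i%C) => ? ? ? ? ? ? ? ?; ring.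
Qed.
End Multipliers.

Lemma derive_line (R : realType) d (u : 'cV[R]_d -> R) (e x : 'cV[R]_d)
    (g : R -> R) dg :
  (forall t : R, u (t *: e + x) = g t) -> is_derive (0 : R) (1 : R) g dg ->
  'D_e u x = dg.
Proof.
move=> ug [_ <-]; rewrite /derive.
have -> : u x = g 0 by rewrite -ug scale0r add0r.
suff -> : (fun h : R => h^-1 *: ((u \o shift x) (h *: e) - g 0)) =
  (fun h : R => h^-1 *: ((g \o shift 0) (h *: 1) - g 0)) by [].
by apply/funext => t /=; rewrite ug addr0 /GRing.scale /= mulr1.
Qed.

Lemma is_derive_wave (R : realType) (a b t c : R) :
  is_derive (0 : R) (1 : R) (fun h => a * cos (t + h * c) + b * sin (t + h * c))
    (c * (b * cos t - a * sin t)).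
Proof.
have dl : is_derive (0 : R) 1 (fun h : R => t + h * c) c.
  have -> : (fun h : R => t + h * c) = cst t + id * cst c by [].
  by apply: is_derive_eq; rewrite add0r scaler0 add0r /GRing.scale /= mulr1.
have e0 : t + 0 * c = t by rewrite mul0r addr0.
have dc : is_derive (0 : R) 1 (fun h : R => cos (t + h * c)) (- sin t * c).
  apply: (@is_derive1_comp R cos (fun h : R => t + h * c)); rewrite e0.
  exact: is_derive_cos.
have ds : is_derive (0 : R) 1 (fun h : R => sin (t + h * c)) (cos t * c).
  apply: (@is_derive1_comp R sin (fun h : R => t + h * c)); rewrite e0.
  exact: is_derive_sin.
have -> : (fun h : R => a * cos (t + h * c) + b * sin (t + h * c)) =
  a \*: (fun h : R => cos (t + h * c)) + b \*: (fun h : R => sin (t + h * c)) by [].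
apply: is_derive_eq; rewrite /GRing.scale /=.
by move: (cos t) (sin t) => ? ?; ring.
Qed.

Lemma partial_deriv_mode (R : realType) n (c : R[i]) rs (j : 'I_(n + n)) :
  partial_deriv j (fun v => c * fourier_mode rs v) =
  (fun v => 2 * pi%:C * 'i%C * ((col_mx rs.1 rs.2) j 0)%:~R * c
            * fourier_mode rs v) :> ('cV[R]_(n + n) -> R[i]).
Proof.
apply/funext => v; rewrite /partial_deriv.
set m : int := col_mx rs.1 rs.2 j 0.
pose th (w : 'cV[R]_(n + n)) : R := 2 * pi * (dot (usubmx w) (map_mx intr rs.1)
               + dot (map_mx intr rs.2) (dsubmx w)).
have modeE w : fourier_mode rs w = cos (th w) +i* sin (th w).
  rewrite /fourier_mode /cexp /= !mul0r !mul1r ?subr0 ?addr0 ?add0r ?mulr0 ?subr0.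
  by rewrite expR0 !mul1r -/(th w).
have thE t : th (t *: delta_mx j 0 + v) = th v + t * (2 * pi * m%:~R).
  have Eu : usubmx (t *: delta_mx j 0 + v) = t *: usubmx (delta_mx j 0) + usubmx v.
    by apply/colP => i; rewrite !mxE.
  have Ed : dsubmx (t *: delta_mx j 0 + v) = t *: dsubmx (delta_mx j 0) + dsubmx v.
    by apply/colP => i; rewrite !mxE.
  rewrite /th Eu Ed dotDl dotDr.
  suff E : dot (t *: usubmx (delta_mx j 0)) (map_mx intr rs.1) +
             dot (map_mx intr rs.2) (t *: dsubmx (delta_mx j 0)) = t * m%:~R :> R.
    by rewrite addrACA E; ring.
  have S : \sum_k (col_mx rs.1 rs.2 k 0)%:~R * (t * (k == j)%:R) = t * m%:~R :> R.
    rewrite (bigD1 j) //= eqxx mulr1 big1 ?addr0 1?mulrC // => i /negPf ->.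
    by rewrite !mulr0.
  rewrite dotC !dotE -S big_split_ord /=; congr (_ + _); apply: eq_bigr => i _.
    by rewrite col_mxEu !mxE andbT.
  by rewrite col_mxEd !mxE andbT.
case: c => a b.
have -> : 'D_(delta_mx j 0) (fun w => complex.Re ((a +i* b) * fourier_mode rs w)) v
  = (2 * pi * m%:~R) * ((- b) * cos (th v) - a * sin (th v)).
  apply: derive_line; last exact: is_derive_wave.
  by move=> t; rewrite modeE thE /= mulNr.
have -> : 'D_(delta_mx j 0) (fun w => complex.Im ((a +i* b) * fourier_mode rs w)) v
  = (2 * pi * m%:~R) * (a * cos (th v) - b * sin (th v)).
  apply: derive_line; last exact: is_derive_wave.
  by move=> t; rewrite modeE thE /= addrC.
rewrite modeE -[m%:~R in RHS](rmorph_int (real_complex R)).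
rewrite -[2 in RHS](rmorph_nat (real_complex R)).
apply/eqP; rewrite eq_complex /=; apply/andP; split; apply/eqP; ring.
Qed.

Lemma cvg_mulr_const (K : numFieldType) (u : nat -> K^o) (l c : K^o) :
  u @ \oo --> l -> (fun k => u k * c : K^o) @ \oo --> (l * c : K^o).
Proof. exact: cvgMr_tmp. Qed.

Section FourierModes.
Context {R : realType} {n : nat}.
Variables (Z : 'M[R[i]]_n) (rs : 'cV[int]_n * 'cV[int]_n).
Let tpi : R[i] := 2 * pi%:C * 'i%C.

Definition eta_exponent : R :=
  let r : 'cV[R]_n := map_mx intr rs.1 in
  let q := map_mx intr rs.2 - re_mx Z *m r in
  dot q (invmx (im_mx Z) *m q) + dot r (im_mx Z *m r).

Definition eta (k : nat) : R := expR (- (pi / (2 * k%:R) * eta_exponent)).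

Lemma dx_mode c i : dx i (fun v => c * fourier_mode rs v) =
  (fun v => tpi * ((map_mx intr rs.1 : 'cV[R]_n) i 0)%:C * c * fourier_mode rs v).
Proof.
rewrite /dx partial_deriv_mode; apply/funext => v.
by rewrite col_mxEu mxE rmorph_int.
Qed.

Lemma dy_Xdx_mode c i : dy_Xdx Z i (fun v => c * fourier_mode rs v) =
  (fun v => tpi * ((map_mx intr rs.2 - re_mx Z *m map_mx intr rs.1) i 0)%:C * c
            * fourier_mode rs v).
Proof.
apply/funext => v; rewrite /dy_Xdx partial_deriv_mode.
under eq_bigr do rewrite dx_mode.
rewrite col_mxEd -[_%:~R](rmorph_int (real_complex R)) !mxE rmorphB rmorph_sum /=.
rewrite mulrBr !mulrBl; congr (_ - _).
rewrite mulr_sumr !mulr_suml; apply: eq_bigr => j _.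
by rewrite rmorphM /=; ring.
Qed.

Lemma laplace_mode c : laplace Z (fun v => c * fourier_mode rs v) =
  (fun v => (- (2 * pi * eta_exponent)%:C * c) * fourier_mode rs v).
Proof.
apply/funext => v; rewrite /laplace.
set q := map_mx intr rs.2 - re_mx Z *m map_mx intr rs.1.
set r : 'cV[R]_n := map_mx intr rs.1.
have quadE (A : 'M[R]_n) (u : 'cV[R]_n) :
    (dot u (A *m u))%:C = \sum_i \sum_j (A i j)%:C * ((u i 0)%:C * (u j 0)%:C).
  rewrite dotE rmorph_sum; apply: eq_bigr => i _.
  rewrite mxE mulr_sumr rmorph_sum; apply: eq_bigr => j _ /=.
  by rewrite !rmorphM; ring.
have -> : \sum_i \sum_j (invmx (im_mx Z) i j)%:C *
    dy_Xdx Z i (dy_Xdx Z j (fun v => c * fourier_mode rs v)) v =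
    tpi ^+ 2 * c * fourier_mode rs v * (dot q (invmx (im_mx Z) *m q))%:C.
  rewrite quadE mulr_sumr; apply: eq_bigr => i _.
  rewrite mulr_sumr; apply: eq_bigr => j _.
  by rewrite !dy_Xdx_mode -/q; ring.
have -> : \sum_i \sum_j (im_mx Z i j)%:C *
    dx i (dx j (fun v => c * fourier_mode rs v)) v =
    tpi ^+ 2 * c * fourier_mode rs v * (dot r (im_mx Z *m r))%:C.
  rewrite quadE mulr_sumr; apply: eq_bigr => i _.
  rewrite mulr_sumr; apply: eq_bigr => j _.
  by rewrite !dx_mode -/r; ring.
have tpi2 : ((2 * pi)^-1)%:C * tpi ^+ 2 = - (2 * pi)%:C.
  have p0 : (2 * pi)%:C != 0 :> R[i].
    by rewrite (fmorph_eq0 (real_complex R)) mulf_neq0 ?pnatr_eq0 // gt_eqF ?pi_gt0.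
  rewrite (fmorphV (real_complex R)) /tpi exprMn sqr_i mulrN1 mulrN.
  have -> : 2 * pi%:C = (2 * pi)%:C :> R[i].
    by rewrite (rmorphM (real_complex R)) (rmorph_nat (real_complex R)).
  by rewrite expr2 mulKf.
rewrite -mulrDr -(rmorphD (real_complex R)) -/eta_exponent.
rewrite [(2 * pi * _)%:C](rmorphM (real_complex R)) /= -mulNr -tpi2.
by rewrite /eta_exponent -/q -/r; ring.
Qed.

Lemma E_coef_mode m v : E_coef Z m (fourier_mode rs) v =
  ((pi / 2 * eta_exponent) ^+ m / m`!%:R)%:C * fourier_mode rs v.
Proof.
have iterE : iter m (laplace Z) (fourier_mode rs) =
    (fun v => (- (2 * pi * eta_exponent)%:C) ^+ m * fourier_mode rs v).
  elim: m => [|m IH]; first by apply/funext => w; rewrite /= expr0 mul1r.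
  by rewrite iterS IH laplace_mode exprS.
rewrite /E_coef iterE mulrA; congr (_ * _).
rewrite mulrAC -exprMn [RHS](rmorphM (real_complex R)) (rmorphXn (real_complex R)).
rewrite (fmorphV (real_complex R)) (rmorph_nat (real_complex R)); congr (_ ^+ _ / _).
rewrite mulrNN -(rmorph_nat (real_complex R)) -(fmorphV (real_complex R)).
by rewrite -(rmorphM (real_complex R)) /=; congr (_ %:C); field.
Qed.

Lemma real_complex_cvg (u : nat -> R) (l : R) :
  u @ \oo --> l -> ((fun k => (u k)%:C : R[i]^o) @ \oo --> (l%:C : R[i]^o)).
Proof.
move=> /cvgrPdist_lt ul; apply/cvgrPdist_lt => e e0.
have e_re : e = (complex.Re e)%:C by rewrite RRe_real ?gtr0_real.
have re0 : 0 < complex.Re e by rewrite -(ltcR 0) -e_re.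
near=> k; rewrite -(rmorphB (real_complex R)) e_re /= normc_def /= expr0n addr0.
by rewrite sqrtr_sqr ltcR; near: k; exact: ul.
Unshelve. all: by end_near.
Qed.

Lemma E_eval_mode h v : E_eval Z h (fourier_mode rs) v =
  (expR (pi / 2 * h * eta_exponent))%:C * fourier_mode rs v.
Proof.
rewrite /E_eval.
have -> : series (fun m => (h ^+ m)%:C * E_coef Z m (fourier_mode rs) v : R[i]^o) =
    (fun N => (series (exp_coeff (pi / 2 * h * eta_exponent)) N)%:C *
              fourier_mode rs v : R[i]^o).
  apply/funext => N; rewrite /series /= (rmorph_sum (real_complex R)) mulr_suml.
  apply: eq_bigr => m _; rewrite E_coef_mode mulrA -(rmorphM (real_complex R)) /=.
  congr (_ %:C * _); rewrite /exp_coeff /= mulrA -exprMn; congr (_ ^+ _ / _).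
  by ring.
apply: (@cvg_lim R[i]^o); first exact: norm_hausdorff.
set x := pi / 2 * h * eta_exponent.
have H1 : series (exp_coeff x) @ \oo --> expR x by exact: is_cvg_series_exp_coeff.
have H2 := real_complex_cvg H1.
have H3 := @cvg_mulr_const R[i] _ _ (fourier_mode rs v) H2.
apply: H3.
Qed.

Lemma E_eval_fourier_mode k :
  E_eval Z (k%:R^-1) (fourier_mode rs) =
  (fun v => ((eta k)^-1)%:C * fourier_mode rs v).
Proof.
apply/funext => v; rewrite E_eval_mode /eta expRN invrK.
by congr (_ %:C * _); congr expR; rewrite invfM mulrA.
Qed.

End FourierModes.

(* Main.v *)
Require Import Defs.
From HB Require Import structures.
From mathcomp Require Import all_boot all_order all_algebra.
From mathcomp Require Import finmap complex ring lra.
From mathcomp Require Import all_classical all_reals all_analysis.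
From mathcomp Require Import showcase.summability.

(** The sections of the k-th power of the bundle are the holomorphic functions on C^n
    with a prescribed quasi-periodicity. Such a function is periodic in the real
    directions, hence has a Fourier expansion; moving the contour of integration
    ([contour_shift]) and using the remaining quasi-periods relates the coefficients at
    m and m + k b by a nonzero factor. So the theta series of the classes mod k span
    the space of sections ([H0_span]).

    Multiplying the theta function of s by the mode F_{r,s'} and pairing it with another
    theta function gives zero unless the latter belongs to the class of s + r, and
    otherwise, by completing the square in a Gaussian integral, the number
    eta_k(r,s') times a phase times a constant N > 0 that does not depend on the
    classes ([matrix_element]). For the zero mode this says that the theta functions
    form an orthogonal basis with equal norms. The factor eta_k is what the operator
    E_I removes: in this basis the operator of a renormalized mode is a shift of the
    classes with phases of modulus 1 ([toeplitz_mode]).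

    Consequently k^-n times the Hilbert-Schmidt product of two renormalized modes has
    modulus at most 1, and for k large it is 1 or 0 according to whether the modes are
    equal: different modes shift by different classes, or differ by a nontrivial
    character of (Z/k)^n, whose sum vanishes ([mode_pair_cvg]).

    For smooth f and g the Fourier coefficients are absolutely summable
    ([smooth_fcoef_summ]), so that the operators are absolutely convergent series of
    renormalized modes ([toeplitz_E_matrix]). Dominated convergence for series, applied
    to the modes of f and then to those of g ([half_pair_cvg], [HS_cvg]), gives the limit
    sum of the products of the coefficients of f with the conjugates of those of g,
    which is the inner product of f and g by Parseval's identity ([fourier_parseval]).

    All integrals are iterated one-dimensional integrals of continuous functions. For
    these, Fubini's theorem ([int01_swap]), the uniqueness of Fourier coefficients
    ([fourier_unique]) and Cauchy's theorem for parallelograms ([goursat]) have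
    elementary proofs. *)

Set Implicit Arguments.
Unset Strict Implicit.
Unset Printing Implicit Defensive.

Import Order.TTheory GRing.Theory Num.Theory.
Import numFieldNormedType.Exports.

Local Open Scope classical_set_scope.
Local Open Scope complex_scope.
Local Open Scope ring_scope.

(** * Complex numbers and continuity *)

Section ComplexModulus.
Variable R : realType.
Implicit Types z w : R[i].

(** The norm of R[i] takes its values in R[i]; every estimate below compares real numbers. *)
Definition cabs z : R := complex.Re `|z|.

Lemma cabsE z : (cabs z)%:C = `|z|.
Proof. by rewrite /cabs normc_def. Qed.

Lemma cabs_ge0 z : 0 <= cabs z.
Proof. by rewrite -lecR cabsE normr_ge0. Qed.

Lemma cabs0 : cabs 0 = 0 :> R.
Proof. by apply: complexI; rewrite cabsE normr0. Qed.

Lemma cabs_eq0 z : cabs z = 0 -> z = 0.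
Proof. by move=> h; apply/eqP; rewrite -normr_eq0 -cabsE h. Qed.

Lemma cabsM z w : cabs (z * w) = cabs z * cabs w.
Proof. by apply: complexI; rewrite rmorphM /= !cabsE normrM. Qed.

Lemma cabsX z m : cabs (z ^+ m) = cabs z ^+ m.
Proof. by apply: complexI; rewrite rmorphXn /= !cabsE normrX. Qed.

Lemma cabsV z : cabs z^-1 = (cabs z)^-1.
Proof. by apply: complexI; rewrite fmorphV /= !cabsE normfV. Qed.

Lemma cabsD z w : cabs (z + w) <= cabs z + cabs w.
Proof. by rewrite -lecR rmorphD /= !cabsE ler_normD. Qed.

Lemma cabsN z : cabs (- z) = cabs z.
Proof. by apply: complexI; rewrite !cabsE normrN. Qed.

Lemma cabsB z w : cabs (z - w) <= cabs z + cabs w.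
Proof. by rewrite (le_trans (cabsD _ _)) // cabsN. Qed.

Lemma cabs_sub z w : cabs (z - w) = cabs (w - z).
Proof. by rewrite -cabsN opprB. Qed.

Lemma cabs_triangle x z w : cabs (z - w) <= cabs (z - x) + cabs (x - w).
Proof. by rewrite -lecR rmorphD /= !cabsE ler_distD. Qed.

Lemma cabsJ z : cabs z^*%C = cabs z.
Proof. by apply: complexI; rewrite !cabsE normcJ. Qed.

Lemma cabs_real (x : R) : cabs x%:C = `|x|.
Proof.
by apply: complexI; rewrite cabsE normc_def /= expr0n addr0 sqrtr_sqr.
Qed.

Lemma cabs_nat m : cabs m%:R = m%:R :> R.
Proof. by rewrite -(rmorph_nat (real_complex R)) cabs_real ger0_norm. Qed.

Lemma Re_le_cabs z : `|complex.Re z| <= cabs z.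
Proof. by rewrite -lecR cabsE normc_ge_Re. Qed.

Lemma Im_le_cabs z : `|complex.Im z| <= cabs z.
Proof.
rewrite -normrN -ReiNIm (le_trans (Re_le_cabs _)) // cabsM.
suff -> : cabs 'i%C = 1 :> R by rewrite mulr1.
by rewrite /cabs normc_def /= expr0n expr1n add0r sqrtr1.
Qed.

Lemma cabsi : cabs 'i%C = 1 :> R.
Proof. by rewrite /cabs normc_def /= expr0n expr1n add0r sqrtr1. Qed.

Lemma cabs_le_ReIm z : cabs z <= `|complex.Re z| + `|complex.Im z|.
Proof.
rewrite {1}[z]complexE (le_trans (cabsD _ _)) // cabsM !cabs_real.
by rewrite cabsi mul1r.
Qed.

Lemma cabs_sum (I : Type) (r : seq I) (P : pred I) (F : I -> R[i]) :
  cabs (\sum_(i <- r | P i) F i) <= \sum_(i <- r | P i) cabs (F i).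
Proof.
elim/big_rec2: _ => [|i y1 y2 _ le12]; first by rewrite cabs0.
by rewrite (le_trans (cabsD _ _)) // lerD2l.
Qed.

Lemma cabs_cexp z : cabs (cexp z) = expR (complex.Re z).
Proof.
case: z => a b; rewrite /cabs normc_def /cexp /=.
rewrite !exprMn -mulrDr cos2Dsin2 mulr1 sqrtr_sqr ger0_norm //.
Qed.

Lemma complex_eq z w : complex.Re z = complex.Re w ->
  complex.Im z = complex.Im w -> z = w.
Proof. by case: z w => a b [c d] /= -> ->. Qed.

Lemma cReD z w : complex.Re (z + w) = complex.Re z + complex.Re w.
Proof. by case: z w => ? ? []. Qed.
Lemma cImD z w : complex.Im (z + w) = complex.Im z + complex.Im w.
Proof. by case: z w => ? ? []. Qed.
Lemma cReN z : complex.Re (- z) = - complex.Re z.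
Proof. by case: z. Qed.
Lemma cImN z : complex.Im (- z) = - complex.Im z.
Proof. by case: z. Qed.
Lemma cReM z w : complex.Re (z * w) =
  complex.Re z * complex.Re w - complex.Im z * complex.Im w.
Proof. by case: z w => ? ? []. Qed.
Lemma cImM z w : complex.Im (z * w) =
  complex.Re z * complex.Im w + complex.Im z * complex.Re w.
Proof. by case: z w => ? ? []. Qed.
Lemma cReJ z : complex.Re z^*%C = complex.Re z. Proof. by case: z. Qed.
Lemma cImJ z : complex.Im z^*%C = - complex.Im z. Proof. by case: z. Qed.
Lemma conjc_mul z w : (z * w)^*%C = z^*%C * w^*%C.
Proof. exact: rmorphM. Qed.

Lemma Re_sum (I : Type) (r : seq I) (P : pred I) (F : I -> R[i]) :
  complex.Re (\sum_(i <- r | P i) F i) = \sum_(i <- r | P i) complex.Re (F i).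
Proof. by elim/big_rec2: _ => // i y1 y2 _ <-; rewrite cReD. Qed.
Lemma Im_sum (I : Type) (r : seq I) (P : pred I) (F : I -> R[i]) :
  complex.Im (\sum_(i <- r | P i) F i) = \sum_(i <- r | P i) complex.Im (F i).
Proof. by elim/big_rec2: _ => // i y1 y2 _ <-; rewrite cImD. Qed.

Lemma cvg_cabsP (T : Type) (F : set_system T) (FF : Filter F) (u : T -> R[i]) (l : R[i]) :
  ((u : T -> R[i]^o) @ F --> (l : R[i]^o)) <->
  (forall e : R, 0 < e -> \forall x \near F, cabs (u x - l) < e).
Proof.
split.
  move/cvgrPdist_lt => h e e0; have e0' : 0 < e%:C by rewrite (ltcR 0).
  have := h _ e0'; apply: filterS => x.
  by rewrite -cabsE ltcR cabs_sub.
move=> h; apply/cvgrPdist_lt => e e0.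
have eE : e = (complex.Re e)%:C by rewrite RRe_real ?gtr0_real.
have re0 : 0 < complex.Re e by rewrite -(ltcR 0) -eE.
have := h _ re0; apply: filterS => x; rewrite /= => hx.
move: hx; rewrite cabs_sub => hx; rewrite [X in _ < X]eE -cabsE ltcR //.
Qed.

Lemma cvg_ReIm (T : Type) (F : set_system T) (FF : Filter F) (u : T -> R[i]) (l : R[i]) :
  ((u : T -> R[i]^o) @ F --> (l : R[i]^o)) <->
  (((fun x => complex.Re (u x)) @ F --> complex.Re l) /\
   ((fun x => complex.Im (u x)) @ F --> complex.Im l)).
Proof.
split=> [/cvg_cabsP h|[/cvgrPdist_lt h1 /cvgrPdist_lt h2]].
  split; apply/cvgrPdist_lt => e /h; apply: filterS => x; rewrite cabs_sub;
    apply: le_lt_trans.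
    by rewrite -cReN -cReD Re_le_cabs.
  by rewrite -cImN -cImD Im_le_cabs.
apply/cvg_cabsP => e e0; have e2 : 0 < e / 2 by rewrite divr_gt0.
near=> x; rewrite cabs_sub (le_lt_trans (cabs_le_ReIm _)) //.
rewrite (splitr e) ltrD // ?cReD ?cImD ?cReN ?cImN; near: x; [exact: h1|exact: h2].
Unshelve. all: by end_near.
Qed.

End ComplexModulus.

Lemma cvg_sum_fun (T I : Type) (K : numFieldType) (V : normedModType K)
    (F : set_system T) (FF : Filter F) (r : seq I) (u : I -> T -> V) (l : I -> V) :
  (forall i, u i @ F --> l i) ->
  (fun x => \sum_(i <- r) u i x) @ F --> \sum_(i <- r) l i.
Proof.
move=> ul; elim: r => [|i r IH].
  rewrite big_nil (_ : (fun x => _) = cst 0); first exact: cvg_cst.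
  by apply/funext => x; rewrite big_nil.
rewrite big_cons (_ : (fun x => _) = u i \+ (fun x => \sum_(j <- r) u j x)).
  exact: cvgD.
by apply/funext => x; rewrite big_cons.
Qed.

Lemma continuous_sum_fun (T : topologicalType) (I : Type) (K : numFieldType)
    (V : normedModType K) (r : seq I) (u : I -> T -> V) :
  (forall i, continuous (u i)) -> continuous (fun x => \sum_(i <- r) u i x).
Proof. by move=> cu x; apply: cvg_sum_fun => i; exact: cu. Qed.

Lemma continuous_pair (T U V : topologicalType) (f : T -> U) (g : T -> V) :
  continuous f -> continuous g -> continuous (fun x => (f x, g x)).
Proof. by move=> cf cg x; apply: cvg_pair; [exact: cf|exact: cg]. Qed.

Lemma continuous_comp_fun (T U V : topologicalType) (f : T -> U) (g : U -> V) :
  continuous f -> continuous g -> continuous (fun x => g (f x)).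
Proof. by move=> cf cg x; apply: continuous_comp; [exact: cf|exact: cg]. Qed.
Arguments continuous_comp_fun {T U V} f g.

Lemma continuous_cst_fun (T U : topologicalType) (a : U) : continuous (fun _ : T => a).
Proof. by move=> x; exact: cvg_cst. Qed.

Lemma continuous_id_fun (T : topologicalType) : continuous (fun x : T => x).
Proof. by move=> x; exact: cvg_id. Qed.

Lemma continuous_fst (T U : topologicalType) : continuous (fun p : T * U => p.1).
Proof. by move=> x; exact: cvg_fst. Qed.

Lemma continuous_snd (T U : topologicalType) : continuous (fun p : T * U => p.2).
Proof. by move=> x; exact: cvg_snd. Qed.

Section ContinuousArith.
Variables (T : topologicalType) (K : numFieldType).
Implicit Types f g : T -> K^o.

Lemma continuousD_fun f g : continuous f -> continuous g ->
  continuous (fun x => f x + g x : K^o).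
Proof. by move=> cf cg x; apply: cvgD; [exact: cf|exact: cg]. Qed.

Lemma continuousM_fun f g : continuous f -> continuous g ->
  continuous (fun x => f x * g x : K^o).
Proof. by move=> cf cg x; apply: cvgM; [exact: cf|exact: cg]. Qed.

Lemma continuousZ_fun (c : K) f : continuous f -> continuous (fun x => c * f x : K^o).
Proof. by move=> cf; apply: continuousM_fun => //; exact: continuous_cst_fun. Qed.

Lemma continuousN_fun f : continuous f -> continuous (fun x => - f x : K^o).
Proof. by move=> cf x; apply: cvgN; exact: cf. Qed.

Lemma continuousB_fun f g : continuous f -> continuous g ->
  continuous (fun x => f x - g x : K^o).
Proof. by move=> cf cg x; apply: cvgB; [exact: cf|exact: cg]. Qed.
End ContinuousArith.

(** * Unconditional sums *)

Local Open Scope fset_scope.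
Local Open Scope ring_scope.

Section UnconditionalSums.
Variables (R : realType) (I : choiceType).
Implicit Types (f g : I -> R[i]) (a : I -> R) (A B : {fset I}).

(** Summability is stated as a bound on the finite partial sums: over an arbitrary index
    type, such as the lattice of Fourier indices, no enumeration has to be chosen. *)
Definition summ a := exists M : R, forall A, \sum_(i <- A) a i <= M.

(** Convergence along the directed set of finite subsets, in epsilon form. *)
Definition has_sum f (l : R[i]) := forall e : R, 0 < e ->
  exists A, forall B, A `<=` B -> cabs (\sum_(i <- B) f i - l) < e.

Lemma sum_fset_split (V : zmodType) (F : I -> V) A B : A `<=` B ->
  \sum_(i <- B) F i = \sum_(i <- A) F i + \sum_(i <- B | i \notin A) F i.
Proof.
move=> AB; rewrite (bigID (mem A)) /=; congr (_ + _).
rewrite [LHS]big_mkcond -(big_fset_incl _ AB) /=.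
  by apply: eq_big_seq => i ->.
by move=> x _ /negPf ->.
Qed.

Lemma summ_tail a : (forall i, 0 <= a i) -> summ a -> forall e : R, 0 < e ->
  exists A, forall B, \sum_(i <- B | i \notin A) a i < e.
Proof.
move=> a0 [M aM] e e0.
pose S := [set x | exists A, x = \sum_(i <- A) a i].
have S_sup : has_sup S.
  split; first by exists (\sum_(i <- fset0) a i), fset0.
  by exists M => _ [A ->].
have [_ [A ->] hA] := sup_adherent e0 S_sup.
exists A => B; have AAB : A `<=` A `|` B by rewrite fsubsetUl.
have : \sum_(i <- A `|` B) a i <= sup S.
  by apply: ub_le_sup; [exact: S_sup.2|exists (A `|` B)].
rewrite (sum_fset_split _ AAB) => h.
suff : \sum_(i <- B | i \notin A) a i <= \sum_(i <- A `|` B | i \notin A) a i.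
  by move=> h2; lra.
rewrite [leLHS]big_mkcond [leRHS]big_mkcond /=.
rewrite (sum_fset_split _ (fsubsetUr A B)) lerDl sumr_ge0 // => i _.
by case: ifP.
Qed.

Lemma summ_le a b : (forall i, a i <= b i) -> summ b -> summ a.
Proof.
by move=> ab [M bM]; exists M => A; apply: le_trans (bM A); exact: ler_sum.
Qed.

Lemma summZ c a : 0 <= c -> summ a -> summ (fun i => c * a i).
Proof.
by move=> c0 [M aM]; exists (c * M) => A; rewrite -mulr_sumr ler_wpM2l.
Qed.

Lemma has_sum_uniq f l l' : has_sum f l -> has_sum f l' -> l = l'.
Proof.
move=> h h'; apply/eqP; rewrite -subr_eq0; apply/eqP/cabs_eq0/eqP.
rewrite eq_le cabs_ge0 andbT leNgt; apply/negP => e0.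
have e2 : 0 < cabs (l - l') / 2 by rewrite divr_gt0.
have [A hA] := h _ e2; have [A' hA'] := h' _ e2.
have := cabs_triangle (\sum_(i <- A `|` A') f i) l l'.
have := hA _ (fsubsetUl A A'); have := hA' _ (fsubsetUr A A').
rewrite (cabs_sub l (\sum_(i <- _) _)) => ? ? ?; lra.
Qed.

Lemma has_sumD f g l l' : has_sum f l -> has_sum g l' ->
  has_sum (fun i => f i + g i) (l + l').
Proof.
move=> h h' e e0; have e2 : 0 < e / 2 by rewrite divr_gt0.
have [A hA] := h _ e2; have [A' hA'] := h' _ e2.
exists (A `|` A') => B; rewrite fsubUset => /andP[/hA ? /hA' ?].
by rewrite big_split opprD addrACA (le_lt_trans (cabsD _ _)) //; lra.
Qed.

Lemma has_sumZ c f l : has_sum f l -> has_sum (fun i => c * f i) (c * l).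
Proof.
move=> h e e0; have c0 : 0 < cabs c + 1 by rewrite ltr_wpDl // cabs_ge0.
have [A hA] := h _ (divr_gt0 e0 c0).
exists A => B /hA; rewrite -mulr_sumr -mulrBr cabsM ltr_pdivlMr // => hB.
apply: le_lt_trans hB; rewrite mulrC ler_wpM2l ?cabs_ge0 //.
by rewrite lerDl.
Qed.

Lemma has_sum_morph (phi : {additive R[i] -> R[i]}) (c : R) f l :
  (forall z, cabs (phi z) <= c * cabs z) ->
  has_sum f l -> has_sum (phi \o f) (phi l).
Proof.
move=> hphi h e e0; have c0 : 0 < `|c| + 1 by rewrite ltr_wpDl.
have [A hA] := h _ (divr_gt0 e0 c0).
exists A => B /hA; rewrite -raddf_sum -raddfB ltr_pdivlMr // => hB.
apply: le_lt_trans hB; apply: le_trans (hphi _) _.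
rewrite mulrC ler_wpM2l ?cabs_ge0 // (le_trans (ler_norm _)) // lerDl //.
Qed.

Lemma has_sum_conj f l : has_sum f l -> has_sum (fun i => (f i)^*%C) l^*%C.
Proof.
apply: (@has_sum_morph (@conjc R) 1) => z; by rewrite mul1r cabsJ.
Qed.

(** The supremum of the partial sums is the sum: a finite set that comes close to it stays
    close when it is enlarged. *)
Lemma has_sum_ge0 a : (forall i, 0 <= a i) -> summ a ->
  exists l : R, has_sum (fun i => (a i)%:C) l%:C.
Proof.
move=> a0 [M aM]; pose S := [set x | exists A, x = \sum_(i <- A) a i].
have S_sup : has_sup S.
  split; first by exists (\sum_(i <- fset0) a i), fset0.
  by exists M => _ [A ->].
exists (sup S) => e e0; have [_ [A ->] hA] := sup_adherent e0 S_sup.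
exists A => B AB; rewrite -rmorph_sum -rmorphB cabs_real.
have h : \sum_(i <- B) a i <= sup S.
  by apply: ub_le_sup; [exact: S_sup.2|exists B].
have h2 : \sum_(i <- A) a i <= \sum_(i <- B) a i.
  by rewrite (sum_fset_split _ AB) lerDl sumr_ge0.
by rewrite ler0_norm ?subr_le0 //; lra.
Qed.

(** Write the real series as the difference of the nonnegative series of |a| + a and of
    |a|. *)
Lemma has_sum_real a : summ (fun i => `|a i|) ->
  exists l : R, has_sum (fun i => (a i)%:C) l%:C.
Proof.
move=> [M aM].
have [||l hl] := @has_sum_ge0 (fun i => `|a i| + a i).
- by move=> i; rewrite -lerBlDl add0r lerNl ler_normr lexx orbT.
- exists (M + M) => A; rewrite big_split lerD // (le_trans _ (aM A)) //.
  by apply: ler_sum => i _; rewrite ler_norm.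
have [||l' hl'] := @has_sum_ge0 (fun i => `|a i|).
- by [].
- by exists M.
exists (l - l'); have h := has_sumD hl (has_sumZ (-1) hl').
have -> : (fun i => (a i)%:C) = (fun i => (`|a i| + a i)%:C + -1 * `|a i|%:C).
  apply/funext => i; rewrite -[-1](rmorphN1 (real_complex R)).
  by rewrite -(rmorphM (real_complex R)) -rmorphD /=; congr (_ %:C); ring.
have -> : (l - l')%:C = l%:C + -1 * l'%:C by rewrite rmorphB mulN1r.
exact: h.
Qed.

Lemma has_sum_ex f : summ (fun i => cabs (f i)) -> exists l, has_sum f l.
Proof.
move=> h.
have [|l hl] := @has_sum_real (fun i => complex.Re (f i)).
  by apply: summ_le h => i; exact: Re_le_cabs.
have [|l' hl'] := @has_sum_real (fun i => complex.Im (f i)).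
  by apply: summ_le h => i; exact: Im_le_cabs.
exists (l%:C + 'i%C * l'%:C).
have -> : f = (fun i => (complex.Re (f i))%:C + 'i%C * (complex.Im (f i))%:C).
  by apply/funext => i; rewrite -complexE.
exact: has_sumD hl (has_sumZ 'i%C hl').
Qed.

Definition tsum f : R[i] := xget 0 [set l | has_sum f l].

Lemma tsumP f : summ (fun i => cabs (f i)) -> has_sum f (tsum f).
Proof. by move=> /has_sum_ex [l hl]; apply: (xgetPex 0); exists l. Qed.

Lemma has_sum_tsum f l : has_sum f l -> tsum f = l.
Proof.
move=> h; apply: has_sum_uniq (h).
exact: (xgetPex (P := [set l | has_sum f l]) 0 (ex_intro _ l h)).
Qed.

Lemma has_sum_le (M : R) f l : has_sum f l ->
  (forall A, cabs (\sum_(i <- A) f i) <= M) -> cabs l <= M.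
Proof.
move=> h hM; rewrite leNgt; apply/negP => lM.
have e0 : 0 < cabs l - M by rewrite subr_gt0.
have [A hA] := h _ e0; have := hA _ (fsubset_refl A).
have := cabs_triangle (\sum_(i <- A) f i) l 0; rewrite !subr0 cabs_sub.
by have := hM A; move=> ? ? ?; lra.
Qed.

Lemma has_sum_abs_le (M : R) f l : has_sum f l ->
  (forall A, \sum_(i <- A) cabs (f i) <= M) -> cabs l <= M.
Proof.
move=> h hM; apply: (has_sum_le h) => A.
exact: le_trans (cabs_sum _ _ _) (hM A).
Qed.

Lemma has_sum_supp (A : {fset I}) f : (forall i, i \notin A -> f i = 0) ->
  has_sum f (\sum_(i <- A) f i).
Proof.
move=> h e e0; exists A => B AB.
by rewrite (sum_fset_split _ AB) [X in _ + X - _]big1 ?addr0 ?subrr ?cabs0.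
Qed.

(** The error made by stopping at A is controlled by the tail of the majorant, with the
    same bound for all the series that it dominates. *)
Lemma has_sum_tail f l (a : I -> R) (A : {fset I}) (e : R) :
  has_sum f l -> (forall i, cabs (f i) <= a i) ->
  (forall B, \sum_(i <- B | i \notin A) a i <= e) ->
  cabs (l - \sum_(i <- A) f i) <= e.
Proof.
move=> h fa hA; apply/ler_addgt0Pr => d d0.
have [B hB] := h _ d0; have := hB _ (fsubsetUl B A).
rewrite (sum_fset_split _ (fsubsetUr B A)).
set s := \sum_(_ <- A) _; set t := \sum_(_ <- _ | _) _ => h2.
have ht : cabs t <= e.
  apply: le_trans (hA (B `|` A)); apply: le_trans (cabs_sum _ _ _) _.
  exact: ler_sum.
have -> : l - s = (l - (s + t)) + t by ring.
rewrite addrC (le_trans (cabsD _ _)) // addrC.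
by rewrite cabs_sub in h2; lra.
Qed.

(** Tannery's theorem. A finite set carries all but a third of epsilon of the majorant,
    hence of every series of the family; on that set the convergence is that of a finite
    sum. *)
Lemma has_sum_dominated (T : Type) (F : set_system T) (FF : Filter F)
    (f : T -> I -> R[i]) (s : T -> R[i]) f0 s0 (a : I -> R) :
  (forall i, 0 <= a i) -> summ a -> (\forall x \near F, forall i, cabs (f x i) <= a i) ->
  (forall i, cabs (f0 i) <= a i) ->
  (\forall x \near F, has_sum (f x) (s x)) -> has_sum f0 s0 ->
  (forall i, (f ^~ i : T -> R[i]^o) @ F --> (f0 i : R[i]^o)) ->
  (s : T -> R[i]^o) @ F --> (s0 : R[i]^o).
Proof.
move=> a0 sa fa f0a fs f0s ff0; apply/cvg_cabsP => e e0.
have e3 : 0 < e / 3 by rewrite divr_gt0.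
have [A hA] := summ_tail a0 sa e3.
have hA' B : \sum_(i <- B | i \notin A) a i <= e / 3 by exact: ltW.
have lim : (fun x => \sum_(i <- A) f x i : R[i]^o) @ F --> (\sum_(i <- A) f0 i : R[i]^o).
  exact: cvg_sum_fun.
have /cvg_cabsP/(_ _ e3) h1 := lim.
near=> x.
have h2 : cabs (s0 - \sum_(i <- A) f0 i) <= e / 3 by exact: (has_sum_tail f0s f0a).
have h3 : cabs (s x - \sum_(i <- A) f x i) <= e / 3.
  by apply: has_sum_tail hA'; near: x.
have h4 : cabs (\sum_(i <- A) f x i - \sum_(i <- A) f0 i) < e / 3 by near: x.
have := cabs_triangle (\sum_(i <- A) f x i) (s x) s0.
have := cabs_triangle (\sum_(i <- A) f0 i) (\sum_(i <- A) f x i) s0.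
rewrite (cabs_sub (\sum_(i <- A) f0 i) s0) => ? ?; lra.
Unshelve. all: by end_near.
Qed.

End UnconditionalSums.

(** Both directions move finite sets along h: the indices outside the range of h carry
    zero terms, and injectivity prevents collisions. *)
Lemma has_sum_reindex (R : realType) (I J : choiceType) (h : J -> I)
    (f : I -> R[i]) (l : R[i]) : injective h ->
  (forall i, (forall j, i <> h j) -> f i = 0) ->
  has_sum f l <-> has_sum (f \o h) l.
Proof.
move=> hinj hsupp.
have E (B : {fset J}) : \sum_(j <- B) (f \o h) j = \sum_(i <- [fset h j | j in B]) f i.
  by rewrite big_imfset //= => ? ? _ _; exact: hinj.
split=> H e /H [A hA].
  pose B := [fset j in pmap (fun i => match pselect (exists j, i = h j) with
    | left p => Some (projT1 (cid p)) | right _ => None end) (A : seq I)].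
  have hB j : h j \in A -> j \in B.
    move=> jA; rewrite inE mem_pmap; apply/mapP; exists (h j) => //.
    case: pselect => [p|]; last by case; exists j.
    by case: cid => j' /= /hinj ->.
  exists B => B' BB'.
  rewrite E; set D := [fset h j | j in B'].
  have -> : \sum_(i <- D) f i = \sum_(i <- A `|` D) f i.
    apply: big_fset_incl; first exact: fsubsetUr.
    move=> i; rewrite in_fsetU => /orP[iA|-> //] iD; apply: hsupp => j ij.
    move/negP: iD; apply; apply/imfsetP; exists j => //=.
    by apply: (fsubsetP BB'); apply: hB; rewrite -ij.
  by apply: hA; exact: fsubsetUl.
exists [fset h j | j in A] => B AB.
pose B' := [fset j in pmap (fun i => match pselect (exists j, i = h j) with
    | left p => Some (projT1 (cid p)) | right _ => None end) (B : seq I)].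
have hB' j : (j \in B') = (h j \in B).
  rewrite inE mem_pmap; apply/mapP/idP => [[i iB]|jB].
    by case: pselect => // p; case: cid => j' /= ij [->]; rewrite -ij.
  exists (h j) => //; case: pselect => [p|]; last by case; exists j.
  by case: cid => j' /= /hinj ->.
have := hA B'; rewrite E.
have -> : \sum_(i <- [fset h j | j in B']) f i = \sum_(i <- B) f i.
  apply: big_fset_incl.
    by apply/fsubsetP => i /imfsetP [j /=]; rewrite hB' => ? ->.
  move=> i iB /negP iN; apply: hsupp => j ij; apply: iN.
  by apply/imfsetP; exists j => //=; rewrite hB' -ij.
apply; apply/fsubsetP => j jA; rewrite hB'; apply: (fsubsetP AB).
by apply/imfsetP; exists j.
Qed.

Lemma summ_inj (R : realType) (I J : choiceType) (h : J -> I) (a : I -> R) :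
  injective h -> summ a -> summ (a \o h).
Proof.
move=> hinj [M aM]; exists M => A; apply: le_trans (aM [fset h j | j in A]).
by rewrite big_imfset //= => ? ? _ _; exact: hinj.
Qed.

Lemma has_sum_real_ge (R : realType) (I : choiceType) (f : I -> R[i]) (l : R[i]) (g : I -> R) i0 :
  has_sum f l -> (forall i, f i = (g i)%:C) -> (forall i, 0 <= g i) ->
  complex.Im l = 0 /\ g i0 <= complex.Re l.
Proof.
move=> h fg g0.
have key (e : R) : 0 < e -> `|complex.Im l| < e /\ g i0 < complex.Re l + e.
  move=> e0; have [A hA] := h _ e0.
  have := hA (i0 |` A)%fset (fsubsetUr _ _).
  have -> : \sum_(i <- (i0 |` A)%fset) f i = (\sum_(i <- (i0 |` A)%fset) g i)%:C.
    by rewrite rmorph_sum; apply: eq_bigr => i _; rewrite fg.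
  set s := \sum_(i <- _) g i => hs.
  have gs : g i0 <= s.
    rewrite /s (big_fsetD1 i0) ?fset1U1 //= lerDl sumr_ge0 // => i _; exact: g0.
  have h1 := le_lt_trans (Im_le_cabs _) hs; have h2 := le_lt_trans (le_trans (ler_norm _) (Re_le_cabs _)) hs.
  rewrite cImD cImN /= sub0r normrN in h1; rewrite cReD cReN /= in h2.
  by split=> //; lra.
split; last by apply/ler_addgt0Pr => e /key [_ /ltW].
apply/eqP; rewrite -normr_eq0 eq_le normr_ge0 andbT leNgt; apply/negP => /key [].
by rewrite ltxx.
Qed.

Local Close Scope fset_scope.

(** * Integration over the unit interval *)

Section UnitInterval.
Variable R : realType.
Notation mu := (@lebesgue_measure R).
Implicit Types f g : R -> R.

Definition int01 f : R := \int[mu]_(t in `[0, 1]) f t.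

Lemma cont_integrable01 f : continuous f -> mu.-integrable `[0%R, 1%R] (EFin \o f).
Proof.
move=> cf; apply: continuous_compact_integrable; first exact: segment_compact.
exact: continuous_subspaceT.
Qed.

Lemma int01D f g : continuous f -> continuous g ->
  int01 (fun t => f t + g t) = int01 f + int01 g.
Proof. by move=> cf cg; apply: RintegralD => //; exact: cont_integrable01. Qed.

Lemma int01Z c f : continuous f -> int01 (fun t => c * f t) = c * int01 f.
Proof. by move=> cf; apply: RintegralZl => //; exact: cont_integrable01. Qed.

Lemma int01_cst c : int01 (fun=> c) = c.
Proof.
rewrite /int01 Rintegral_cst //=.
have -> : mu `[0, 1] = 1%E.
  have := @lebesgue_measure_itv R `[0, 1]; rewrite /= lte_fin ltr01 => ->.
  by rewrite oppr0 adde0.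
by rewrite mulr1.
Qed.

Lemma int01_le f g : continuous f -> continuous g ->
  (forall t, 0 <= t <= 1 -> f t <= g t) -> int01 f <= int01 g.
Proof.
move=> cf cg fg; apply: le_Rintegral => //; exact: cont_integrable01.
Qed.

Lemma le_normr_int01 f : continuous f -> `|int01 f| <= int01 (fun t => `|f t|).
Proof. by move=> cf; apply: le_normr_Rintegral => //; exact: cont_integrable01. Qed.

(** The hypothesis is local in s and near the limit; compactness of the unit interval
    makes it uniform, by the tube lemma, and the integral of a uniform bound is that
    bound. *)
Lemma int01_param_cvg (T : Type) (F : set_system T) (FF : Filter F)
   (u : T -> R -> R) (u0 : R -> R) :
  (forall x, continuous (u x)) -> continuous u0 ->
  (forall e : R, 0 < e -> forall s : R, 0 <= s <= 1 -> \forall s' \near s & x \near F,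
     `|u0 s' - u x s'| <= e) ->
  (fun x => int01 (u x)) @ F --> int01 u0.
Proof.
move=> cu cu0 H; apply/cvgrPdist_le => e e0.
have /compact_near_coveringP/(_ T F (fun x s => `|u0 s - u x s| <= e) FF) K :=
  @segment_compact R 0 1.
have {K} : \forall x \near F, forall s, 0 <= s <= 1 -> `|u0 s - u x s| <= e.
  have K' := K _; apply: filterS (K' _) => [x Hx s hs|s].
    by apply: Hx; rewrite /= in_itv.
  by rewrite /= in_itv /= => hs; exact: H.
apply: filterS => x Kx.
have -> : int01 u0 - int01 (u x) = int01 (fun t => u0 t + -1 * u x t).
  rewrite int01D // ?int01Z // ?mulN1r //.
  by move=> t; apply: cvgM; [exact: cvg_cst|exact: cu].
have c1 : continuous (fun t => u0 t + -1 * u x t).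
  by move=> t; apply: cvgD; [exact: cu0|apply: cvgM; [exact: cvg_cst|exact: cu]].
rewrite (le_trans (le_normr_int01 c1)) // -[leRHS](int01_cst e).
apply: int01_le.
- by move=> t; apply: cvg_norm; exact: c1.
- by move=> t; exact: cvg_cst.
- by move=> t ht; rewrite mulN1r; apply: Kx.
Qed.

(** The primitive is taken from a base point b to the left of all the points where it is
    used, so that no endpoint of an interval needs a special treatment. *)
Lemma primitive f (b : R) : continuous f ->
  exists F : R -> R, forall x : R, b < x -> is_derive x (1 : R) F (f x).
Proof.
move=> cf; exists (fun x => \int[mu]_(t in `[b, x]) f t) => x bx.
have [||d e] := @continuous_FTC1_closed R f b x (x + 1) _ _ bx (cf x).
- by rewrite ltrDl.
- apply: continuous_compact_integrable; first exact: segment_compact.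
  exact: continuous_subspaceT.
- by apply: DeriveDef => //; rewrite -derive1E.
Qed.

Lemma FTC01 F f : continuous f ->
  (forall t : R, 0 <= t <= 1 -> is_derive t (1 : R) F (f t)) -> int01 f = F 1 - F 0.
Proof.
move=> cf dF.
have dc t : 0 <= t <= 1 -> {for t, continuous F}.
  by move=> /dF [h _]; apply/differentiable_continuous/derivable1_diffP.
rewrite /int01 /Rintegral (@continuous_FTC2 R f F) //.
- exact: continuous_subspaceT.
- split.
  + by move=> t; rewrite in_itv /= => /andP[/ltW t0 /ltW t1]; have [] := dF t; rewrite ?t0.
  + by apply: cvg_at_right_filter; apply: dc; rewrite lexx ler01.
  + by apply: cvg_at_left_filter; apply: dc; rewrite lexx ler01.
- move=> t; rewrite in_itv /= => /andP[/ltW t0 /ltW t1].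
  by rewrite derive1E; have [] := dF t; rewrite ?t0.
Qed.

(** The change of variables for affine maps, read off from a primitive. *)
Lemma int_line f F (b a h : R) : continuous f -> b < a -> b < a + h ->
  (forall x : R, b < x -> is_derive x (1 : R) F (f x)) ->
  h * int01 (fun s => f (a + h * s)) = F (a + h) - F a.
Proof.
move=> cf ba bah dF.
have ca : continuous (fun s => a + h * s).
  by move=> s; apply: cvgD; [exact: cvg_cst|apply: cvgM; [exact: cvg_cst|exact: cvg_id]].
have cc : continuous (fun s => f (a + h * s)).
  by move=> s; apply: (@continuous_comp _ _ _ (fun s => a + h * s)); [exact: ca|exact: cf].
have -> : F (a + h) - F a = (fun s => F (a + h * s)) 1 - (fun s => F (a + h * s)) 0.
  by rewrite mulr1 mulr0 addr0.
have ch : continuous (fun s => h * f (a + h * s)).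
  by move=> s; apply: cvgM; [exact: cvg_cst|exact: cc].
rewrite -int01Z //; apply: (@FTC01 (fun s => F (a + h * s)) _ ch) => t /andP[t0 t1].
have bt : b < a + h * t.
  have [h0|h0] := leP 0 h; first by rewrite (lt_le_trans ba) // lerDl mulr_ge0.
  rewrite (lt_le_trans bah) // lerD2l -[leLHS]mulr1 ler_nM2l //.
have d1 : is_derive t (1 : R) (fun s => a + h * s) h.
  have -> : (fun s : R => a + h * s) = cst a + h \*: id by [].
  by apply: is_derive_eq; rewrite add0r /GRing.scale /= mulr1.
have d2 := dF _ bt.
have := @is_derive1_comp R F (fun s => a + h * s) t _ _ d2 d1; rewrite mulrC; exact.
Qed.

Lemma int01_split f : continuous f ->
  int01 f = 2^-1 * int01 (fun t => f (2^-1 * t)) + 2^-1 * int01 (fun t => f (2^-1 + 2^-1 * t)).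
Proof.
move=> cf; have [F dF] := primitive (-1) cf.
rewrite (@int_line f F (-1) 2^-1 2^-1) //; try lra.
have -> : (fun t => f (2^-1 * t)) = (fun t => f (0 + 2^-1 * t)).
  by apply/funext => t; rewrite add0r.
rewrite (@int_line f F (-1) 0 2^-1) //; try lra.
have -> : int01 f = 1 * int01 (fun t => f (0 + 1 * t)).
  by rewrite mul1r; congr int01; apply/funext => t; rewrite add0r mul1r.
rewrite (@int_line f F (-1) 0 1) //; try lra.
have -> : 2^-1 + 2^-1 = 1 :> R by lra.
by rewrite !add0r; lra.
Qed.

(** The difference is the integral of f from 1 to 1 + h minus that from 0 to h, and these
    agree by periodicity. *)
Lemma int01_translate f h : continuous f -> (forall t, f (t + 1) = f t) ->
  int01 (fun t => f (t + h)) = int01 f.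
Proof.
move=> cf pf; pose b := Num.min 0 h - 1.
have b0 : b < 0 by rewrite /b; case: (ltP 0 h) => ?; lra.
have bh : b < h by rewrite /b; case: (ltP 0 h) => ?; lra.
have [F dF] := primitive b cf.
have -> : int01 (fun t => f (t + h)) = 1 * int01 (fun t => f (h + 1 * t)).
  by rewrite mul1r; congr int01; apply/funext => t; rewrite mul1r addrC.
rewrite (@int_line f F b h 1) //; try lra.
have -> : int01 f = 1 * int01 (fun t => f (0 + 1 * t)).
  by rewrite mul1r; congr int01; apply/funext => t; rewrite add0r mul1r.
rewrite (@int_line f F b 0 1) //; try lra.
have h1 : h * int01 (fun s => f (1 + h * s)) = F (1 + h) - F 1.
  by rewrite (@int_line f F b) //; lra.
have h2 : h * int01 (fun s => f (0 + h * s)) = F (0 + h) - F 0.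
  by rewrite (@int_line f F b) //; lra.
have h3 : (fun s => f (1 + h * s)) = (fun s => f (0 + h * s)).
  by apply/funext => s; rewrite add0r addrC pf.
rewrite h3 in h1; rewrite add0r in h2; rewrite add0r (addrC h).
by lra.
Qed.

Lemma int01_param_continuous (T : topologicalType) (u : T -> R -> R) :
  continuous (fun p : T * R => u p.1 p.2) -> continuous (fun x => int01 (u x)).
Proof.
move=> cu x; have cx y : continuous (u y).
  apply: (continuous_comp_fun (fun s => (y, s)) (fun p : T * R => u p.1 p.2)) => //.
  by apply: continuous_pair; [exact: continuous_cst_fun|exact: continuous_id_fun].
apply: int01_param_cvg => //.
move=> e e0 s _; have e2 : 0 < e / 2 by rewrite divr_gt0.
  have /cvgrPdist_lt/(_ _ e2) [[A B] /= [xA sB] AB] := cu (x, s).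
  exists (B, A) => //= -[s' x'] /= [Bs' Ax'].
  have h1 := AB (x', s') (conj Ax' Bs').
  have h2 := AB (x, s') (conj (nbhs_singleton xA) Bs').
  rewrite /= in h1 h2.
  rewrite (le_trans (ler_distD (u x s) _ _)) // (splitr e) lerD ?ltW //.
  by rewrite distrC.
Qed.

(** Both iterated integrals are the value at 1 of a primitive of x |-> int01 (u x): the
    function x |-> x * int01 (fun t => int01 (fun s => u (x * s) t)) is one, since its
    increments are again integrals of u over segments. Thus Fubini's theorem for
    continuous functions needs no product measure. *)
Lemma int01_swap (u : R -> R -> R) : continuous (fun p : R * R => u p.1 p.2) ->
  int01 (fun s => int01 (u s)) = int01 (fun t => int01 (u ^~ t)).
Proof.
move=> cu; pose A x := x * int01 (fun t => int01 (fun s => u (x * s) t)).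
have cs t : continuous (u ^~ t).
  apply: (continuous_comp_fun (fun s => (s, t)) (fun p : R * R => u p.1 p.2)) => //.
  by apply: continuous_pair; [exact: continuous_id_fun|exact: continuous_cst_fun].
have c3 x : continuous (fun p : (R * R) * R => u (x + p.1.1 * p.2) p.1.2).
  apply: (continuous_comp_fun (fun p : (R * R) * R => (x + p.1.1 * p.2, p.1.2))
     (fun p : R * R => u p.1 p.2)) => //.
  have c1 := continuous_comp_fun _ _ (@continuous_fst (R * R)%type R) (@continuous_fst R R).
  have c2 := continuous_comp_fun _ _ (@continuous_fst (R * R)%type R) (@continuous_snd R R).
  apply: continuous_pair; last exact: c2.
  apply: continuousD_fun; first exact: continuous_cst_fun.
  by apply: continuousM_fun; [exact: c1|exact: continuous_snd].
have c2 x : continuous (fun p : R * R => int01 (fun s => u (x + p.1 * s) p.2)).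
  exact: (@int01_param_continuous (R * R)%type (fun (p : R * R) s => u (x + p.1 * s) p.2) (c3 x)).
have c1 (x : R) : continuous (fun h : R => int01 (fun t => int01 (fun s => u (x + h * s) t))).
  exact: (@int01_param_continuous R (fun h t => int01 (fun s => u (x + h * s) t)) (c2 x)).
have c2' (x h : R) : continuous (fun t : R => int01 (fun s => u (x + h * s) t)).
  apply: (continuous_comp_fun (fun t : R => (h, t))
     (fun p : R * R => int01 (fun s => u (x + p.1 * s) p.2))); last exact: c2.
  by apply: continuous_pair; [exact: continuous_cst_fun|exact: continuous_id_fun].
have dA (x : R) : is_derive x (1 : R) A (int01 (u x)).
  have key (h : R) : A (x + h) - A x = h * int01 (fun t => int01 (fun s => u (x + h * s) t)).
    pose G (y t : R) := int01 (fun s => u (0 + y * s) t).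
    have AE y : A y = int01 (fun t => y * G y t).
      rewrite int01Z; last exact: c2'.
      rewrite /A; congr (_ * int01 _); apply/funext => t.
      by congr int01; apply/funext => s; rewrite add0r.
    have cG y : continuous (fun t => y * G y t) by apply: continuousZ_fun; exact: c2'.
    transitivity (int01 (fun t => (x + h) * G (x + h) t + -1 * (x * G x t))).
      have := int01Z (-1) (cG x); rewrite mulN1r !AE => <-.
      by rewrite -int01D //; exact: continuousZ_fun.
    rewrite -(int01Z _ (c2' x h)); congr int01; apply/funext => t.
    pose b := Num.min 0 (Num.min x (x + h)) - 1.
    have [b0 bx bxh] : [/\ b < 0, b < x & b < x + h].
      have E1 : Num.min 0 (Num.min x (x + h)) <= 0 by rewrite ge_min lexx.
      have E2 : Num.min 0 (Num.min x (x + h)) <= x by rewrite !ge_min lexx orbT.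
      have E3 : Num.min 0 (Num.min x (x + h)) <= x + h by rewrite !ge_min lexx !orbT.
      by rewrite /b; split; lra.
    have [F dF] := primitive b (cs t).
    have h1 := int_line (a := 0) (h := x + h) (cs t) b0.
    have h2 := int_line (a := 0) (h := x) (cs t) b0.
    rewrite add0r in h1; rewrite add0r in h2.
    rewrite (h1 F bxh dF) (h2 F bx dF) (int_line (cs t) bx bxh dF).
    ring.
  have lim : (fun h : R => h^-1 *: ((A \o shift x) (h *: 1) - A x)) @ 0^' --> int01 (u x).
    have /continuous_withinNx := c1 x 0.
    have -> : int01 (fun t => int01 (fun s => u (x + 0 * s) t)) = int01 (u x).
      congr int01; apply/funext => t.
      under [X in int01 X]funext do rewrite mul0r addr0.
      exact: int01_cst.
    move=> c; apply: cvg_trans c; apply: near_eq_cvg.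
    near=> h.
    have -> : (A \o shift x) (h *: 1) = A (x + h).
      by rewrite /= /GRing.scale /= mulr1 addrC.
    rewrite key /GRing.scale /= mulKf //.
    by near: h; exact: nbhs_dnbhs_neq.
  apply: DeriveDef; first by apply/cvg_ex; exists (int01 (u x)).
  exact: cvg_lim lim.
have -> := FTC01 (@int01_param_continuous R u cu) (fun t _ => dA t).
rewrite /A mul0r subr0 mul1r; congr int01; apply/funext => t.
by congr int01; apply/funext => s; rewrite mul1r.
Unshelve. all: by end_near.
Qed.
End UnitInterval.

(** * Integration over the unit cube *)

Section MatrixTopology.

(** The topology of matrices is the product topology; this form allows an arbitrary
    codomain. *)
Lemma continuous_mx (T X : topologicalType) (m n : nat) (f : T -> 'M[X]_(m, n)) :
  (forall i j, continuous (fun x => f x i j)) -> continuous f.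
Proof.
move=> cf x A [P MP sub]; rewrite /= nbhs_filterE.
have : \forall y \near x, forall i j, P i j (f y i j).
  apply: filter_forall => i; apply: filter_forall => j.
  exact: (cf i j x _ (MP i j)).
by apply: filterS => y Py; exact: sub.
Qed.

Lemma continuous_coord (X : topologicalType) (m n : nat) i j :
  continuous (fun M : 'M[X]_(m, n) => M i j).
Proof.
move=> M A MA; exists (fun i' j' => [set y | (i', j') = (i, j) -> A y]).
  move=> i' j'; have [e|ne] := pselect ((i', j') = (i, j)).
    by case: e => -> ->; apply: filterS MA => y Ay _.
  by apply: filterS filterT => y _ /ne.
by move=> N /(_ i j); apply.
Qed.

End MatrixTopology.

Section ConsVector.
Variables (X : Type) (d : nat).

(** The constructor by which the integral over the cube recurses, as a function of a
    number and a vector. *)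
Definition vcons (t : X) (v : 'cV[X]_d) : 'cV[X]_d.+1 := col_mx (const_mx t : 'cV_1) v.

Lemma vcons0 t v : vcons t v 0 0 = t.
Proof.
transitivity ((const_mx t : 'cV_1) (0 : 'I_1) (0 : 'I_1)); last by rewrite mxE.
rewrite -[RHS](col_mxEu _ v); congr (col_mx _ _ _ _); exact/val_inj.
Qed.

Lemma vconsS t v (i : 'I_d) : vcons t v (rshift 1 i) 0 = v i 0.
Proof. exact: (col_mxEd (const_mx t : 'cV_1) v i 0). Qed.

Lemma vcons_ind (P : 'I_d.+1 -> Prop) :
  P 0 -> (forall i : 'I_d, P (rshift 1 i)) -> forall i, P i.
Proof.
move=> P0 PS i; case: (@split_ordP 1 d i) => j ->; last exact: PS.
by have -> : lshift d j = 0 by apply/val_inj; case: j => -[].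
Qed.

Lemma vconsP (v : 'cV[X]_d.+1) : v = vcons (v 0 0) (\col_i v (rshift 1 i) 0).
Proof.
apply/colP; apply: vcons_ind => [|i]; first by rewrite vcons0.
by rewrite vconsS mxE.
Qed.

Lemma vcons_eq (v w : 'cV[X]_d.+1) : v 0 0 = w 0 0 ->
  (forall i : 'I_d, v (rshift 1 i) 0 = w (rshift 1 i) 0) -> v = w.
Proof. by move=> h0 hS; apply/colP; exact: vcons_ind. Qed.

End ConsVector.

Lemma vconsD (V : nmodType) d (s t : V) (v w : 'cV[V]_d) :
  vcons (s + t) (v + w) = vcons s v + vcons t w.
Proof.
apply: vcons_eq => [|i]; first by rewrite [RHS]mxE !vcons0.
by rewrite [RHS]mxE !vconsS mxE.
Qed.

Lemma vconsE (R : pzSemiRingType) d (t : R) (v : 'cV[R]_d) :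
  col_mx (t%:M : 'cV_1) v = vcons t v.
Proof. by congr col_mx; apply/matrixP => i j; rewrite !mxE !ord1 eqxx. Qed.

Lemma continuous_vcons (T X : topologicalType) d (f : T -> X) (g : T -> 'cV[X]_d) :
  continuous f -> continuous g -> continuous (fun x => vcons (f x) (g x)).
Proof.
move=> cf cg; apply: continuous_mx => i j; rewrite ord1.
elim/vcons_ind: i => [|i].
  by under [X in continuous X]funext do rewrite vcons0.
under [X in continuous X]funext do rewrite vconsS.
exact: (continuous_comp_fun _ _ cg (@continuous_coord X d 1 i 0)).
Qed.

Lemma continuous_col_mx (T X : topologicalType) m d (f : T -> 'cV[X]_m) (g : T -> 'cV[X]_d) :
  continuous f -> continuous g -> continuous (fun x => col_mx (f x) (g x)).
Proof.
move=> cf cg; apply: continuous_mx => i j; rewrite ord1.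
case: (split_ordP i) => k ->.
  under [X in continuous X]funext do rewrite col_mxEu.
  exact: (continuous_comp_fun _ _ cf (@continuous_coord X m 1 k 0)).
under [X in continuous X]funext do rewrite col_mxEd.
exact: (continuous_comp_fun _ _ cg (@continuous_coord X d 1 k 0)).
Qed.

(** Periodicity under the integer lattice, for functions of real as well as of complex
    vectors. *)
Definition zper (R : pzRingType) (X : Type) d (u : 'cV[R]_d -> X) :=
  forall (l : 'cV[int]_d) v, u (v + map_mx intr l) = u v.

Lemma vcons_shift (R : pzRingType) d (t : R) (v : 'cV[R]_d) (l : 'cV[int]_d) (a : int) :
  vcons (t + a%:~R) (v + map_mx intr l) = vcons t v + map_mx intr (vcons a l).
Proof.
rewrite vconsD; congr (_ + _).
apply: vcons_eq => [|i]; first by rewrite [RHS]mxE !vcons0.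
by rewrite [RHS]mxE !vconsS mxE.
Qed.

Lemma zper_slice (R : pzRingType) d (X : Type) (u : 'cV[R]_d.+1 -> X) t :
  zper u -> zper (fun v => u (vcons t v)).
Proof.
by move=> pu l v; rewrite -(addr0 t) -[X in t + X](mulr0z 1) vcons_shift pu mulr0z addr0.
Qed.

Lemma zper_slice1 (R : pzRingType) d (X : Type) (u : 'cV[R]_d.+1 -> X) t v :
  zper u -> u (vcons (t + 1) v) = u (vcons t v).
Proof.
move=> pu; rewrite -(pu (vcons 1 0) (vcons t v)) -vcons_shift; congr (u (vcons _ _)).
by apply/colP => i; rewrite !mxE addr0.
Qed.

Section CubeIntegral.
Variable R : realType.

Lemma cube_intS d (u : 'cV[R]_d.+1 -> R) :
  cube_int u = int01 (fun t => cube_int (fun v => u (vcons t v))).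
Proof.
rewrite /int01; congr (Rintegral _ _ _); apply/funext => t.
by congr cube_int; apply/funext => v; rewrite vconsE.
Qed.

Lemma continuous_slice d (X : topologicalType) (u : 'cV[R]_d.+1 -> X) t :
  continuous u -> continuous (fun v => u (vcons t v)).
Proof.
move=> cu; apply: (continuous_comp_fun (vcons t)) => //.
apply: continuous_vcons; [exact: continuous_cst_fun|exact: continuous_id_fun].
Qed.

Lemma continuous_slice2 d (X : topologicalType) (u : 'cV[R]_d.+1 -> X) :
  continuous u -> continuous (fun p : R * 'cV[R]_d => u (vcons p.1 p.2)).
Proof.
move=> cu; apply: (continuous_comp_fun (fun p : R * 'cV[R]_d => vcons p.1 p.2)) => //.
apply: continuous_vcons; [exact: continuous_fst|exact: continuous_snd].
Qed.

(** The dimension is removed one coordinate at a time; the statement has to be proved for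
    all parameter spaces at once, since the coordinate that is left becomes part of the
    parameter. *)
Lemma cube_int_param_continuous d (T : topologicalType) (u : T -> 'cV[R]_d -> R) :
  continuous (fun p : T * 'cV[R]_d => u p.1 p.2) ->
  continuous (fun x => cube_int (u x)).
Proof.
elim: d T u => [|d IH] T u cu.
  rewrite /=; apply: (continuous_comp_fun (fun x : T => (x, 0 : 'cV[R]_0))
    (fun p : T * 'cV[R]_0 => u p.1 p.2)) => //.
  by apply: continuous_pair; [exact: continuous_id_fun|exact: continuous_cst_fun].
under [X in continuous X]funext do rewrite cube_intS.
apply: (int01_param_continuous
  (u := fun x t => cube_int (fun v => u x (vcons t v)))).
apply: (IH (T * R)%type (fun (p : T * R) v => u p.1 (vcons p.2 v))).
apply: (continuous_comp_fun (fun p : T * R * 'cV[R]_d => (p.1.1, vcons p.1.2 p.2))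
  (fun p : T * 'cV[R]_d.+1 => u p.1 p.2)) => //.
have c1 := continuous_comp_fun _ _ (@continuous_fst (T * R)%type 'cV[R]_d) (@continuous_fst T R).
have c2 := continuous_comp_fun _ _ (@continuous_fst (T * R)%type 'cV[R]_d) (@continuous_snd T R).
apply: continuous_pair; first exact: c1.
by apply: continuous_vcons; [exact: c2|exact: continuous_snd].
Qed.

Lemma cube_int_slice_continuous d (u : 'cV[R]_d.+1 -> R) : continuous u ->
  continuous (fun t => cube_int (fun v => u (vcons t v))).
Proof.
move=> cu.
apply: (@cube_int_param_continuous d R (fun t v => u (vcons t v))).
exact: continuous_slice2.
Qed.

Lemma cube_intD d (u w : 'cV[R]_d -> R) : continuous u -> continuous w ->
  cube_int (fun v => u v + w v) = cube_int u + cube_int w.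
Proof.
elim: d u w => [//|d IH] u w cu cw; rewrite !cube_intS -int01D.
- by congr int01; apply/funext => t; rewrite IH //; exact: continuous_slice.
- exact: cube_int_slice_continuous.
- exact: cube_int_slice_continuous.
Qed.

Lemma cube_intZ d c (u : 'cV[R]_d -> R) : continuous u ->
  cube_int (fun v => c * u v) = c * cube_int u.
Proof.
elim: d u => [//|d IH] u cu; rewrite !cube_intS -int01Z.
- by congr int01; apply/funext => t; rewrite IH //; exact: continuous_slice.
- exact: cube_int_slice_continuous.
Qed.

Lemma cube_int_cst d c : cube_int (fun _ : 'cV[R]_d => c) = c.
Proof.
elim: d => [//|d IH]; rewrite cube_intS.
by under [X in int01 X]funext do rewrite IH; exact: int01_cst.
Qed.

Lemma cube_int_le d (u w : 'cV[R]_d -> R) : continuous u -> continuous w ->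
  (forall v : 'cV[R]_d, (forall i, 0 <= v i 0 <= 1) -> u v <= w v) -> cube_int u <= cube_int w.
Proof.
elim: d u w => [|d IH] u w cu cw uw; first by apply: uw => -[].
rewrite !cube_intS; apply: int01_le; do ?exact: cube_int_slice_continuous.
move=> t ht; apply: IH; do ?exact: continuous_slice.
by move=> v hv; apply: uw; apply: vcons_ind => [|i]; rewrite ?vcons0 ?vconsS.
Qed.

Lemma cube_int_swap01 d (u : R -> 'cV[R]_d -> R) :
  continuous (fun p : R * 'cV[R]_d => u p.1 p.2) ->
  cube_int (fun v => int01 (u ^~ v)) = int01 (fun t => cube_int (u t)).
Proof.
elim: d u => [//|d IH] u cu.
have cu3 : continuous (fun p : R * R * 'cV[R]_d => u p.1.2 (vcons p.1.1 p.2)).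
  apply: (continuous_comp_fun (fun p : R * R * 'cV[R]_d => (p.1.2, vcons p.1.1 p.2))
    (fun p : R * 'cV[R]_d.+1 => u p.1 p.2)) => //.
  have c1 := continuous_comp_fun _ _ (@continuous_fst (R * R)%type 'cV[R]_d) (@continuous_fst R R).
  have c2 := continuous_comp_fun _ _ (@continuous_fst (R * R)%type 'cV[R]_d) (@continuous_snd R R).
  apply: continuous_pair; first exact: c2.
  by apply: continuous_vcons; [exact: c1|exact: continuous_snd].
have cu2 s : continuous (fun p : R * 'cV[R]_d => u p.1 (vcons s p.2)).
  apply: (continuous_comp_fun (fun p : R * 'cV[R]_d => (p.1, vcons s p.2))
    (fun p : R * 'cV[R]_d.+1 => u p.1 p.2)) => //.
  apply: continuous_pair; first exact: continuous_fst.
  by apply: continuous_vcons; [exact: continuous_cst_fun|exact: continuous_snd].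
rewrite cube_intS.
transitivity (int01 (fun s => int01 (fun t => cube_int (fun v => u t (vcons s v))))).
  by congr int01; apply/funext => s; rewrite -(IH _ (cu2 s)).
rewrite (@int01_swap _ (fun s t => cube_int (fun v => u t (vcons s v)))).
  by congr int01; apply/funext => t; rewrite cube_intS.
exact: (@cube_int_param_continuous d (R * R)%type (fun (p : R * R) v => u p.2 (vcons p.1 v))).
Qed.

Lemma cube_int_swap m d (u : 'cV[R]_m -> 'cV[R]_d -> R) :
  continuous (fun p : 'cV[R]_m * 'cV[R]_d => u p.1 p.2) ->
  cube_int (fun v => cube_int (u ^~ v)) = cube_int (fun x => cube_int (u x)).
Proof.
elim: m u => [//|m IH] u cu; rewrite cube_intS.
have cu2 t : continuous (fun p : 'cV[R]_m * 'cV[R]_d => u (vcons t p.1) p.2).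
  apply: (continuous_comp_fun (fun p : 'cV[R]_m * 'cV[R]_d => (vcons t p.1, p.2))
    (fun p : 'cV[R]_m.+1 * 'cV[R]_d => u p.1 p.2)) => //.
  apply: continuous_pair; last exact: continuous_snd.
  by apply: continuous_vcons; [exact: continuous_cst_fun|exact: continuous_fst].
have cu3 : continuous (fun p : R * 'cV[R]_d * 'cV[R]_m => u (vcons p.1.1 p.2) p.1.2).
  apply: (continuous_comp_fun (fun p : R * 'cV[R]_d * 'cV[R]_m => (vcons p.1.1 p.2, p.1.2))
    (fun p : 'cV[R]_m.+1 * 'cV[R]_d => u p.1 p.2)) => //.
  have c1 := continuous_comp_fun _ _ (@continuous_fst (R * 'cV[R]_d)%type 'cV[R]_m) (@continuous_fst R 'cV[R]_d).
  have c2 := continuous_comp_fun _ _ (@continuous_fst (R * 'cV[R]_d)%type 'cV[R]_m) (@continuous_snd R 'cV[R]_d).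
  apply: continuous_pair; last exact: c2.
  by apply: continuous_vcons; [exact: c1|exact: continuous_snd].
transitivity (int01 (fun t => cube_int (fun v => cube_int (fun x => u (vcons t x) v)))).
  rewrite -cube_int_swap01; last first.
    exact: (@cube_int_param_continuous m (R * 'cV[R]_d)%type
      (fun (p : R * 'cV[R]_d) x => u (vcons p.1 x) p.2)).
  by congr cube_int; apply/funext => v; rewrite cube_intS.
by congr int01; apply/funext => t; exact: (IH (fun x v => u (vcons t x) v)).
Qed.

Lemma cube_int_col_mx m d (u : 'cV[R]_(m + d) -> R) :
  cube_int u = cube_int (fun x : 'cV[R]_m => cube_int (fun y : 'cV[R]_d => u (col_mx x y))).
Proof.
elim: m u => [|m IH] u.
  rewrite /=; congr cube_int; apply/funext => y; congr u.
  apply/colP => i; case: (@split_ordP 0 d i) => j ->; first by case: j.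
  by rewrite col_mxEd; congr (y _ _); apply/val_inj.
rewrite [LHS]cube_intS [RHS]cube_intS; congr int01; apply/funext => t.
rewrite IH; congr cube_int; apply/funext => x; congr cube_int; apply/funext => y.
by congr u; rewrite /vcons col_mxA castmx_id.
Qed.

Lemma cube_int_translate d (u : 'cV[R]_d -> R) (h : 'cV[R]_d) : continuous u -> zper u ->
  cube_int (fun v => u (v + h)) = cube_int u.
Proof.
elim: d u h => [|d IH] u h cu pu; first by rewrite /=; congr u; apply/colP => -[].
rewrite [h]vconsP; set h0 := h 0 0; set h' := \col__ _.
rewrite !cube_intS.
rewrite -(@int01_translate _ (fun t => cube_int (fun v => u (vcons t v))) h0).
- congr int01; apply/funext => t; rewrite -(IH (fun v => u (vcons (t + h0) v)) h').
  + by congr cube_int; apply/funext => v; rewrite vconsD.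
  + exact: continuous_slice.
  + exact: zper_slice.
- exact: cube_int_slice_continuous.
- by move=> t; congr cube_int; apply/funext => v; rewrite zper_slice1.
Qed.

(** In the direction of the derivative the integral is F 1 - F 0 for a periodic F;
    Fubini's theorem brings that direction to the front. *)
Lemma cube_int_deriv0 d (w w' : 'cV[R]_d -> R) (i : 'I_d) :
  continuous w -> continuous w' -> zper w ->
  (forall v (t : R), is_derive t (1 : R) (fun t => w (v + t *: delta_mx i 0)) (w' (v + t *: delta_mx i 0))) ->
  cube_int w' = 0.
Proof.
elim: d w w' i => [|d IH] w w' i; first by case: i.
elim/vcons_ind: i => [|i] cw cw' pw dw; rewrite cube_intS.
  rewrite -cube_int_swap01; last exact: continuous_slice2.
  rewrite -[RHS](cube_int_cst d 0); congr cube_int; apply/funext => v.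
  have E (t : R) : vcons t v = vcons 0 v + t *: delta_mx 0 0.
    apply: vcons_eq => [|j]; rewrite [RHS]mxE ?vcons0 ?vconsS [X in _ = _ + X]mxE mxE.
      by rewrite add0r mulr1.
    by rewrite (_ : (rshift 1 j == 0) = false) // mulr0 addr0.
  have cs : continuous (fun t => w' (vcons t v)).
    apply: (continuous_comp_fun (fun t => vcons t v)) => //.
    by apply: continuous_vcons; [exact: continuous_id_fun|exact: continuous_cst_fun].
  have ds (t : R) : is_derive t (1 : R) (fun t => w (vcons t v)) (w' (vcons t v)).
    rewrite (E t); have := dw (vcons 0 v) t; congr (is_derive _ _ _ _).
    by apply/funext => s; rewrite (E s).
  rewrite (FTC01 cs (fun t _ => ds t)) -[X in w (vcons X v) - _](add0r 1).
  by rewrite (zper_slice1 0 v pw) subrr.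
rewrite -[RHS](int01_cst 0); congr int01; apply/funext => t.
apply: (IH (fun v => w (vcons t v)) _ i).
- exact: continuous_slice.
- exact: continuous_slice.
- exact: zper_slice.
have E (v : 'cV[R]_d) (s : R) : vcons t (v + s *: delta_mx i 0) = vcons t v + s *: delta_mx (rshift 1 i) 0.
  apply: vcons_eq => [|j]; rewrite [RHS]mxE ?vcons0 ?vconsS [X in _ = _ + X]mxE mxE.
    by rewrite mulr0 addr0.
  by rewrite !mxE (inj_eq (@rshift_inj 1 d)).
move=> v s; rewrite E; have := dw (vcons t v) s; congr (is_derive _ _ _ _).
by apply/funext => x; rewrite E.
Qed.

End CubeIntegral.

(** * Complex valued functions on the torus *)

Section ComplexContinuity.
Variables (R : realType) (T : topologicalType).
Implicit Types u w : T -> R[i].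

(** Continuity into the complex line, with the regular structure fixed once and for all so
    that it need not be repeated at each use. *)
Definition ccont u := continuous (u : T -> R[i]^o).

Lemma ccontP u : ccont u <->
  continuous (fun x => complex.Re (u x)) /\ continuous (fun x => complex.Im (u x)).
Proof.
split=> [cu|[c1 c2] x].
  by split=> x; have /cvg_ReIm[] := cu x.
by apply/cvg_ReIm; split; [exact: c1|exact: c2].
Qed.

Lemma ccontD u w : ccont u -> ccont w -> ccont (fun x => u x + w x).
Proof. exact: continuousD_fun. Qed.
Lemma ccontM u w : ccont u -> ccont w -> ccont (fun x => u x * w x).
Proof. exact: continuousM_fun. Qed.
Lemma ccontB u w : ccont u -> ccont w -> ccont (fun x => u x - w x).
Proof. exact: continuousB_fun. Qed.
Lemma ccont_cst (c : R[i]) : ccont (fun=> c).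
Proof. exact: continuous_cst_fun. Qed.
Lemma ccontZ c u : ccont u -> ccont (fun x => c * u x).
Proof. exact: continuousZ_fun. Qed.

Lemma ccontX m u : ccont u -> ccont (fun x => u x ^+ m).
Proof.
move=> cu; elim: m => [|m IH]; first exact: ccont_cst.
by under [X in ccont X]funext do rewrite exprS; exact: ccontM.
Qed.

Lemma ccont_sum (I : Type) (r : seq I) (u : I -> T -> R[i]) :
  (forall i, ccont (u i)) -> ccont (fun x => \sum_(i <- r) u i x).
Proof. by move=> cu x; apply: cvg_sum_fun => i; exact: cu. Qed.

Lemma ccontJ u : ccont u -> ccont (fun x => (u x)^*%C).
Proof.
move=> /ccontP[c1 c2]; apply/ccontP; split.
  by under [X in continuous X]funext do rewrite cReJ.
under [X in continuous X]funext do rewrite cImJ.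
exact: (continuousN_fun c2).
Qed.

Lemma ccont_real (u : T -> R) : continuous u -> ccont (fun x => (u x)%:C).
Proof. by move=> cu; apply/ccontP; split=> //=; exact: continuous_cst_fun. Qed.

Lemma ccont_cexp u : ccont u -> ccont (fun x => cexp (u x)).
Proof.
move=> /ccontP[c1 c2].
have c3 := continuous_comp_fun _ _ c1 (@continuous_expR R).
apply/ccontP; split=> /=; apply: continuousM_fun => //.
  exact: (continuous_comp_fun _ _ c2 (@continuous_cos R)).
exact: (continuous_comp_fun _ _ c2 (@continuous_sin R)).
Qed.

(** The Weierstrass test with a majorant that is only locally uniform, as a case of
    dominated convergence along the neighbourhood filter. *)
Lemma ccont_has_sum (I : choiceType) (f : I -> T -> R[i]) (F : T -> R[i]) :
  (forall i, ccont (f i)) ->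
  (forall x : T, exists2 a : I -> R, summ a &
     \forall y \near x, forall i, cabs (f i y) <= a i) ->
  (forall x, has_sum (f ^~ x) (F x)) -> ccont F.
Proof.
move=> cf H hs x; have [a sa fa] := H x.
have f0a := nbhs_singleton fa.
have a0 i : 0 <= a i by exact: le_trans (cabs_ge0 _) (f0a i).
apply: (has_sum_dominated (F := nbhs x) (f := fun y i => f i y) (f0 := f ^~ x) _ a0 sa fa f0a) => //.
  by apply: nearW => y; exact: hs.
by move=> i; exact: cf.
Qed.

End ComplexContinuity.

Section TorusIntegral.
Variables (R : realType) (d : nat).
Implicit Types u w : 'cV[R]_d -> R[i].

Lemma Re_torus_int u : complex.Re (torus_int u) = cube_int (fun v => complex.Re (u v)).
Proof. by []. Qed.

Lemma Im_torus_int u : complex.Im (torus_int u) = cube_int (fun v => complex.Im (u v)).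
Proof. by []. Qed.

Lemma torus_intD u w : ccont u -> ccont w ->
  torus_int (fun v => u v + w v) = torus_int u + torus_int w.
Proof.
move=> /ccontP[u1 u2] /ccontP[w1 w2]; apply: complex_eq => /=.
  by rewrite -cube_intD //; congr cube_int; apply/funext => v; rewrite cReD.
by rewrite -cube_intD //; congr cube_int; apply/funext => v; rewrite cImD.
Qed.

Lemma torus_intZ c u : ccont u -> torus_int (fun v => c * u v) = c * torus_int u.
Proof.
move=> /ccontP[u1 u2]; apply: complex_eq => /=.
  transitivity (cube_int (fun v => complex.Re c * complex.Re (u v) +
                                   (- complex.Im c) * complex.Im (u v))).
    by congr cube_int; apply/funext => v; rewrite cReM mulNr.
  rewrite cube_intD ?cube_intZ ?cReM ?mulNr //; exact: (@continuousZ_fun _ R).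
transitivity (cube_int (fun v => complex.Re c * complex.Im (u v) +
                                 complex.Im c * complex.Re (u v))).
  by congr cube_int; apply/funext => v; rewrite cImM.
rewrite cube_intD ?cube_intZ ?cImM //; exact: (@continuousZ_fun _ R).
Qed.

Lemma torus_intB u w : ccont u -> ccont w ->
  torus_int (fun v => u v - w v) = torus_int u - torus_int w.
Proof.
move=> cu cw; have := torus_intD cu (ccontZ (c := -1) cw).
rewrite (torus_intZ (-1) cw) mulN1r => <-.
by congr torus_int; apply/funext => v; rewrite mulN1r.
Qed.

Lemma torus_int_cst c : torus_int (fun _ : 'cV[R]_d => c) = c.
Proof. by apply: complex_eq; rewrite /= cube_int_cst. Qed.

Lemma torus_int_sum (I : Type) (r : seq I) (u : I -> 'cV[R]_d -> R[i]) :
  (forall i, ccont (u i)) ->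
  torus_int (fun v => \sum_(i <- r) u i v) = \sum_(i <- r) torus_int (u i).
Proof.
move=> cu; elim: r => [|i r IH].
  by under [X in torus_int X]funext do rewrite big_nil; rewrite torus_int_cst big_nil.
under [X in torus_int X]funext do rewrite big_cons.
by rewrite torus_intD ?IH ?big_cons //; exact: ccont_sum.
Qed.

Lemma torus_int_conj u : ccont u -> torus_int (fun v => (u v)^*%C) = (torus_int u)^*%C.
Proof.
move=> /ccontP[u1 u2]; apply: complex_eq => /=.
  by congr cube_int; apply/funext => v; rewrite cReJ.
rewrite -mulN1r -cube_intZ //.
by congr cube_int; apply/funext => v; rewrite cImJ mulN1r.
Qed.

Lemma cube_int_bound (w : 'cV[R]_d -> R) M : continuous w ->
  (forall v, `|w v| <= M) -> `|cube_int w| <= M.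
Proof.
move=> cw wM; rewrite ler_norml -(cube_int_cst d (- M)) -[X in _ && (_ <= X)](cube_int_cst d M).
apply/andP; split; apply: cube_int_le => //; try exact: continuous_cst_fun.
  by move=> v _; have := wM v; rewrite ler_norml => /andP[].
by move=> v _; have := wM v; rewrite ler_norml => /andP[].
Qed.

(** The factor 2 comes from bounding the real and the imaginary part separately. *)
Lemma torus_int_bound u M : ccont u -> (forall v, cabs (u v) <= M) ->
  cabs (torus_int u) <= M *+ 2.
Proof.
move=> /ccontP[u1 u2] uM; apply: le_trans (cabs_le_ReIm _) _; rewrite mulr2n /=.
apply: lerD; apply: cube_int_bound => // v; apply: le_trans (uM v).
  exact: Re_le_cabs.
exact: Im_le_cabs.
Qed.

(** Uniform convergence: the finite partial sums are uniformly close to the sum. *)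
Lemma torus_int_has_sum (I : choiceType) (f : I -> 'cV[R]_d -> R[i])
    (F : 'cV[R]_d -> R[i]) (a : I -> R) :
  (forall i, ccont (f i)) -> summ a -> (forall i v, cabs (f i v) <= a i) ->
  (forall v, has_sum (f ^~ v) (F v)) ->
  ccont F /\ has_sum (fun i => torus_int (f i)) (torus_int F).
Proof.
move=> cf sa fa hs.
have a0 i : 0 <= a i by exact: le_trans (cabs_ge0 _) (fa i 0).
have cF : ccont F.
  by apply: ccont_has_sum cf _ hs => x; exists a => //; exact: (@nearW _ (nbhs x)).
split=> // e e0; have e4 : 0 < e / 4 by rewrite divr_gt0.
have [A hA] := summ_tail a0 sa e4; exists A => B AB.
have cS : ccont (fun v => \sum_(i <- B) f i v) by exact: ccont_sum.
rewrite -(torus_int_sum B cf) cabs_sub -(torus_intB cF cS).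
have h v : cabs (F v - \sum_(i <- B) f i v) <= e / 4.
  apply: (has_sum_tail (hs v) (fa ^~ v)) => C; apply: ltW; apply: le_lt_trans (hA C).
  rewrite [leLHS]big_mkcond [leRHS]big_mkcond /=; apply: ler_sum => i _.
  case: ifP => iB; first by rewrite (contraNN (fsubsetP AB i) iB).
  by case: ifP.
have := torus_int_bound (ccontB cF cS) h.
by move=> /le_lt_trans -> //; rewrite mulr2n; lra.
Qed.

Lemma torus_int_translate u (h : 'cV[R]_d) : ccont u -> zper u ->
  torus_int (fun v => u (v + h)) = torus_int u.
Proof.
move=> /ccontP[u1 u2] pu; apply: complex_eq => /=.
  by apply: (@cube_int_translate _ _ (fun v => complex.Re (u v))) => // l v; rewrite pu.
by apply: (@cube_int_translate _ _ (fun v => complex.Im (u v))) => // l v; rewrite pu.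
Qed.

Lemma ccont_translate u (h : 'cV[R]_d) : ccont u -> ccont (fun v : 'cV[R]_d => u (v + h)).
Proof.
move=> cu; have ch : continuous (fun v : 'cV[R]_d => v + h : 'cV[R]_d).
  apply: continuous_mx => i j; under [X in continuous X]funext do rewrite mxE.
  apply: (@continuousD_fun _ R); first exact: continuous_coord.
  exact: continuous_cst_fun.
exact: (@continuous_comp_fun 'cV[R]_d 'cV[R]_d R[i]^o (fun v => v + h) u).
Qed.

End TorusIntegral.

Lemma torus_int_swap (R : realType) m d (u : 'cV[R]_m -> 'cV[R]_d -> R[i]) :
  ccont (fun p : 'cV[R]_m * 'cV[R]_d => u p.1 p.2) ->
  torus_int (fun v => torus_int (u ^~ v)) = torus_int (fun x => torus_int (u x)).
Proof.
move=> /ccontP[c1 c2]; apply: complex_eq => /=.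
  exact: (cube_int_swap c1).
exact: (cube_int_swap c2).
Qed.

Lemma torus_int_col_mx (R : realType) m d (u : 'cV[R]_(m + d) -> R[i]) :
  torus_int u = torus_int (fun x : 'cV[R]_m => torus_int (fun y : 'cV[R]_d => u (col_mx x y))).
Proof. by apply: complex_eq => /=; exact: cube_int_col_mx. Qed.

(** * Characters of the torus *)

Section Characters.
Variables (R : realType) (d : nat).
Implicit Types (m : 'cV[int]_d) (v w : 'cV[R]_d).

Definition chi m v : R[i] := cexp ('i%C * (2 * pi * dot (map_mx intr m) v)%:C).

Lemma chiE m v : chi m v = cos (2 * pi * dot (map_mx intr m) v) +i*
  sin (2 * pi * dot (map_mx intr m) v).
Proof.
by rewrite /chi /cexp cReM cImM /= !mul0r !mul1r subr0 add0r expR0 !mul1r.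
Qed.

Lemma cabs_chi m v : cabs (chi m v) = 1.
Proof. by rewrite cabs_cexp cReM /= mul0r mul1r subr0 expR0. Qed.

Lemma chiD m m' v : chi (m + m') v = chi m v * chi m' v.
Proof.
by rewrite /chi -cexpD map_mxD dotDl -mulrDr -rmorphD mulrDr.
Qed.

Lemma chiDr m v w : chi m (v + w) = chi m v * chi m w.
Proof. by rewrite /chi -cexpD dotDr -mulrDr -rmorphD mulrDr. Qed.

Lemma chi0 v : chi 0 v = 1.
Proof.
rewrite /chi (_ : map_mx intr 0 = 0 :> 'cV[R]_d); last by apply/colP => i; rewrite !mxE.
by rewrite /dot trmx0 mul0mx mxE mulr0 mulr0 cexp0.
Qed.

Lemma chi_neq0 m v : chi m v != 0.
Proof. by apply: contra_eq_neq (cabs_chi m v) => ->; rewrite cabs0 eq_sym oner_neq0. Qed.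

Lemma chiJ m v : (chi m v)^*%C = chi (- m) v.
Proof.
rewrite !chiE (_ : map_mx intr (- m) = - map_mx intr m :> 'cV[R]_d); last first.
  by apply/colP => i; rewrite !mxE mulrNz.
rewrite (_ : dot (- map_mx intr m) v = - dot (map_mx intr m) v); last first.
  by rewrite /dot linearN mulNmx mxE.
by rewrite mulrN cosN sinN.
Qed.

Lemma dot_intr m (l : 'cV[int]_d) :
  dot (map_mx intr m) (map_mx intr l) = (dot m l)%:~R :> R.
Proof. by rewrite !dotE rmorph_sum; apply: eq_bigr => i _; rewrite !mxE rmorphM. Qed.

Lemma chi_int m (l : 'cV[int]_d) : chi m (map_mx intr l) = 1.
Proof.
rewrite /chi dot_intr -[RHS](cexp_periodic R (dot m l)); congr cexp.
rewrite !rmorphM /= (rmorph_int (real_complex R)) (rmorph_nat (real_complex R)).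
by ring.
Qed.

Lemma chi_per m : zper (chi m).
Proof. by move=> l v; rewrite chiDr chi_int mulr1. Qed.

Lemma continuous_dot (T : topologicalType) (x : 'cV[R]_d) (f : T -> 'cV[R]_d) :
  continuous f -> continuous (fun t => dot x (f t)).
Proof.
move=> cf; under [X in continuous X]funext do rewrite dotE.
apply: continuous_sum_fun => i; apply: (@continuousZ_fun _ R).
exact: (continuous_comp_fun _ _ cf (@continuous_coord R d 1 i 0)).
Qed.

Lemma ccont_chi m : ccont (chi m).
Proof.
apply: ccont_cexp; apply: ccontZ; apply: ccont_real.
by apply: (@continuousZ_fun _ R); apply: continuous_dot; exact: continuous_id_fun.
Qed.

(** Translating by a vector h multiplies chi m by chi m h without changing its integral;
    for m <> 0 there is an h for which this factor is -1. *)
Lemma torus_int_chi m : torus_int (chi m) = (m == 0)%:R.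
Proof.
have [->|m0] := eqVneq m 0.
  by rewrite (_ : chi 0 = fun=> 1) ?torus_int_cst //; apply/funext => v; rewrite chi0.
have [i mi] : exists i, m i 0 != 0.
  apply/existsP; apply: contraNT m0; rewrite negb_exists => /forallP h.
  by apply/eqP/colP => i; rewrite mxE; apply/eqP; have := h i; rewrite negbK.
pose h : 'cV[R]_d := (2 * (m i 0)%:~R)^-1 *: delta_mx i 0.
have hE : chi m h = -1.
  have mi' : (m i 0)%:~R != 0 :> R by rewrite intr_eq0.
  have -> : chi m h = cos pi +i* sin pi.
    rewrite chiE; suff -> : 2 * pi * dot (map_mx intr m) h = pi by [].
    rewrite dotE (bigD1 i) //= big1 => [|j ji].
      by rewrite !mxE !eqxx mulr1 addr0; field.
    by rewrite !mxE (negPf ji) !mulr0.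
  by rewrite cospi sinpi; apply: complex_eq; rewrite /= ?oppr0.
have := torus_int_translate h (@ccont_chi m) (@chi_per m).
under [X in torus_int X]funext do rewrite chiDr hE mulrC.
rewrite torus_intZ; last exact: ccont_chi.
rewrite mulN1r => /eqP; rewrite -subr_eq0 -opprD oppr_eq0 -mulr2n mulrn_eq0 /=.
by move/eqP.
Qed.

End Characters.
Arguments ccont_chi {R d} m.
Arguments chi_per {R d} m.

(* From here on these notions are used through their lemmas only. *)
Opaque torus_int ccont has_sum.

(** * Fourier series of continuous functions *)

Section PeakFunction.
Variable R : realType.

(** A trigonometric polynomial with values in [0, 1] and equal to 1 on the integers only.
    Its powers concentrate at the integers, which replaces the theory of summation
    kernels. *)
Definition peak (t : R) : R := (1 + cos (2 * pi * t)) / 2.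

Lemma continuous_peak : continuous peak.
Proof.
apply: (@continuousM_fun _ R); last exact: continuous_cst_fun.
apply: (@continuousD_fun _ R); first exact: continuous_cst_fun.
apply: (continuous_comp_fun (fun t => 2 * pi * t) (@cos R)); last exact: continuous_cos.
by apply: (@continuousZ_fun _ R); exact: continuous_id_fun.
Qed.

Lemma peak_ge0 t : 0 <= peak t.
Proof. by rewrite divr_ge0 // -lerBlDl sub0r cos_geN1. Qed.

Lemma peak_sym t : peak (1 - t) = peak t.
Proof.
rewrite /peak; congr ((1 + _) / 2); rewrite mulrBr mulr1 cosB.
have -> : 2 * pi = pi *+ 2 :> R by rewrite mulr_natl.
by rewrite cos2pi sin2pi mul1r mul0r addr0.
Qed.

Lemma peak_decr s t : 0 <= s -> s <= t -> t <= 2^-1 -> peak t <= peak s.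
Proof.
move=> s0; rewrite le_eqVlt => /orP[/eqP -> //|st] t2.
have p0 := pi_gt0 R.
have sp : 2 * pi * s \in `[0, pi] by rewrite in_itv /=; apply/andP; split; nra.
have tp : 2 * pi * t \in `[0, pi] by rewrite in_itv /=; apply/andP; split; nra.
rewrite /peak ler_pM2r ?invr_gt0 // lerD2l ltW // ltr_cos //; nra.
Qed.

Lemma peak_decr_lt s t : 0 <= s -> s < t -> t <= 2^-1 -> peak t < peak s.
Proof.
move=> s0 st t2; have p0 := pi_gt0 R.
have sp : 2 * pi * s \in `[0, pi] by rewrite in_itv /=; apply/andP; split; nra.
have tp : 2 * pi * t \in `[0, pi] by rewrite in_itv /=; apply/andP; split; nra.
rewrite /peak ltr_pM2r ?invr_gt0 // ltrD2l ltr_cos //; nra.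
Qed.

(** If f 0 > 0, then f >= c on a neighbourhood of the integers. The contribution of a
    smaller neighbourhood is at least a constant times the N-th power of q' = peak (d /
    2), and all that could cancel it comes from points where the peak is at most q = peak
    d < q'. As (q / q') ^ N tends to 0, the integral cannot vanish for all N. *)
Lemma peak_localize_pos (f : R -> R) : continuous f -> (forall t, f (t + 1) = f t) ->
  (forall N, int01 (fun t => peak t ^+ N * f t) = 0) -> f 0 <= 0.
Proof.
move=> cf pf h; rewrite leNgt; apply/negP => f0; pose c := f 0 / 2.
have c0 : 0 < c by rewrite divr_gt0.
have [e e0 he] : exists2 e : R, 0 < e & forall t, `|t| < e -> c <= f t.
  have /cvgrPdist_lt/(_ c c0) [e /= e0 he] := cf 0; exists e => // t te.
  have := he t; rewrite /ball /= sub0r normrN => /(_ te).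
  rewrite ltr_norml => /andP[_]; rewrite ltrBlDr => h1.
  by rewrite -(lerD2l c); apply/ltW/(le_lt_trans _ h1); rewrite /c; lra.
pose d := Num.min (e / 2) 4^-1.
have d0 : 0 < d by rewrite /d lt_min divr_gt0 //= invr_gt0.
have de : d < e.
  by rewrite (le_lt_trans (y := e / 2)) ?ge_min ?lexx //; lra.
have d4 : d <= 4^-1 by rewrite /d ge_min lexx orbT.
have fc t : 0 <= t <= d -> c <= f t.
  by move=> /andP[t0 td]; apply: he; rewrite ger0_norm //; lra.
have fc1 t : 1 - d <= t <= 1 -> c <= f t.
  move=> /andP[t0 td]; have -> : f t = f (t - 1) by rewrite -[in LHS](subrK 1 t) pf.
  by apply: he; rewrite ler0_norm; lra.
pose q := peak d; pose q' := peak (d / 2).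
have qq' : q < q' by apply: peak_decr_lt; lra.
have q0 : 0 <= q := peak_ge0 d.
have q'0 : 0 < q' := le_lt_trans q0 qq'.
have pq t : d <= t <= 1 - d -> peak t <= q.
  move=> /andP[t1 t2]; have [th|th] := leP t 2^-1; first by apply: peak_decr; lra.
  by rewrite -peak_sym; apply: peak_decr; lra.
pose b := 1 - d / 2.
pose M := int01 (fun s => `|f (d / 2 + b * s)|).
have clin (x y : R) : continuous (fun s => x + y * s).
  apply: (@continuousD_fun _ R); first exact: continuous_cst_fun.
  by apply: (@continuousZ_fun _ R); exact: continuous_id_fun.
have M0 : 0 <= M.
  rewrite -(int01_cst 0); apply: int01_le => //; first exact: continuous_cst_fun.
  apply: (continuous_comp_fun (fun s => f (d / 2 + b * s)) (@Num.norm R R)).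
    exact: (continuous_comp_fun _ _ (clin _ _) cf).
  exact: norm_continuous.
have bound N : d / 2 * c * q' ^+ N <= M * q ^+ N.
  pose g t := peak t ^+ N * f t.
  have cg : continuous g.
    apply: (@continuousM_fun _ R) => //.
    apply: (continuous_comp_fun peak (fun x => x ^+ N)); first exact: continuous_peak.
    exact: exprn_continuous.
  have [F dF] := primitive (-1) cg.
  have h1 : d / 2 * int01 (fun s => g (0 + d / 2 * s)) = F (0 + d / 2) - F 0.
    by apply: (int_line cg _ _ dF); lra.
  have h2 : b * int01 (fun s => g (d / 2 + b * s)) = F (d / 2 + b) - F (d / 2).
    by apply: (int_line cg _ _ dF); rewrite /b; lra.
  have h3 : 1 * int01 (fun s => g (0 + 1 * s)) = F (0 + 1) - F 0.
    by apply: (int_line cg _ _ dF); lra.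
  have h3' : int01 (fun s => g (0 + 1 * s)) = 0.
    by rewrite -[RHS](h N); congr int01; apply/funext => s; rewrite add0r mul1r.
  rewrite h3' mulr0 add0r in h3.
  have i1 : c * q' ^+ N <= int01 (fun s => g (0 + d / 2 * s)).
    rewrite -[leLHS]int01_cst; apply: int01_le.
    - exact: continuous_cst_fun.
    - exact: (continuous_comp_fun _ _ (clin _ _) cg).
    move=> t /andP[t0 t1]; rewrite add0r /g mulrC.
    have td : d / 2 * t <= d / 2 by rewrite ler_piMr //; lra.
    have td0 : 0 <= d / 2 * t by rewrite mulr_ge0 //; lra.
    apply: ler_pM; [by rewrite exprn_ge0 ?(ltW q'0)|exact: ltW| |by apply: fc; lra].
    by rewrite lerXn2r ?nnegrE ?peak_ge0 ?(ltW q'0) //; apply: peak_decr; lra.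
  have i2 : - (q ^+ N * M) <= int01 (fun s => g (d / 2 + b * s)).
    have cn : continuous (fun s => `|f (d / 2 + b * s)|).
      apply: (continuous_comp_fun (fun s => f (d / 2 + b * s)) (@Num.norm R R)).
        exact: (continuous_comp_fun _ _ (clin _ _) cf).
      exact: norm_continuous.
    rewrite -mulNr -int01Z //; apply: int01_le.
    - exact: (@continuousZ_fun _ R).
    - exact: (continuous_comp_fun _ _ (clin _ _) cg).
    move=> t /andP[t0 t1]; rewrite /g; set s := _ + _ * t.
    have bt : 0 <= b * t <= b.
      by rewrite mulr_ge0 ?ler_piMr // /b; lra.
    have s1 : d / 2 <= s <= 1 by move: bt; rewrite /s /b; lra.
    have gp : c <= f s -> - q ^+ N * `|f s| <= peak s ^+ N * f s.
      move=> cs; have fs0 : 0 <= f s by lra.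
      rewrite (@le_trans _ _ 0) // ?mulNr ?oppr_le0 mulr_ge0 ?exprn_ge0 //.
      exact: peak_ge0.
    have [sd|sd] := leP s d; first by apply: gp; apply: fc; lra.
    have [sd'|sd'] := leP s (1 - d); last by apply: gp; apply: fc1; lra.
    have : `|peak s ^+ N * f s| <= q ^+ N * `|f s|.
      rewrite normrM ler_wpM2r // normrX ger0_norm ?peak_ge0 //.
      by rewrite lerXn2r ?nnegrE ?peak_ge0 //; apply: pq; lra.
    by rewrite ler_norml mulNr => /andP[].
  have b1 : 0 <= b <= 1 by rewrite /b; lra.
  have Q0 : 0 <= q ^+ N * M by rewrite mulr_ge0 ?exprn_ge0.
  have E : F (d / 2 + b) = F 1 by congr F; rewrite /b; lra.
  have j1 : d / 2 * (c * q' ^+ N) <= d / 2 * int01 (fun s => g (0 + d / 2 * s)).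
    by rewrite ler_pM2l //; lra.
  have j2 : b * - (q ^+ N * M) <= b * int01 (fun s => g (d / 2 + b * s)).
    by rewrite ler_wpM2l //; lra.
  have j3 : b * (q ^+ N * M) <= q ^+ N * M by rewrite ler_piMl //; lra.
  rewrite add0r in h1; rewrite E in h2; rewrite mulrN in j2.
  rewrite mulrC [M * _]mulrC; move: j1; rewrite mulrA [_ * c * _]mulrC.
  by lra.
have qlim : (fun N => (q / q') ^+ N) @ \oo --> (0 : R).
  by apply: cvg_expr; rewrite ger0_norm ?divr_ge0 ?(ltW q'0) // ltr_pdivrMr // mul1r.
have : (fun N => M * (q / q') ^+ N) @ \oo --> (M * 0 : R).
  by apply: cvgM => //; exact: cvg_cst.
rewrite mulr0 => /cvgrPdist_lt /(_ (d / 2 * c)); case.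
  by rewrite mulr_gt0 // divr_gt0.
move=> N _ /(_ N (leqnn N)); rewrite sub0r normrN.
apply/negP; rewrite -leNgt (le_trans _ (ler_norm _)) //.
have -> : M * (q / q') ^+ N = (M * q ^+ N) / q' ^+ N by rewrite expr_div_n mulrA.
by rewrite (ler_pdivlMr _ _ (exprn_gt0 N q'0)).
Qed.

Lemma peak_localize (f : R -> R) : continuous f -> (forall t, f (t + 1) = f t) ->
  (forall N, int01 (fun t => peak t ^+ N * f t) = 0) -> f 0 = 0.
Proof.
move=> cf pf h; apply/eqP; rewrite eq_le peak_localize_pos //=.
rewrite -oppr_le0; apply: (@peak_localize_pos (fun t => - f t)).
- exact: (@continuousN_fun _ R).
- by move=> t; rewrite pf.
move=> N; rewrite -[RHS](mulr0 (-1)) -(h N) -int01Z.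
  by congr int01; apply/funext => t; rewrite mulN1r mulrN.
apply: (@continuousM_fun _ R) => //.
apply: (continuous_comp_fun peak (fun x => x ^+ N)); first exact: continuous_peak.
exact: exprn_continuous.
Qed.

Lemma continuous_peakX (T : topologicalType) (g : T -> R) N : continuous g ->
  continuous (fun x => peak (g x) ^+ N).
Proof.
move=> cg; have c1 := continuous_comp_fun _ _ cg continuous_peak.
exact: (continuous_comp_fun _ _ c1 (@exprn_continuous R N)).
Qed.

Lemma continuous_peakprod d (N : 'I_d -> nat) :
  continuous (fun v : 'cV[R]_d => \prod_i peak (v i 0) ^+ N i).
Proof.
elim: (index_enum _) => [|i r IH].
  under [X in continuous X]funext do rewrite big_nil.
  exact: continuous_cst_fun.
under [X in continuous X]funext do rewrite big_cons.
apply: (@continuousM_fun _ R) => //.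
exact (@continuous_peakX 'cV[R]_d (fun v => v i 0) (N i) (@continuous_coord R d 1 i 0)).
Qed.

(** One coordinate at a time, by the one-dimensional statement applied to the partial
    integrals. *)
Lemma peakprod_localize d (u : 'cV[R]_d -> R) : continuous u -> zper u ->
  (forall N : 'I_d -> nat, cube_int (fun v => (\prod_i peak (v i 0) ^+ N i) * u v) = 0) ->
  u 0 = 0.
Proof.
elim: d u => [|d IH] u cu pu h.
  by have := h (fun=> 0%N); rewrite /= big_ord0 mul1r.
have -> : 0 = vcons 0 0 :> 'cV[R]_d.+1.
  by apply: vcons_eq => [|i]; rewrite ?vcons0 ?vconsS !mxE.
apply: (IH (fun v => u (vcons 0 v))); first exact: continuous_slice.
  exact: zper_slice.
move=> N; pose w (v : 'cV[R]_d.+1) := (\prod_(i < d) peak (v (rshift 1 i) 0) ^+ N i) * u v.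
have cw : continuous w.
  apply: (@continuousM_fun _ R) => //.
  have -> : (fun v : 'cV[R]_d.+1 => \prod_(i < d) peak (v (rshift 1 i) 0) ^+ N i) =
      (fun v => (fun x : 'cV[R]_d => \prod_(i < d) peak (x i 0) ^+ N i)
                (\col_i v (rshift 1 i) 0)).
    by apply/funext => v; apply: eq_bigr => i _; rewrite mxE.
  apply: (@continuous_comp_fun 'cV[R]_d.+1 'cV[R]_d R
    (fun v => \col_i v (rshift 1 i) 0) (fun x => \prod_(i < d) peak (x i 0) ^+ N i)).
    apply: continuous_mx => i j; under [X in continuous X]funext do rewrite mxE.
    exact: continuous_coord.
  exact: continuous_peakprod.
have wE t v : w (vcons t v) = (\prod_(i < d) peak (v i 0) ^+ N i) * u (vcons t v).
  by rewrite /w; congr (_ * _); apply: eq_bigr => i _; rewrite vconsS.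
under [X in cube_int X]funext do rewrite -wE.
apply: (@peak_localize (fun t => cube_int (fun v => w (vcons t v)))).
- exact: cube_int_slice_continuous.
- move=> t; congr cube_int; apply/funext => v; rewrite !wE; congr (_ * _).
  exact: zper_slice1.
move=> M; pose NM (i : 'I_d.+1) := if fintype.unlift 0 i is Some j then N j else M.
rewrite -(h NM) cube_intS; congr int01; apply/funext => t.
rewrite -cube_intZ; last exact: continuous_slice.
congr cube_int; apply/funext => v; rewrite wE mulrA; congr (_ * _).
rewrite big_ord_recl /NM unlift_none vcons0; congr (_ * _).
by apply: eq_bigr => i _; rewrite liftK -rshift1 vconsS.
Qed.
End PeakFunction.

Lemma eq_leE (R : realType) (x y : R) : x = y -> x <= y.
Proof. by move=> ->. Qed.

Section FourierUniqueness.
Variables (R : realType) (d : nat).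
Implicit Types (u w : 'cV[R]_d -> R[i]) (m : 'cV[int]_d).

Lemma peak_chi (i : 'I_d) (v : 'cV[R]_d) : (peak (v i 0))%:C =
  2^-1 + 4^-1 * chi (delta_mx i 0) v + 4^-1 * chi (- delta_mx i 0) v.
Proof.
rewrite -chiJ chiE.
have -> : dot (map_mx intr (delta_mx i 0)) v = v i 0.
  rewrite dotE (bigD1 i) //= big1 => [|j ji].
    by rewrite !mxE !eqxx mul1r addr0.
  by rewrite !mxE (negPf ji) mul0r.
rewrite -addrA -mulrDr addcJ /= /peak.
rewrite -(rmorph_nat (real_complex R) 2) -(rmorph_nat (real_complex R) 4).
rewrite -!fmorphV -!rmorphM -rmorphD /=; congr (_ %:C).
by field.
Qed.

(** The functions w for which u * w has vanishing Fourier coefficients are stable under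
    multiplication by a peak function, which is a combination of three characters. So u
    integrates to zero against all products of powers of peaks, which isolate its value at
    0. *)
Lemma fourier_unique0 u : ccont u -> zper u ->
  (forall m, torus_int (fun v => u v * chi m v) = 0) -> u 0 = 0.
Proof.
move=> cu pu h.
pose Q w := ccont w /\ forall m, torus_int (fun v => u v * w v * chi m v) = 0.
have Q1 : Q (fun=> 1).
  split; first exact: ccont_cst.
  by move=> m; rewrite -(h m); congr torus_int; apply/funext => v; rewrite mulr1.
have QK w i : Q w -> Q (fun v => (peak (v i 0))%:C * w v).
  move=> [cw hw]; split.
    apply: ccontM; last exact: cw.
    apply: ccont_real.
    exact: (continuous_comp_fun _ _ (@continuous_coord R d 1 i 0) (@continuous_peak R)).
  move=> m; pose f m' v := u v * w v * chi m' v.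
  have cf m' : ccont (f m') by apply: ccontM; [exact: ccontM|exact: ccont_chi].
  have -> : (fun v => u v * ((peak (v i 0))%:C * w v) * chi m v) =
    (fun v => 2^-1 * f m v + 4^-1 * f (m + delta_mx i 0) v + 4^-1 * f (m - delta_mx i 0) v).
    by apply/funext => v; rewrite peak_chi /f !chiD; ring.
  have c1 m' (a : R[i]) : ccont (fun v => a * f m' v) by apply: ccontZ; exact: cf.
  have c12 : ccont (fun v => 2^-1 * f m v + 4^-1 * f (m + delta_mx i 0) v).
    by apply: ccontD; exact: c1.
  have f0 m' : torus_int (f m') = 0 := hw m'.
  rewrite (torus_intD c12 (c1 _ _)) (torus_intD (c1 m _) (c1 _ _)).
  by rewrite !(torus_intZ _ (cf _)) !f0 !mulr0 !addr0.
have QKN w i N : Q w -> Q (fun v : 'cV[R]_d => (peak (v i 0) ^+ N)%:C * w v).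
  move=> Qw; elim: N => [|N IH].
    by have -> : (fun v : 'cV[R]_d => (peak (v i 0) ^+ 0)%:C * w v) = w
      by apply/funext => v; rewrite expr0 mul1r.
  have -> : (fun v : 'cV[R]_d => (peak (v i 0) ^+ N.+1)%:C * w v) =
    (fun v : 'cV[R]_d => (peak (v i 0))%:C * ((peak (v i 0) ^+ N)%:C * w v)).
    by apply/funext => v; rewrite exprS rmorphM mulrA.
  exact: QK.
have Qprod (N : 'I_d -> nat) : Q (fun v : 'cV[R]_d => (\prod_i peak (v i 0) ^+ N i)%:C).
  elim: (index_enum _) => [|i r IH].
    by under [X in Q X]funext do rewrite big_nil.
  under [X in Q X]funext do rewrite big_cons rmorphM.
  exact: QKN.
have [c1 c2] := (ccontP u).1 cu.
have key (N : 'I_d -> nat) : torus_int (fun v : 'cV[R]_d => (\prod_i peak (v i 0) ^+ N i)%:C * u v) = 0.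
  have [_ /(_ 0) e] := Qprod N; rewrite -[RHS]e; congr torus_int; apply/funext => v.
  by rewrite chi0 mulr1 mulrC.
apply: complex_eq.
  apply: (@peakprod_localize R d (fun v => complex.Re (u v))) => //.
    by move=> l v; rewrite pu.
  move=> N; have := congr1 (@complex.Re R) (key N); rewrite Re_torus_int /= => <-.
  by congr cube_int; apply/funext => v; rewrite cReM /= mul0r subr0.
apply: (@peakprod_localize R d (fun v => complex.Im (u v))) => //.
  by move=> l v; rewrite pu.
move=> N; have := congr1 (@complex.Im R) (key N); rewrite Im_torus_int /= => <-.
by congr cube_int; apply/funext => v; rewrite cImM /= mul0r addr0.
Qed.

Lemma zper_translate (X : Type) (u : 'cV[R]_d -> X) (h : 'cV[R]_d) :
  zper u -> zper (fun v => u (v + h)).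
Proof. by move=> pu l v; rewrite addrAC pu. Qed.

Lemma zperM u w : zper u -> zper w -> zper (fun v => u v * w v).
Proof. by move=> pu pw l v; rewrite pu pw. Qed.

(** A translate of u has the same vanishing coefficients, so it is enough to look at the
    point 0. *)
Lemma fourier_unique u : ccont u -> zper u ->
  (forall m, torus_int (fun v => u v * chi m v) = 0) -> forall v, u v = 0.
Proof.
move=> cu pu h v; rewrite -[v]add0r.
apply: (@fourier_unique0 (fun x => u (x + v))).
- exact: ccont_translate.
- exact: zper_translate.
move=> m; have -> : (fun x => u (x + v) * chi m x) =
    (fun x => (chi m v)^-1 * (u (x + v) * chi m (x + v))).
  by apply/funext => x; rewrite chiDr mulrCA [chi m x * _]mulrC mulKf ?chi_neq0.
have c : ccont (fun x => u x * chi m x) by apply: ccontM; [exact: cu|exact: ccont_chi].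
have pc : zper (fun x => u x * chi m x) by apply: zperM => //; exact: chi_per.
have cT : ccont (fun x : 'cV[R]_d => u (x + v) * chi m (x + v)) := ccont_translate (h := v) c.
have := torus_intZ (chi m v)^-1 cT => ->.
by have := torus_int_translate v c pc => ->; rewrite h mulr0.
Qed.

Definition fcoef u m := torus_int (fun v => u v * chi (- m) v).

Lemma has_sum_bound (I : choiceType) (f : I -> R[i]) (F : R[i]) (a : I -> R) M :
  (forall A : {fset I}, \sum_(i <- A) a i <= M) ->
  (forall i, cabs (f i) <= a i) -> has_sum f F -> cabs F <= M.
Proof.
move=> aM fa h; apply: has_sum_abs_le h _ => A; apply: le_trans (aM A).
exact: ler_sum.
Qed.

(** Termwise integration of an absolutely convergent expansion against a bounded
    continuous weight. *)
Lemma torus_int_expand (I : choiceType) (c : I -> R[i]) (f : I -> 'cV[R]_d -> R[i]) u w (B : R) :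
  (forall i, ccont (f i)) -> (forall i v, cabs (f i v) <= 1) ->
  summ (fun i => cabs (c i)) -> (forall v, has_sum (fun i => c i * f i v) (u v)) ->
  ccont w -> (forall v, cabs (w v) <= B) ->
  has_sum (fun i => c i * torus_int (fun v => f i v * w v)) (torus_int (fun v => u v * w v)).
Proof.
move=> cf f1 sc hs cw wB.
have B0 : 0 <= B := le_trans (cabs_ge0 _) (wB 0).
have cfw i : ccont (fun v => f i v * w v) by apply: ccontM; [exact: cf|exact: cw].
have [||||_ H] := @torus_int_has_sum R d I (fun i v => c i * (f i v * w v))
  (fun v => u v * w v) (fun i => B * cabs (c i)).
- by move=> i; apply: ccontZ; exact: cfw.
- exact: summZ.
- move=> i v; rewrite !cabsM [B * _]mulrC ler_wpM2l ?cabs_ge0 // -[B]mul1r.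
  by rewrite ler_pM ?cabs_ge0.
- move=> v; have := has_sumZ (w v) (hs v); rewrite mulrC.
  by congr has_sum; apply/funext => i; rewrite mulrC mulrA.
have -> // : (fun i => c i * torus_int (fun v => f i v * w v)) =
   (fun i => torus_int (fun v => c i * (f i v * w v))).
by apply/funext => i; rewrite (torus_intZ _ (cfw i)).
Qed.

Lemma fcoef_has_sum (c : 'cV[int]_d -> R[i]) u : summ (fun m => cabs (c m)) ->
  (forall v, has_sum (fun m => c m * chi m v) (u v)) -> forall l, fcoef u l = c l.
Proof.
move=> sc hu l.
have H := torus_int_expand (@ccont_chi R d) (fun m v => eq_leE (cabs_chi m v)) sc hu
  (ccont_chi (- l)) (fun v => eq_leE (cabs_chi (- l) v)).
apply: has_sum_uniq H _.
have -> : c l = \sum_(i <- [fset l]%fset) c i * torus_int (fun v => chi i v * chi (- l) v).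
  rewrite big_seq_fset1.
  under [X in _ * torus_int X]funext do rewrite -chiD subrr chi0.
  by rewrite torus_int_cst mulr1.
apply: has_sum_supp => i; rewrite inE => il.
under [X in _ * torus_int X]funext do rewrite -chiD.
by rewrite torus_int_chi subr_eq0 (negPf il) mulr0.
Qed.

(** The sum of the Fourier series is continuous and has the same coefficients as u. *)
Lemma fourier_inversion u : ccont u -> zper u -> summ (fun m => cabs (fcoef u m)) ->
  forall v, has_sum (fun m => fcoef u m * chi m v) (u v).
Proof.
move=> cu pu sc.
have le1 m v : cabs (fcoef u m * chi m v) <= cabs (fcoef u m).
  by rewrite cabsM cabs_chi mulr1.
pose F v := tsum (fun m => fcoef u m * chi m v).
have hF v : has_sum (fun m => fcoef u m * chi m v) (F v).
  by apply: tsumP; apply: summ_le sc => m; exact: le1.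
have cc m : ccont (fun v => fcoef u m * chi m v) by apply: ccontZ; exact: ccont_chi.
have [cF _] := torus_int_has_sum cc sc le1 hF.
have pF : zper F by move=> l v; congr tsum; apply/funext => m; rewrite chi_per.
suff uF v : u v - F v = 0.
  move=> v; have -> : u v = F v by apply/eqP; rewrite -subr_eq0 uF.
  exact: hF.
apply: (@fourier_unique (fun v => u v - F v)).
- by apply: ccontB; [exact: cu|exact: cF].
- by move=> l w; rewrite pu pF.
move=> m; under [X in torus_int X]funext do rewrite mulrBl.
rewrite torus_intB; try by apply: ccontM; [assumption|exact: ccont_chi].
have := fcoef_has_sum sc hF (- m); rewrite /fcoef opprK => ->.
by rewrite subrr.
Qed.

(** Integrate the Fourier series of u against the conjugate of w term by term. *)
Lemma fourier_parseval u w : ccont u -> zper u -> summ (fun m => cabs (fcoef u m)) ->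
  ccont w -> zper w -> summ (fun m => cabs (fcoef w m)) ->
  has_sum (fun m => fcoef u m * (fcoef w m)^*%C) (torus_ip u w).
Proof.
move=> cu pu su cw pw sw.
have [B hB] := sw.
have wB v : cabs (w v)^*%C <= B.
  rewrite cabsJ; apply: has_sum_bound hB _ (fourier_inversion cw pw sw v) => m.
  by rewrite cabsM cabs_chi mulr1.
have H := torus_int_expand (@ccont_chi R d) (fun m v => eq_leE (cabs_chi m v)) su
  (fourier_inversion cu pu su) (ccontJ cw) wB.
have -> // : (fun m => fcoef u m * (fcoef w m)^*%C) =
  (fun m => fcoef u m * torus_int (fun v => chi m v * (w v)^*%C)).
apply/funext => m; congr (_ * _); rewrite /fcoef -torus_int_conj.
  by congr torus_int; apply/funext => v; rewrite conjc_mul chiJ opprK mulrC.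
by apply: ccontM; [exact: cw|exact: ccont_chi].
Qed.

End FourierUniqueness.

(** * Goursat's theorem and the contour shift *)

Section ComplexSegment.
Variable R : realType.
Local Notation C := R[i].
Implicit Types g : R -> C.

Definition cint01 g : C :=
  int01 (fun t => complex.Re (g t)) +i* int01 (fun t => complex.Im (g t)).

Lemma cint01Z c g : ccont g -> cint01 (fun t => c * g t) = c * cint01 g.
Proof.
move=> /ccontP[u1 u2]; apply: complex_eq => /=.
  transitivity (int01 (fun v => complex.Re c * complex.Re (g v) +
                                   (- complex.Im c) * complex.Im (g v))).
    by congr int01; apply/funext => v; rewrite cReM mulNr.
  rewrite int01D ?int01Z ?cReM ?mulNr //; exact: (@continuousZ_fun _ R).
transitivity (int01 (fun v => complex.Re c * complex.Im (g v) +
                                 complex.Im c * complex.Re (g v))).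
  by congr int01; apply/funext => v; rewrite cImM.
rewrite int01D ?int01Z ?cImM //; exact: (@continuousZ_fun _ R).
Qed.

Lemma cint01D g g' : ccont g -> ccont g' ->
  cint01 (fun t => g t + g' t) = cint01 g + cint01 g'.
Proof.
move=> /ccontP[u1 u2] /ccontP[w1 w2]; apply: complex_eq => /=.
  by rewrite -int01D //; congr int01; apply/funext => v; rewrite cReD.
by rewrite -int01D //; congr int01; apply/funext => v; rewrite cImD.
Qed.

Lemma cint01_cst c : cint01 (fun=> c) = c.
Proof. by apply: complex_eq; rewrite /= int01_cst. Qed.

Lemma cint01_id : cint01 (fun t => t%:C) = 2^-1.
Proof.
have h : int01 (fun t : R => t) = 2^-1.
  have cid : continuous (fun t : R => t) by exact: continuous_id_fun.
  have d (t : R) : is_derive t (1 : R) (fun t => 2^-1 * (t * t)) t.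
    have -> : (fun t : R => 2^-1 * (t * t)) = 2^-1 \*: (id * id) by [].
    by apply: is_derive_eq; rewrite /GRing.scale /=; lra.
  by rewrite (FTC01 cid (fun t _ => d t)); lra.
rewrite -(rmorph_nat (real_complex R)) -fmorphV.
by apply: complex_eq; rewrite /= ?int01_cst ?h.
Qed.

Lemma cint01_bound g M : ccont g -> (forall t, 0 <= t <= 1 -> cabs (g t) <= M) ->
  cabs (cint01 g) <= M *+ 2.
Proof.
move=> /ccontP[c1 c2] gM; apply: le_trans (cabs_le_ReIm _) _; rewrite mulr2n /=.
have H (f : R -> R) : continuous f -> (forall t, 0 <= t <= 1 -> `|f t| <= M) -> `|int01 f| <= M.
  move=> cf fM; rewrite ler_norml -(int01_cst (- M)) -[X in _ && (_ <= X)](int01_cst M).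
  apply/andP; split; apply: int01_le => //; try exact: continuous_cst_fun.
    by move=> t /fM; rewrite ler_norml => /andP[].
  by move=> t /fM; rewrite ler_norml => /andP[].
apply: lerD; apply: H => // t /gM; apply: le_trans.
  exact: Re_le_cabs.
exact: Im_le_cabs.
Qed.

Lemma cint01_split g : ccont g -> cint01 g =
  2^-1 * (cint01 (fun t => g (2^-1 * t)) + cint01 (fun t => g (2^-1 + 2^-1 * t))).
Proof.
move=> /ccontP[c1 c2].
rewrite -(rmorph_nat (real_complex R)) -fmorphV /=.
apply: complex_eq; rewrite /= int01_split // ?mul0r ?subr0 ?addr0; ring.
Qed.

Lemma torus_intS d (u : 'cV[R]_d.+1 -> C) :
  torus_int u = cint01 (fun t => torus_int (fun v => u (vcons t v))).
Proof. by apply: complex_eq; rewrite ?Re_torus_int ?Im_torus_int cube_intS. Qed.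

Lemma torus_int_swap01 d (u : R -> 'cV[R]_d -> C) :
  ccont (fun p : R * 'cV[R]_d => u p.1 p.2) ->
  torus_int (fun v => cint01 (u ^~ v)) = cint01 (fun t => torus_int (u t)).
Proof.
move=> /ccontP[c1 c2]; apply: complex_eq; rewrite ?Re_torus_int ?Im_torus_int.
  exact: (@cube_int_swap01 R d (fun t v => complex.Re (u t v))).
exact: (@cube_int_swap01 R d (fun t v => complex.Im (u t v))).
Qed.

End ComplexSegment.

Section Goursat.
Variable R : realType.
Local Notation C := R[i].
Variable G : C -> C.

Definition cdiff (z : C) := exists D, forall e : R, 0 < e ->
  exists2 dl : R, 0 < dl &
    forall h, cabs h < dl -> cabs (G (z + h) - G z - h * D) <= e * cabs h.

Hypothesis dG : forall z, cdiff z.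

Let contG : continuous (G : C^o -> C^o).
Proof.
move=> z; apply/(cvg_cabsP (nbhs_filter (z : C^o))) => e e0; have [D HD] := dG z.
have [dl dl0 Hd] := HD 1 ltr01.
have k0 : 0 < 1 + cabs D by rewrite ltr_pwDl // cabs_ge0.
apply/nbhs_ballP.
pose r := Num.min dl (e / (1 + cabs D)).
have r0 : 0 < r by rewrite lt_min dl0 divr_gt0.
exists r%:C; first by rewrite /= (ltcR 0).
move=> x; rewrite /ball /= -cabsE ltcR (cabs_sub z x) => zx.
have xd : cabs (x - z) < dl by rewrite (lt_le_trans zx) // /r ge_min lexx.
have e1 : z + (x - z) = x by ring.
have := Hd (x - z) xd; rewrite e1 mul1r => h1.
have : cabs (G x - G z) <= cabs (x - z) * (1 + cabs D).
  have -> : G x - G z = (G x - G z - (x - z) * D) + (x - z) * D by ring.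
  by rewrite mulrDr mulr1 (le_trans (cabsD _ _)) // cabsM lerD.
move=> /le_lt_trans; apply; rewrite -ltr_pdivlMr //.
by rewrite (lt_le_trans zx) // /r ge_min lexx orbT.
Qed.

Let ccont_line z h : ccont (fun t : R => G (z + t%:C * h)).
Proof.
apply: (@continuous_comp_fun R C^o C^o (fun t : R => z + t%:C * h) G) => //.
apply: ccontD; first exact: ccont_cst.
apply: ccontM; last exact: ccont_cst.
by apply: ccont_real; exact: continuous_id_fun.
Qed.

Definition segint z h := h * cint01 (fun t => G (z + t%:C * h)).

(** The contour integral around the parallelogram with corner z and sides a and b. *)
Definition parint z a b := segint z a + segint (z + a) b - segint (z + b) a - segint z b.

Lemma segint_split z h : segint z (2 * h) = segint z h + segint (z + h) h.
Proof.
rewrite /segint cint01_split; last exact: ccont_line.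
have n2 : (2 : C) != 0 by rewrite pnatr_eq0.
have E (t : R) : (2^-1 * t)%:C * (2 * h) = t%:C * h.
  rewrite (rmorphM (real_complex R)) (fmorphV (real_complex R)) (rmorph_nat (real_complex R)).
  by rewrite mulrCA mulrA mulrCA; field.
have E2 : (2^-1)%:C * (2 * h) = h.
  by rewrite (fmorphV (real_complex R)) (rmorph_nat (real_complex R)); field.
have -> : (fun t => G (z + (2^-1 * t)%:C * (2 * h))) = (fun t => G (z + t%:C * h)).
  by apply/funext => t; rewrite E.
have -> : (fun t => G (z + (2^-1 + 2^-1 * t)%:C * (2 * h))) = (fun t => G (z + h + t%:C * h)).
  by apply/funext => t; rewrite (rmorphD (real_complex R)) mulrDl E E2 addrA.
by field.
Qed.

(** The inner sides cancel. *)
Lemma parint_split z a b : parint z (2 * a) (2 * b) =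
  parint z a b + parint (z + a) a b + parint (z + b) a b + parint (z + a + b) a b.
Proof.
rewrite /parint !segint_split.
have -> : z + 2 * a = z + a + a by ring.
have -> : z + 2 * b = z + b + b by ring.
have -> : z + a + b = z + b + a by ring.
have -> : z + a + a + b = z + b + a + a by ring.
have -> : z + b + b + a = z + b + a + b by ring.
ring.
Qed.

(** On an affine function the four sides cancel, so only the deviation from the affine
    approximation contributes. *)
Lemma parint_small z a b al be (eta : R) :
  (forall s t : R, 0 <= s <= 1 -> 0 <= t <= 1 ->
     cabs (G (z + s%:C * a + t%:C * b) - (al + be * (s%:C * a + t%:C * b))) <= eta) ->
  cabs (parint z a b) <= (cabs a + cabs b) * (eta *+ 4).
Proof.
move=> H.
have seg w h c : (forall t : R, 0 <= t <= 1 -> cabs (G (w + t%:C * h) - (al + be * (c + t%:C * h))) <= eta) ->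
    cabs (segint w h - (h * (al + be * c) + 2^-1 * be * h ^+ 2)) <= cabs h * (eta *+ 2).
  move=> hw.
  pose L (t : R) := al + be * (c + t%:C * h).
  have cL : ccont L.
    apply: ccontD; first exact: ccont_cst.
    apply: ccontZ; apply: ccontD; first exact: ccont_cst.
    apply: ccontM; last exact: ccont_cst.
    by apply: ccont_real; exact: continuous_id_fun.
  have iL : cint01 L = (al + be * c) + 2^-1 * (be * h).
    have -> : L = fun t : R => (al + be * c) + (be * h) * t%:C.
      by apply/funext => t; rewrite /L; ring.
    have cR : ccont (fun t : R => t%:C) by apply: ccont_real; exact: continuous_id_fun.
    rewrite cint01D; [|exact: ccont_cst|exact: ccontZ].
    by rewrite cint01_cst cint01Z // cint01_id [_ * 2^-1]mulrC.
  have -> : segint w h - (h * (al + be * c) + 2^-1 * be * h ^+ 2) =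
    h * (cint01 (fun t => G (w + t%:C * h) + -1 * L t)).
    rewrite cint01D; [|exact: ccont_line|exact: ccontZ].
    by rewrite cint01Z // iL /segint; ring.
  rewrite cabsM ler_wpM2l ?cabs_ge0 //; apply: cint01_bound.
    by apply: ccontD; [exact: ccont_line|exact: ccontZ].
  by move=> t ht; rewrite mulN1r; exact: hw.
have lin : parint z a b =
  (segint z a - (a * (al + be * 0) + 2^-1 * be * a ^+ 2)) +
  (segint (z + a) b - (b * (al + be * a) + 2^-1 * be * b ^+ 2)) -
  (segint (z + b) a - (a * (al + be * b) + 2^-1 * be * a ^+ 2)) -
  (segint z b - (b * (al + be * 0) + 2^-1 * be * b ^+ 2)).
  by rewrite /parint; ring.
have i0 : 0 <= (0 : R) <= 1 by rewrite lexx ler01.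
have i1 : 0 <= (1 : R) <= 1 by rewrite lexx ler01.
rewrite lin.
have s1 := seg z a 0; have s2 := seg (z + a) b a; have s3 := seg (z + b) a b.
have s4 := seg z b 0.
have C0 : (0 : R)%:C = 0 := rmorph0 (real_complex R).
have C1 : (1 : R)%:C = 1 := rmorph1 (real_complex R).
have {}s1 : cabs (segint z a - (a * (al + be * 0) + 2^-1 * be * a ^+ 2)) <= cabs a * (eta *+ 2).
  by apply: s1 => t ht; have := H t 0 ht i0; rewrite C0 mul0r !addr0 add0r.
have {}s4 : cabs (segint z b - (b * (al + be * 0) + 2^-1 * be * b ^+ 2)) <= cabs b * (eta *+ 2).
  by apply: s4 => t ht; have := H 0 t i0 ht; rewrite C0 mul0r !addr0 !add0r.
have {}s2 : cabs (segint (z + a) b - (b * (al + be * a) + 2^-1 * be * b ^+ 2)) <= cabs b * (eta *+ 2).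
  by apply: s2 => t ht; have := H 1 t i1 ht; rewrite C1 mul1r.
have {}s3 : cabs (segint (z + b) a - (a * (al + be * b) + 2^-1 * be * a ^+ 2)) <= cabs a * (eta *+ 2).
  by apply: s3 => t ht; have := H t 1 ht i1; rewrite C1 mul1r [z + _ + b]addrAC [_ * a + b]addrC.
apply: le_trans (cabsB _ _) _; apply: le_trans (lerD (cabsB _ _) (lexx _)) _.
apply: le_trans (lerD (lerD (cabsD _ _) (lexx _)) (lexx _)) _.
rewrite -(mulr_natr _ 4) -(mulr_natr _ 2) in s1 s2 s3 s4 *; lra.
Qed.

(** Goursat's bisection. If the integral c over the parallelogram were not zero, one of
    its four quarters would carry at least c / 4, and iterating gives nested
    parallelograms of size 2^-n with integral at least c / 4^n. They shrink to a point,
    where complex differentiability makes the integral o(4^-n). *)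
Lemma goursat z a b : parint z a b = 0.
Proof.
apply: cabs_eq0; apply/eqP; rewrite eq_le cabs_ge0 andbT leNgt; apply/negP => P0.
set c := cabs (parint z a b) in P0.
pose q n : R := 2^-1 ^+ n.
have q0 n : 0 < q n by rewrite exprn_gt0.
have qS n : q n = 2 * q n.+1 by rewrite /q exprS mulrA divff ?mul1r.
pose bad n (p : R * R) := c * q n ^+ 2 <=
  cabs (parint (z + p.1%:C * a + p.2%:C * b) ((q n)%:C * a) ((q n)%:C * b)).
have child n p : bad n p -> {p' | bad n.+1 p' /\
    (p.1 <= p'.1 <= p.1 + q n.+1) /\ (p.2 <= p'.2 <= p.2 + q n.+1)}.
  move=> bp; apply: cid; apply: contrapT => nb.
  have nb' (x y : R) : 0 <= x <= q n.+1 -> 0 <= y <= q n.+1 ->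
     cabs (parint (z + (p.1 + x)%:C * a + (p.2 + y)%:C * b) ((q n.+1)%:C * a) ((q n.+1)%:C * b))
     < c * q n.+1 ^+ 2.
    move=> /andP[x0 x1] /andP[y0 y1]; rewrite ltNge; apply/negP => h; apply: nb.
    by exists (p.1 + x, p.2 + y); split=> //=; rewrite !lerD2l !lerDl x0 x1 y0 y1.
  have i0 : 0 <= (0 : R) <= q n.+1 by rewrite lexx ltW.
  have i1 : 0 <= q n.+1 <= q n.+1 by rewrite lexx ltW.
  have h1 := nb' _ _ i0 i0; have h2 := nb' _ _ i1 i0.
  have h3 := nb' _ _ i0 i1; have h4 := nb' _ _ i1 i1.
  move: bp; rewrite /bad qS.
  have -> : (2 * q n.+1)%:C * a = 2 * ((q n.+1)%:C * a).
    by rewrite (rmorphM (real_complex R)) (rmorph_nat (real_complex R)) mulrA.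
  have -> : (2 * q n.+1)%:C * b = 2 * ((q n.+1)%:C * b).
    by rewrite (rmorphM (real_complex R)) (rmorph_nat (real_complex R)) mulrA.
  rewrite parint_split; rewrite !addr0 in h1 h2 h3 h4.
  have E x y : z + (p.1 + x)%:C * a + y%:C * b = z + p.1%:C * a + y%:C * b + x%:C * a.
    by rewrite (rmorphD (real_complex R)); ring.
  have E' x y : z + x%:C * a + (p.2 + y)%:C * b = z + x%:C * a + p.2%:C * b + y%:C * b.
    by rewrite (rmorphD (real_complex R)); ring.
  rewrite E' in h3; rewrite E' E in h4; rewrite E in h2.
  move=> h; have := le_trans h (le_trans (cabsD _ _) (lerD (le_trans (cabsD _ _)
    (lerD (cabsD _ _) (lexx _))) (lexx _))).
  apply/negP; rewrite -ltNge exprMn.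
  by move: (c * q n.+1 ^+ 2) (q n.+1 ^+ 2) h1 h2 h3 h4 => X Y *; nra.
have bad0 : bad 0%N (0, 0).
  by rewrite /bad /q /= expr0 !mul1r !mul0r !addr0 expr1n mulr1.
pose st := fix st n : {p | bad n p} := match n return {p | bad n p} with
  | 0%N => exist (fun p => bad 0%N p) (0, 0) bad0
  | m.+1 => let: exist p bp := st m in
            let: exist p' hp' := child m p bp in exist (fun p => bad m.+1 p) p' hp'.1 end.
pose p n := sval (st n).
have pbad n : bad n (p n) by rewrite /p; case: (st n).
have pS n : ((p n).1 <= (p n.+1).1 <= (p n).1 + q n.+1) /\
            ((p n).2 <= (p n.+1).2 <= (p n).2 + q n.+1).
  by rewrite /p /=; case: (st n) => x bx /=; case: (child n x bx) => y [] /=.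
have mono (f : nat -> R) : (forall n, f n <= f n.+1 <= f n + q n.+1) ->
    exists x, forall n, f n <= x <= f n + q n.
  move=> hf.
  have up n m : f (n + m)%N + q (n + m)%N <= f n + q n /\ f n <= f (n + m)%N.
    elim: m => [|m [IH1 IH2]]; first by rewrite addn0.
    rewrite addnS; have /andP[a1 a2] := hf (n + m)%N; have := qS (n + m)%N.
    by move: (q0 (n + m).+1); split; lra.
  have le n m : f n <= f m + q m.
    have [nm|mn] := leqP n m.
      have [_] := up n (m - n)%N; rewrite subnKC // => /le_trans; apply.
      by rewrite lerDl ltW.
    have [h _] := up m (n - m)%N; rewrite subnKC ?(ltnW mn) // in h.
    by apply: le_trans h; rewrite lerDl ltW.
  have hs : has_sup (range f).
    by split; [exists (f 0%N), 0%N|exists (f 0%N + q 0%N) => _ [n _ <-]].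
  exists (sup (range f)) => n; apply/andP; split.
    by apply: ub_le_sup; [exact: hs.2|exists n].
  by apply: ge_sup; [exact: hs.1|move=> _ [m _ <-]].
have [s hs] := mono _ (fun n => (pS n).1).
have [t ht] := mono _ (fun n => (pS n).2).
pose z0 := z + s%:C * a + t%:C * b.
have [D HD] := dG z0.
pose L := cabs a + cabs b + 1.
have L0 : 0 < L by rewrite ltr_wpDl // addr_ge0 ?cabs_ge0.
(* With this precision the bound of parint_small is half of c * q n ^+ 2. *)
have e0 : 0 < c / (8 * L ^+ 2) by rewrite divr_gt0 // mulr_gt0 // exprn_gt0.
have [dl dl0 Hd] := HD _ e0.
have [n qn] : exists n, q n * L < dl.
  have : (fun n => q n * L) @ \oo --> (0 * L : R).
    apply: cvgM; last exact: cvg_cst.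
    by apply: cvg_expr; rewrite ger0_norm ?invr_ge0 // invf_lt1 // ltr1n.
  rewrite mul0r => /cvgrPdist_lt /(_ dl dl0) [n _ /(_ n (leqnn n))].
  by rewrite /= sub0r normrN => h; exists n; exact: le_lt_trans (ler_norm _) h.
have := pbad n; rewrite /bad; apply/negP; rewrite -ltNge.
have nearz (x y : R) : 0 <= x <= 1 -> 0 <= y <= 1 ->
   cabs (z + (p n).1%:C * a + (p n).2%:C * b + x%:C * ((q n)%:C * a) + y%:C * ((q n)%:C * b)
         - z0) <= q n * L.
  move=> /andP[x0 x1] /andP[y0 y1]; set w := _ + y%:C * _.
  have -> : w - z0 = ((p n).1 + x * q n - s)%:C * a + ((p n).2 + y * q n - t)%:C * b.
    by rewrite /w /z0 !rmorphB !rmorphD !(rmorphM (real_complex R)) /=; ring.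
  have q0n := ltW (q0 n).
  have xq : 0 <= x * q n <= q n by rewrite mulr_ge0 ?ler_piMl.
  have yq : 0 <= y * q n <= q n by rewrite mulr_ge0 ?ler_piMl.
  have k1 : `|(p n).1 + x * q n - s| <= q n.
    by rewrite ler_norml; have := hs n; lra.
  have k2 : `|(p n).2 + y * q n - t| <= q n.
    by rewrite ler_norml; have := ht n; lra.
  apply: le_trans (cabsD _ _) _; rewrite !cabsM !cabs_real.
  have := ler_wpM2r (cabs_ge0 a) k1; have := ler_wpM2r (cabs_ge0 b) k2.
  by rewrite /L; lra.
set w0 := z + _ + _; set a' := _ * a; set b' := _ * b.
have small : cabs (parint w0 a' b') <=
    (cabs a' + cabs b') * ((c / (8 * L ^+ 2) * (q n * L)) *+ 4).
  apply: (@parint_small _ _ _ (G z0 + (w0 - z0) * D) D) => x y hx hy.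
  have nr := nearz x y hx hy; rewrite -/a' -/b' -/w0 in nr.
  have := Hd _ (le_lt_trans nr qn); rewrite [z0 + _]addrC subrK => h.
  have -> : G (w0 + x%:C * a' + y%:C * b') -
     (G z0 + (w0 - z0) * D + D * (x%:C * a' + y%:C * b')) =
     G (w0 + x%:C * a' + y%:C * b') - G z0 - (w0 + x%:C * a' + y%:C * b' - z0) * D.
    by ring.
  by apply: le_trans h _; rewrite ler_wpM2l // ltW.
apply: le_lt_trans small _.
have -> : cabs a' + cabs b' = q n * (cabs a + cabs b).
  by rewrite /a' /b' !cabsM !cabs_real !(ger0_norm (ltW (q0 n))) mulrDr.
have Ll : cabs a + cabs b <= L by rewrite /L lerDl.
have qL0 : 0 <= q n * L by rewrite mulr_ge0 ?ltW.
apply: (@le_lt_trans _ _ (q n * L * ((c / (8 * L ^+ 2) * (q n * L)) *+ 4))).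
  apply: ler_wpM2r; last by rewrite ler_wpM2l // ltW.
  by rewrite mulrn_wge0 // mulr_ge0 // ltW.
have -> : q n * L * ((c / (8 * L ^+ 2) * (q n * L)) *+ 4) = c * q n ^+ 2 / 2.
  by rewrite -mulr_natr; field; rewrite gt_eqF.
have : 0 < c * q n ^+ 2 by rewrite mulr_gt0 // exprn_gt0.
by lra.
Qed.

(** On the parallelogram with sides 1 and w the two sides parallel to w cancel by
    periodicity. *)
Lemma contour_shift01 w : (forall z, G (z + 1) = G z) ->
  cint01 (fun t : R => G (t%:C + w)) = cint01 (fun t : R => G t%:C).
Proof.
move=> pG; have := goursat 0 1 w; rewrite /parint.
have -> : segint (0 + 1) w = segint 0 w.
  by rewrite /segint; congr (_ * cint01 _); apply/funext => t; rewrite addrAC pG.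
rewrite /segint !mul1r add0r => h.
have {h} : cint01 (fun t : R => G (0 + t%:C * 1)) = cint01 (fun t : R => G (w + t%:C * 1)).
  by apply/eqP; rewrite -subr_eq0; apply/eqP; rewrite -[RHS]h; ring.
move=> h; transitivity (cint01 (fun t : R => G (w + t%:C * 1))).
  by congr cint01; apply/funext => t; rewrite mulr1 addrC.
by rewrite -h; congr cint01; apply/funext => t; rewrite mulr1 add0r.
Qed.

End Goursat.

Section ContourShift.
Variable R : realType.
Local Notation C := R[i].

(** The form of holomorphy that an induction on the number of variables can use. *)
Definition sepdiff n (G : 'cV[C]_n -> C) := forall z (i : 'I_n),
  cdiff (fun h => G (z + h *: delta_mx i 0)) 0.

Lemma complex_mx_vcons n t (v : 'cV[R]_n) :
  complex_mx (vcons t v) = vcons t%:C (complex_mx v).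
Proof.
apply: vcons_eq => [|i]; first by rewrite [LHS]mxE !vcons0.
by rewrite [LHS]mxE !vconsS [RHS]mxE.
Qed.

Lemma vcons_add_delta0 n (t h : C) (v : 'cV[C]_n) :
  vcons t v + h *: delta_mx 0 0 = vcons (t + h) v.
Proof.
apply: vcons_eq => [|j]; rewrite [LHS]mxE ?vcons0 ?vconsS [X in _ + X = _]mxE mxE.
  by rewrite mulr1.
by rewrite (_ : (rshift 1 j == 0) = false) // mulr0 addr0.
Qed.

Lemma vcons_add_deltaS n (t h : C) (v : 'cV[C]_n) i :
  vcons t v + h *: delta_mx (rshift 1 i) 0 = vcons t (v + h *: delta_mx i 0).
Proof.
apply: vcons_eq => [|j]; rewrite [LHS]mxE ?vcons0 ?vconsS [X in _ + X = _]mxE mxE.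
  by rewrite mulr0 addr0.
by rewrite !mxE (inj_eq (@rshift_inj 1 n)).
Qed.

Lemma ccont_compC (T U : topologicalType) (g : T -> U) (G : U -> C) :
  continuous g -> ccont G -> ccont (fun x => G (g x)).
Proof. move=> cg cG; exact: (@continuous_comp_fun T U C^o g G). Qed.

Lemma continuous_complex_mx (T : topologicalType) n (g : T -> 'cV[R]_n) :
  continuous g -> continuous (fun x => complex_mx (g x) : 'cV[C^o]_n).
Proof.
move=> cg; apply: continuous_mx => i j.
under [X in continuous X]funext do rewrite mxE.
have : ccont (fun x => (g x i j)%:C).
  by apply: ccont_real; exact: (continuous_comp_fun _ _ cg (@continuous_coord R n 1 i j)).
exact.
Qed.

Lemma continuous_mx_translate (T : topologicalType) n (g : T -> 'cV[C^o]_n) (w : 'cV[C^o]_n) :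
  continuous g -> continuous (fun x => g x + w : 'cV[C^o]_n).
Proof.
move=> cg; apply: continuous_mx => i j.
under [X in continuous X]funext do rewrite mxE.
apply: continuousD_fun; last exact: continuous_cst_fun.
exact: (continuous_comp_fun _ _ cg (@continuous_coord C^o n 1 i j)).
Qed.

(** Shift one coordinate at a time. Separate differentiability together with joint
    continuity allows the coordinates to be exchanged by Fubini's theorem. *)
Theorem contour_shift n (G : 'cV[C]_n -> C) (w : 'cV[C]_n) :
  ccont (G : 'cV[C^o]_n -> C) -> zper G -> sepdiff G ->
  torus_int (fun x : 'cV[R]_n => G (complex_mx x + w)) = torus_int (fun x => G (complex_mx x)).
Proof.
elim: n G w => [|n IH] G w cG pG dG.
  by congr torus_int; apply/funext => x; congr G; apply/colP => -[].
rewrite [w]vconsP; set w0 := w 0 0; set w' := \col__ _.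
have shift' t : torus_int (fun v => G (vcons t (complex_mx v + w'))) =
                torus_int (fun v => G (vcons t (complex_mx v))).
  apply: (IH (fun v => G (vcons t v))).
  - apply: (ccont_compC (g := fun v : 'cV[C^o]_n => vcons t v : 'cV[C^o]_n.+1)); last exact: cG.
    by apply: continuous_vcons; [exact: continuous_cst_fun|exact: continuous_id_fun].
  - exact: zper_slice.
  - move=> z i; have := dG (vcons t z) (rshift 1 i).
    by under [X in cdiff X _ -> _]funext do rewrite vcons_add_deltaS.
have cvc (c : C) : ccont (fun p : R * 'cV[R]_n => G (vcons (p.1%:C + c) (complex_mx p.2))).
  apply: (ccont_compC (g := fun p : R * 'cV[R]_n =>
    vcons (p.1%:C + c) (complex_mx p.2) : 'cV[C^o]_n.+1)); last exact: cG.
  apply: continuous_vcons; last by apply: continuous_complex_mx; exact: continuous_snd.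
  have : ccont (fun p : R * 'cV[R]_n => p.1%:C + c).
    apply: ccontD; last exact: ccont_cst.
    by apply: ccont_real; exact: continuous_fst.
  exact.
rewrite !torus_intS.
transitivity (cint01 (fun t : R => torus_int (fun v => G (vcons (t%:C + w0) (complex_mx v))))).
  congr cint01; apply/funext => t; rewrite -shift'; congr torus_int; apply/funext => v.
  by rewrite complex_mx_vcons -vconsD.
rewrite -(torus_int_swap01 (cvc w0)).
transitivity (torus_int (fun v : 'cV[R]_n => cint01 (fun t : R => G (vcons (t%:C + 0) (complex_mx v))))).
  congr torus_int; apply/funext => v.
  under [X in _ = cint01 X]funext do rewrite addr0.
  apply: (@contour_shift01 R (fun z => G (vcons z (complex_mx v)))); last first.
    by move=> z; exact: zper_slice1.
  move=> z; have [D HD] := dG (vcons z (complex_mx v)) 0; exists D => e /HD [dl dl0 h].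
  exists dl => // x /h; rewrite scale0r addr0 add0r.
  by rewrite vcons_add_delta0.
rewrite (torus_int_swap01 (cvc 0)); congr cint01; apply/funext => t.
by congr torus_int; apply/funext => v; rewrite addr0 complex_mx_vcons.
Qed.

End ContourShift.

(** * Gaussian sums over the lattice *)

Section LatticeSums.
Variable R : realType.

Lemma ler_sum_subseq (I : eqType) (a : I -> R) (s t : seq I) : (forall i, 0 <= a i) ->
  uniq s -> {subset s <= t} -> \sum_(i <- s) a i <= \sum_(i <- t) a i.
Proof.
move=> a0; elim: s t => [|x s IH] t /=; first by rewrite big_nil sumr_ge0.
move=> /andP[xs us] st; have xt : x \in t by apply: st; rewrite mem_head.
rewrite (perm_big _ (perm_to_rem xt)) !big_cons lerD2l; apply: IH => // y ys.
have yt : y \in t by apply: st; rewrite in_cons ys orbT.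
have : y \in x :: rem x t by rewrite -(perm_mem (perm_to_rem xt)).
by rewrite in_cons => /orP[/eqP yx|//]; rewrite -yx ys in xs.
Qed.

(** A finite set of vectors is contained in a product of finite sets, on which the sum of
    the products factors. *)
Lemma summ_prod d (q : int -> R) : (forall m, 0 <= q m) -> summ q ->
  summ (fun b : 'cV[int]_d => \prod_i q (b i 0)).
Proof.
move=> q0 [M qM]; elim: d => [|d [N IH]].
  exists 1 => A; rewrite (eq_bigr (fun=> 1)); last by move=> b _; rewrite big_ord0.
  apply: (@le_trans _ _ (\sum_(b <- [:: (0 : 'cV[int]_0)]) (1 : R))).
    apply: ler_sum_subseq; [by []|exact: fset_uniq|].
    by move=> b _; rewrite inE; apply/eqP/colP => -[].
  by rewrite big_seq1.
exists (M * N) => A.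
pose A0 := [fset b 0 0 | b : 'cV[int]_d.+1 in A]%fset.
pose A' := [fset \col_i b (rshift 1 i) 0 | b : 'cV[int]_d.+1 in A]%fset.
pose F (p : int * 'cV[int]_d) : R := q p.1 * \prod_i q (p.2 i 0).
pose sp (b : 'cV[int]_d.+1) := (b 0 0, \col_i b (rshift 1 i) 0).
have F0 p : 0 <= F p by rewrite mulr_ge0 // prodr_ge0.
have -> : \sum_(b <- A) \prod_i q (b i 0) = \sum_(p <- [seq sp b | b <- A]) F p.
  rewrite big_map; apply: eq_bigr => b _; rewrite big_ord_recl /F /=; congr (_ * _).
  by apply: eq_bigr => i _; rewrite mxE rshift1.
apply: (@le_trans _ _ (\sum_(p <- [seq (x, y) | x <- A0, y <- A']) F p)).
  apply: ler_sum_subseq => //.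
    rewrite map_inj_uniq ?fset_uniq // => b b' [e1 e2].
    by rewrite (vconsP b) (vconsP b') e1 e2.
  move=> p /mapP[b bA ->]; apply/allpairsP; exists (sp b); split=> //=.
    by apply/imfsetP; exists b.
  by apply/imfsetP; exists b.
rewrite big_allpairs /F /=.
under eq_bigr do rewrite -mulr_sumr.
rewrite -mulr_suml; apply: ler_pM; rewrite ?sumr_ge0 //.
by move=> b _; rewrite prodr_ge0.
Qed.

Definition qwt (m : int) : R := (1 + m%:~R ^+ 2)^-1.

Lemma qwt_gt0 m : 0 < qwt m.
Proof. by rewrite invr_gt0 ltr_pwDl // sqr_ge0. Qed.

(** By comparison with the telescoping series of 4 / j - 4 / (j + 1). *)
Lemma summ_qwt : summ qwt.
Proof.
pose h (j : nat) : R := (1 + j%:R ^+ 2)^-1.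
have h0 j : 0 <= h j by rewrite invr_ge0 addr_ge0 // sqr_ge0.
have hb N : \sum_(j <- iota 0 N) h j <= 4.
  suff : \sum_(j <- iota 0 N) h j <= 4 - 4 / N.+1%:R.
    by move=> /le_trans; apply; rewrite gerBl divr_ge0.
  elim: N => [|N IH]; first by rewrite big_nil divr1 subrr.
  rewrite -addn1 iotaD big_cat /= big_seq1 add0n addn1.
  have E2 : N.+2%:R = N.+1%:R + 1 :> R by rewrite natr1.
  have E1 : N%:R = N.+1%:R - 1 :> R by rewrite -[N.+1%:R]natr1 addrK.
  have x1 : (1 : R) <= N.+1%:R by rewrite ler1n.
  rewrite E2; set x : R := N.+1%:R in IH E1 x1 *; clearbody x.
  have k : h N <= 4 / x - 4 / (x + 1).
    have x_neq0 : x != 0 by rewrite gt_eqF //; lra.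
    have x1_neq0 : x + 1 != 0 by rewrite gt_eqF //; lra.
    have -> : 4 / x - 4 / (x + 1) = 4 / (x * (x + 1)).
      by field; rewrite x_neq0 x1_neq0.
    have xx : 0 < x * (x + 1) by rewrite mulr_gt0 //; lra.
    have p0 : 0 < 1 + (x - 1) ^+ 2 by rewrite ltr_pwDl // sqr_ge0.
    rewrite /h E1 ler_pdivlMr // mulrC ler_pdivrMr //.
    (* The two sides differ by 3 x^2 - 9 x + 8, which has no real root. *)
    by have := sqr_ge0 (x - 3 / 2); rewrite !expr2; nra.
  by move: (h N) (4 / x) (4 / (x + 1)) (\sum_(j <- _) _) IH k => *; lra.
exists (4 + 4) => A.
pose N := (\max_(m <- A) `|m|%N).+1.
apply: (@le_trans _ _ (\sum_(m <- [seq Posz j | j <- iota 0 N] ++ [seq Negz j | j <- iota 0 N]) qwt m)).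
  apply: ler_sum_subseq; [by move=> m; rewrite ltW ?qwt_gt0|exact: fset_uniq|].
  move=> m mA; have mN : (`|m| < N)%N by rewrite ltnS (leq_bigmax_seq _ mA).
  rewrite mem_cat; case: m mN {mA} => j jN; apply/orP; [left|right]; apply: map_f;
    rewrite mem_iota /= add0n //.
  exact: ltn_trans (ltnSn j) jN.
rewrite big_cat !big_map; apply: lerD; first exact: hb.
apply: le_trans (hb N); apply: ler_sum => j _.
rewrite /qwt /h NegzE lef_pV2 ?posrE ?ltr_pwDl ?sqr_ge0 // lerD2l.
by rewrite mulrNz sqrrN lerXn2r ?nnegrE ?ler0n // ler_nat.
Qed.

(** One summable weight on the lattice dominates every series in use: Gaussian series with
    an exponential factor, and the Fourier coefficients of smooth functions. *)
Definition lwt d (b : 'cV[int]_d) : R := \prod_i qwt (b i 0).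

Lemma summ_lwt d : summ (@lwt d).
Proof. by apply: summ_prod summ_qwt => m; rewrite ltW // qwt_gt0. Qed.

(** Complete the square to absorb the linear term into half of the quadratic one, then use
    1 + x <= exp x. *)
Lemma gauss_qwt (al C : R) : 0 < al -> exists2 K : R, 0 <= K &
  forall m : int, expR (- (al * m%:~R ^+ 2) + C * `|m%:~R|) <= K * qwt m.
Proof.
move=> al0; exists (expR (C ^+ 2 / (2 * al)) * (1 + 2 / al)).
  by rewrite mulr_ge0 ?expR_ge0 // addr_ge0 // divr_ge0 // ltW.
move=> m; set x : R := m%:~R.
have al_neq0 : al != 0 by rewrite gt_eqF.
have e1 : - (al * x ^+ 2) + C * `|x| <= C ^+ 2 / (2 * al) - al / 2 * x ^+ 2.
  have -> : - (al * x ^+ 2) + C * `|x| = C ^+ 2 / (2 * al) - al / 2 * x ^+ 2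
     - al / 2 * (`|x| - C / al) ^+ 2.
    by rewrite -(real_normK (num_real x)); field.
  by rewrite gerBl mulr_ge0 ?sqr_ge0 // divr_ge0 // ltW.
have x20 : 0 <= x ^+ 2 by rewrite sqr_ge0.
have y0 : 0 <= al / 2 * x ^+ 2 by rewrite mulr_ge0 // divr_ge0 // ltW.
have e2 : expR (- (al / 2 * x ^+ 2)) <= (1 + al / 2 * x ^+ 2)^-1.
  by rewrite expRN lef_pV2 ?posrE ?expR_gt0 ?ltr_pwDl // expR_ge1Dx.
apply: (@le_trans _ _ (expR (C ^+ 2 / (2 * al) - al / 2 * x ^+ 2))).
  by rewrite ler_expR.
rewrite expRD -[leRHS]mulrA ler_wpM2l ?expR_ge0 //; apply: le_trans e2 _.
have x1 : 0 < 1 + x ^+ 2 by rewrite ltr_pwDl.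
have y1 : 0 < 1 + al / 2 * x ^+ 2 by rewrite ltr_pwDl.
rewrite /qwt -/x ler_pdivlMr // mulrC ler_pdivrMr //.
have -> : (1 + 2 / al) * (1 + al / 2 * x ^+ 2) = 1 + x ^+ 2 + 2 / al + al / 2 * x ^+ 2.
  by field.
have : 0 <= 2 / al by rewrite divr_ge0 // ltW.
by lra.
Qed.

Definition l1 d (b : 'cV[int]_d) : R := \sum_i `|(b i 0)%:~R|.

Lemma gauss_lwt d (al C : R) : 0 < al -> exists2 K : R, 0 <= K &
  forall b : 'cV[int]_d,
    expR (- (al * \sum_i (b i 0)%:~R ^+ 2) + C * l1 b) <= K * lwt b.
Proof.
move=> al0; have [K K0 hK] := gauss_qwt C al0; exists (K ^+ d); first exact: exprn_ge0.
move=> b.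
have -> : - (al * \sum_i (b i 0)%:~R ^+ 2) + C * l1 b =
   \sum_i (- (al * (b i 0)%:~R ^+ 2) + C * `|(b i 0)%:~R|).
  by rewrite big_split /= mulr_sumr sumrN mulr_sumr.
rewrite expR_sum.
have -> : K ^+ d * lwt b = \prod_(i < d) (K * qwt (b i 0)).
  by rewrite big_split /= prodr_const card_ord.
by apply: ler_prod => i _; rewrite expR_ge0 hK.
Qed.

End LatticeSums.

(** * Positive definite forms *)

Section PositiveForms.
Variables (R : realType) (n : nat) (Y : 'M[R]_n).
Hypothesis Ysym : Y^T = Y.
Hypothesis Ypos : forall u : 'cV[R]_n, u != 0 -> 0 < dot u (Y *m u).

Lemma dot_symm (u v : 'cV[R]_n) : dot u (Y *m v) = dot v (Y *m u).
Proof. by rewrite dotC /dot trmx_mul Ysym mulmxA. Qed.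

Lemma dotZl (F : comPzRingType) m (c : F) (u v : 'cV[F]_m) : dot (c *: u) v = c * dot u v.
Proof. by rewrite /dot linearZ -scalemxAl mxE. Qed.

Lemma dotZr (F : comPzRingType) m (c : F) (u v : 'cV[F]_m) : dot u (c *: v) = c * dot u v.
Proof. by rewrite dotC dotZl dotC. Qed.

Lemma pos_form_ge0 u : 0 <= dot u (Y *m u).
Proof.
have [->|u0] := eqVneq u 0; last exact/ltW/Ypos.
by rewrite mulmx0 dotE sumr_ge0 // => i _; rewrite !mxE mulr0.
Qed.

Lemma cauchy_schwarz u v : dot u (Y *m v) ^+ 2 <= dot u (Y *m u) * dot v (Y *m v).
Proof.
have [->|v0] := eqVneq v 0.
  have e0 (w : 'cV[R]_n) : dot w 0 = 0.
    by rewrite dotE big1 // => i _; rewrite mxE mulr0.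
  by rewrite mulmx0 !e0 expr0n mulr0.
have := pos_form_ge0 (dot v (Y *m v) *: u - dot u (Y *m v) *: v).
have vp := Ypos v0.
rewrite mulmxBr -!scalemxAr -!scaleNr !dotDl !dotDr !dotZl !dotZr (dot_symm v u).
set A := dot u (Y *m u); set B := dot u (Y *m v); set D := dot v (Y *m v) in vp *.
have -> : D * (D * A) + D * (- B * B) + (- B * (D * B) + - B * (- B * D)) =
  D * (A * D - B ^+ 2) by ring.
by rewrite pmulr_rge0 // subr_ge0.
Qed.

Lemma pos_form_unit : Y \in unitmx.
Proof.
rewrite -row_free_unit -kermx_eq0; apply/eqP/row_matrixP => i; rewrite row0.
apply/eqP; apply: contraT => r0.
have : (row i (kermx Y))^T != 0 by rewrite -trmx0 (inj_eq trmx_inj).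
move=> /Ypos; rewrite /dot trmxK mulmxA.
have -> : row i (kermx Y) *m Y = 0 by apply/sub_kermxP; exact: row_sub.
by rewrite mul0mx mxE ltxx.
Qed.

(** The coordinate u_i is the product of u, for the form Y, with the i-th column of the
    inverse of Y; the Cauchy-Schwarz inequality for Y bounds it. This avoids the spectral
    theorem. *)
Lemma pos_form_lower : exists2 c : R, 0 < c &
  forall u : 'cV[R]_n, c * \sum_i u i 0 ^+ 2 <= dot u (Y *m u).
Proof.
pose w (i : 'I_n) : 'cV[R]_n := invmx Y *m delta_mx i 0.
pose S := \sum_i dot (w i) (Y *m w i).
have S0 : 0 <= S by rewrite sumr_ge0 // => i _; exact: pos_form_ge0.
have S1 : 0 < 1 + S by rewrite ltr_pwDl.
exists (1 + S)^-1; first by rewrite invr_gt0.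
move=> u; rewrite mulrC ler_pdivrMr // mulrDr mulr1.
have uS : \sum_i u i 0 ^+ 2 <= dot u (Y *m u) * S.
  rewrite mulr_sumr; apply: ler_sum => i _.
  suff -> : u i 0 = dot u (Y *m w i) by exact: cauchy_schwarz.
  rewrite mulKVmx ?pos_form_unit // dotE (bigD1 i) //= big1 ?addr0.
    by rewrite mxE !eqxx mulr1.
  by move=> j ji; rewrite mxE (negPf ji) mulr0.
by rewrite (le_trans uS) // lerDr pos_form_ge0.
Qed.

End PositiveForms.

(** * Remainder estimates for the exponential *)

Section ExponentialRemainder.
Variable R : realType.
Local Notation C := R[i].

Lemma is_derive_cexp_line (w : C) (t : R) :
  is_derive t (1 : R) (fun t => complex.Re (cexp (t%:C * w))) (complex.Re (w * cexp (t%:C * w))) /\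
  is_derive t (1 : R) (fun t => complex.Im (cexp (t%:C * w))) (complex.Im (w * cexp (t%:C * w))).
Proof.
case: w => a b.
have dl c : is_derive t 1 (fun t : R => t * c) c.
  have -> : (fun t : R => t * c) = id * cst c by [].
  by apply: is_derive_eq; rewrite scaler0 add0r /GRing.scale /= mulr1.
have dE := @is_derive1_comp R expR (fun t => t * a) t _ _ (is_derive_expR _) (dl a).
have dC := @is_derive1_comp R cos (fun t => t * b) t _ _ (is_derive_cos _) (dl b).
have dS := @is_derive1_comp R sin (fun t => t * b) t _ _ (is_derive_sin _) (dl b).
have E1 (s : R) : complex.Re (s%:C * (a +i* b)) = s * a by rewrite cReM /= mul0r subr0.
have E2 (s : R) : complex.Im (s%:C * (a +i* b)) = s * b by rewrite cImM /= mul0r addr0.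
split.
  rewrite cReM /cexp E1 E2 /=.
  have -> : (fun t : R => complex.Re (cexp (t%:C * (a +i* b)))) =
    (expR \o (fun t => t * a)) * (cos \o (fun t => t * b)).
    by apply/funext => s; rewrite /cexp E1 E2.
  by apply: is_derive_eq; rewrite /GRing.scale /=; ring.
rewrite cImM /cexp E1 E2 /=.
have -> : (fun t : R => complex.Im (cexp (t%:C * (a +i* b)))) =
  (expR \o (fun t => t * a)) * (sin \o (fun t => t * b)).
  by apply/funext => s; rewrite /cexp E1 E2.
by apply: is_derive_eq; rewrite /GRing.scale /=; ring.
Qed.

Lemma ccont_cexp_line (w : C) : ccont (fun t : R => cexp (t%:C * w)).
Proof.
apply: ccont_cexp; apply: ccontM; last exact: ccont_cst.
by apply: ccont_real; exact: continuous_id_fun.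
Qed.

(** Integrate the derivative along the segment from 0 to w. *)
Lemma cexp_sub1 (w : C) : cexp w - 1 = cint01 (fun t => w * cexp (t%:C * w)).
Proof.
have [c1 c2] := (ccontP _).1 (ccontZ (c := w) (@ccont_cexp_line w)).
rewrite /cint01 (FTC01 c1 (fun t _ => (is_derive_cexp_line w t).1)).
rewrite (FTC01 c2 (fun t _ => (is_derive_cexp_line w t).2)).
rewrite (rmorph0 (real_complex R)) (rmorph1 (real_complex R)) mul0r mul1r cexp0.
by apply: complex_eq; rewrite /= ?cReD ?cImD ?cReN ?cImN.
Qed.

Lemma Re_le_cabsW (w : C) : complex.Re w <= cabs w.
Proof. exact: le_trans (ler_norm _) (Re_le_cabs w). Qed.

Lemma cexp_line_bound (w : C) (t : R) : 0 <= t <= 1 -> cabs (cexp (t%:C * w)) <= expR (cabs w).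
Proof.
move=> /andP[t0 t1]; rewrite cabs_cexp ler_expR (le_trans (Re_le_cabsW _)) //.
by rewrite cabsM cabs_real ger0_norm // ler_piMl // cabs_ge0.
Qed.

Lemma cexp_bound1 (w : C) : cabs (cexp w - 1) <= 2 * (cabs w * expR (cabs w)).
Proof.
rewrite cexp_sub1 mulr_natl; apply: cint01_bound.
  by apply: ccontZ; exact: ccont_cexp_line.
by move=> t ht; rewrite cabsM ler_wpM2l ?cabs_ge0 // cexp_line_bound.
Qed.

(** The difference cexp w - 1 - w is the integral of w * (cexp (t w) - 1), to which the
    first order bound applies. *)
Lemma cexp_bound2 (w : C) : cabs (cexp w - 1 - w) <= 4 * (cabs w ^+ 2 * expR (cabs w)).
Proof.
have cl := @ccont_cexp_line w.
have -> : cexp w - 1 - w = cint01 (fun t => w * (cexp (t%:C * w) + -1)).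
  have c1 : ccont (fun _ : R => -1 : C) by exact: ccont_cst.
  have cm : ccont (fun t : R => cexp (t%:C * w) + -1) by apply: ccontD; [exact: cl|exact: c1].
  by rewrite cexp_sub1 (cint01Z w cl) (cint01Z w cm) (cint01D cl c1) cint01_cst; ring.
have -> : 4 * (cabs w ^+ 2 * expR (cabs w)) = (cabs w * (2 * (cabs w * expR (cabs w)))) *+ 2.
  by rewrite -mulr_natl; ring.
apply: cint01_bound.
  by apply: ccontZ; apply: ccontD; [exact: cl|exact: ccont_cst].
move=> t /andP[t0 t1]; rewrite cabsM ler_wpM2l ?cabs_ge0 //.
apply: le_trans (cexp_bound1 _) _; rewrite ler_pM2l //.
have tw : cabs (t%:C * w) <= cabs w.
  by rewrite cabsM cabs_real ger0_norm // ler_piMl // cabs_ge0.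
by rewrite ler_pM ?cabs_ge0 ?expR_ge0 // ler_expR.
Qed.

End ExponentialRemainder.

(** * Entire exponential series *)

Section HolomorphicFunctions.
Variables (R : realType) (n : nat).
Local Notation C := R[i].
Local Notation V := ('cV[C]_n : normedModType C).
Implicit Types (z h : 'cV[C]_n) (f : 'cV[C]_n -> C).

Definition differentiableC f := fun p => differentiable (f : _ -> C^o) p.

Definition cnorm h : R := \sum_i cabs (h i 0).

Lemma cnorm_ge0 h : 0 <= cnorm h.
Proof. by rewrite sumr_ge0 // => i _; exact: cabs_ge0. Qed.

Lemma coord_le_norm (m : nat) (h : 'M[C]_(m, 1)) i : `|h i 0| <= `|h|.
Proof.
have -> : `|h| = mx_norm h by [].
rewrite mx_normE -[leLHS]nngE num_le.
exact: (le_bigmax _ (fun ij => `|h ij.1 ij.2|%:nng) (i, 0)).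
Qed.

Lemma cnorm_le_norm h : (cnorm h)%:C <= n%:R * `|h|.
Proof.
rewrite rmorph_sum -[n in n%:R]card_ord -sum1_card natr_sum mulr_suml.
by apply: ler_sum => i _; rewrite mul1r /= cabsE coord_le_norm.
Qed.

(** The candidate for the differential at a point. *)
Definition linform (D : 'I_n -> C) (h : 'cV[C]_n) : C^o := \sum_i D i * h i 0.

Lemma linform_is_linear D : linear (linform D).
Proof.
move=> a u v; rewrite /linform scaler_sumr -big_split; apply: eq_bigr => i _ /=.
by rewrite !mxE /GRing.scale /=; ring.
Qed.

HB.instance Definition _ D :=
  GRing.isLinear.Build C 'cV[C]_n C^o _ (linform D) (linform_is_linear D).

Lemma linform_continuous D : continuous (linform D : 'cV[C^o]_n -> C^o).
Proof.
apply: (@continuous_sum_fun 'cV[C^o]_n _ _ C^o) => i.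
apply: (@continuousZ_fun _ C).
exact: (@continuous_coord C^o n 1 i 0).
Qed.

(** The remainder is O(|h|^2), hence o(h). *)
Lemma differentiable_quadratic f z (D : 'I_n -> C) (K : R) : 0 <= K ->
  (forall h, cnorm h <= 1 -> cabs (f (z + h) - f z - linform D h) <= K * cnorm h ^+ 2) ->
  differentiableC f z.
Proof.
move=> K0 hK.
have lo : (f : _ -> C^o) \o shift z = cst (f z : C^o) + linform D +o_ (0 : V) id.
  apply/eqaddoP => e e0.
  have eE : e = (complex.Re e)%:C by rewrite RRe_real ?gtr0_real.
  have re0 : 0 < complex.Re e by rewrite -(ltcR 0) -eE.
  set r := complex.Re e in eE re0.
  pose d := Num.min (n.+1%:R^-1) (r / (K + 1) / n.+1%:R ^+ 2) : R.
  have n0 : (0 : R) < n.+1%:R by rewrite ltr0n.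
  have K1 : 0 < K + 1 by rewrite ltr_wpDl.
  have d0 : 0 < d by rewrite lt_min invr_gt0 n0 /= !divr_gt0 // exprn_gt0.
  have : \forall h \near (0 : V), `|h| < d%:C.
    by apply/nbhs_norm0P; exists d%:C => //=; rewrite (ltcR 0).
  apply: filterS => h hd.
  have [x xE] : exists x : R, `|h| = x%:C.
    by apply/complex_realP; rewrite ger0_real.
  have x0 : 0 <= x by have := normr_ge0 h; rewrite xE (lecR 0).
  have xd : x < d by rewrite -ltcR -xE; exact: hd.
  have hx : cnorm h <= n.+1%:R * x.
    rewrite -lecR (le_trans (cnorm_le_norm h)) // xE rmorphM rmorph_nat.
    by rewrite ler_wpM2r // ?(lecR 0) // ler_nat.
  have h1 : cnorm h <= 1.
    apply: le_trans hx _; rewrite mulrC -ler_pdivlMr // mul1r.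
    by apply: ltW; apply: lt_le_trans xd _; rewrite /d ge_min lexx.
  have -> : ((f : _ -> C^o) \o shift z - (cst (f z : C^o) + linform D)) h =
     f (z + h) - f z - linform D h.
    by rewrite !fctE /= opprD addrA [h + z]addrC.
  rewrite -cabsE xE eE -rmorphM lecR; apply: le_trans (hK h h1) _.
  have cn2 : cnorm h ^+ 2 <= n.+1%:R ^+ 2 * x * d.
    apply: (@le_trans _ _ ((n.+1%:R * x) ^+ 2)).
      by rewrite lerXn2r ?nnegrE ?cnorm_ge0 ?mulr_ge0 // ltW.
    rewrite exprMn -[leRHS]mulrA ler_wpM2l ?exprn_ge0 ?(ltW n0) //.
    by rewrite expr2 ler_wpM2l // ltW.
  apply: (@le_trans _ _ ((K + 1) * (n.+1%:R ^+ 2 * x * d))).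
    by apply: ler_pM; rewrite ?exprn_ge0 ?cnorm_ge0 ?lerDl.
  have dr : d <= r / (K + 1) / n.+1%:R ^+ 2 by rewrite /d ge_min lexx orbT.
  have -> : r * x = (K + 1) * (n.+1%:R ^+ 2 * x * (r / (K + 1) / n.+1%:R ^+ 2)).
    by field; rewrite !gt_eqF.
  apply: ler_wpM2l; first exact: ltW.
  by apply: ler_wpM2l dr; apply: mulr_ge0 => //; apply: exprn_ge0; exact: ltW.
have dfE := diff_unique (@linform_continuous D) lo.
by apply/diff_locallyP; rewrite dfE; split => //; exact: linform_continuous.
Qed.

Lemma holo_ccont f : (forall z, differentiableC f z) ->
  ccont (f : 'cV[C^o]_n -> C).
Proof. by move=> df z; apply: differentiable_continuous; exact: df. Qed.

Lemma cdiff_derivable (g : C -> C) (z : C) :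
  derivable (g : C^o -> C^o) z 1 -> cdiff g z.
Proof.
move=> /derivable_nbhs/eqaddoP hD.
exists (@derive C C^o C^o g z 1) => e e0.
have e0' : 0 < e%:C by rewrite (ltcR 0).
have := hD _ e0' => /nbhs_norm0P [r /= r0 hr].
have rE : r = (complex.Re r)%:C by rewrite RRe_real ?gtr0_real.
exists (complex.Re r) => [|h hd]; first by rewrite -(ltcR 0) -rE.
have := hr h; rewrite /= -cabsE rE ltcR => /(_ hd).
rewrite !fctE /= -!cabsE -rmorphM lecR opprD addrA.
by rewrite [_ *: 1 + z]addrC /GRing.scale /= mulr1.
Qed.

Lemma differentiable_line f z v : differentiableC f z ->
  derivable ((fun h : C => f (z + h *: v)) : C^o -> C^o) 0 1.
Proof.
move=> df; have := @diff_derivable C V C^o f z v df; rewrite /derivable.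
have -> : (fun h : C => h^-1 *: (((f : V -> C^o) \o shift z) (h *: v) - (f z : C^o))) =
  (fun h : C => h^-1 *: (((fun h : C => f (z + h *: v) : C^o) \o shift (0 : C^o)) (h *: (1 : C^o))
     - (f (z + (0 : C) *: v) : C^o))) => //.
apply/funext => h /=; rewrite scale0r addr0 addr0.
have -> : h *: (1 : C^o) = h by rewrite /GRing.scale /= mulr1.
by rewrite [h *: v + z]addrC.
Qed.

Lemma holo_sepdiff f : (forall z, differentiableC f z) -> sepdiff f.
Proof. by move=> df z i; apply: cdiff_derivable; exact: differentiable_line. Qed.

End HolomorphicFunctions.

Section ExponentialSeries.
Variables (R : realType) (n : nat).
Local Notation C := R[i].
Variable a : 'cV[int]_n -> C.
Hypothesis ha : forall M : R, 0 <= M -> summ (fun b => cabs (a b) * expR (M * l1 R b)).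

Definition tpi : C := 2 * pi%:C * 'i%C.

Definition bdot (b : 'cV[int]_n) (z : 'cV[C]_n) : C := dot (map_mx intr b) z.

Definition expterm b z : C := a b * cexp (tpi * bdot b z).

(** A Fourier series in the complex variable z. The standing hypothesis asks that the
    coefficients decay faster than any exponential, so that the series converges on all of
    C^n. *)
Definition expser z : C := tsum (expterm ^~ z).

Lemma bdotD b z w : bdot b (z + w) = bdot b z + bdot b w.
Proof. by rewrite /bdot dotDr. Qed.

Lemma cabs_tpi : cabs tpi = 2 * pi.
Proof.
rewrite /tpi !cabsM cabs_nat cabs_real cabsi mulr1 ger0_norm //.
exact: pi_ge0.
Qed.

Lemma l1_ge0 (b : 'cV[int]_n) : 0 <= l1 R b.
Proof. by rewrite sumr_ge0. Qed.

Lemma cabs_bdot b z : cabs (bdot b z) <= l1 R b * cnorm z.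
Proof.
rewrite /bdot dotE (le_trans (cabs_sum _ _ _)) // mulr_suml.
apply: ler_sum => i _; rewrite cabsM mxE -(rmorph_int (real_complex R)) cabs_real.
rewrite ler_wpM2l // /cnorm (bigD1 i) //= lerDl sumr_ge0 // => j _.
exact: cabs_ge0.
Qed.

Lemma cabs_tpi_bdot b z : cabs (tpi * bdot b z) <= 2 * pi * cnorm z * l1 R b.
Proof.
rewrite cabsM cabs_tpi -[leRHS]mulrA ler_wpM2l ?mulr_ge0 ?pi_ge0 //.
by rewrite mulrC cabs_bdot.
Qed.

Lemma expterm_bound b z (r : R) : cnorm z <= r ->
  cabs (expterm b z) <= cabs (a b) * expR (2 * pi * r * l1 R b).
Proof.
move=> zr; rewrite cabsM ler_wpM2l ?cabs_ge0 // cabs_cexp ler_expR.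
apply: le_trans (Re_le_cabsW _) _; apply: le_trans (cabs_tpi_bdot _ _) _.
by rewrite ler_wpM2r ?l1_ge0 // ler_wpM2l // mulr_ge0 ?pi_ge0.
Qed.

Lemma has_sum_expser z : has_sum (expterm ^~ z) (expser z).
Proof.
apply: tsumP; apply: summ_le (ha (M := 2 * pi * cnorm z) _).
  by move=> b; exact: expterm_bound.
by rewrite !mulr_ge0 ?pi_ge0 ?cnorm_ge0.
Qed.

Lemma sqr_le_expR (x : R) : 0 <= x -> x ^+ 2 <= 4 * expR x.
Proof.
move=> x0; have h : x / 2 <= expR (x / 2).
  by apply: le_trans (expR_ge1Dx _); lra.
have -> : expR x = expR (x / 2) ^+ 2.
  by rewrite expr2 -expRD; congr expR; lra.
have := lerXn2r 2 _ _ h; rewrite !nnegrE expR_ge0 divr_ge0 // => /(_ isT isT).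
by rewrite expr_div_n ler_pdivrMr ?exprn_gt0 // expr2 => /le_trans; apply; lra.
Qed.

(** The series is compared termwise with its formal differential; the second order
    remainders of the exponentials sum up to O(|h|^2). *)
Lemma expser_differentiable z : differentiableC expser z.
Proof.
pose Dt (i : 'I_n) (b : 'cV[int]_n) := expterm b z * (tpi * (b i 0)%:~R).
have pi0 := pi_ge0 R; have z0 := cnorm_ge0 z.
pose M := 2 * pi * (cnorm z + 2).
have M0 : 0 <= M by apply: mulr_ge0; [rewrite mulr_ge0|rewrite addr_ge0].
have sM := ha M0.
have bi (b : 'cV[int]_n) i : `|(b i 0)%:~R| <= l1 R b :> R.
  by rewrite /l1 (bigD1 i) //= lerDl sumr_ge0.
have sD i : summ (fun b => cabs (Dt i b)).
  apply: summ_le sM => b; rewrite /Dt cabsM [cabs (tpi * _)]cabsM cabs_tpi.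
  rewrite -(rmorph_int (real_complex R)) cabs_real /expterm cabsM cabs_cexp.
  rewrite -mulrA ler_wpM2l ?cabs_ge0 //; apply: (@le_trans _ _ (expR (2 * pi * cnorm z * l1 R b) * expR (2 * pi * l1 R b))).
    apply: ler_pM; rewrite ?expR_ge0 ?mulr_ge0 //.
      by rewrite ler_expR (le_trans (Re_le_cabsW _)) // cabs_tpi_bdot.
    apply: (@le_trans _ _ (2 * pi * l1 R b)).
      by rewrite ler_wpM2l ?mulr_ge0.
    by apply: le_trans (expR_ge1Dx _); rewrite lerDr.
  rewrite -expRD ler_expR /M; have := l1_ge0 b; move: (l1 R b) => l l0.
  have : 0 <= 2 * pi * l by rewrite !mulr_ge0.
  by lra.
pose D i := tsum (Dt i).
have hD i : has_sum (Dt i) (D i) by exact: tsumP.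
have [S hS] := sM.
have S0 : 0 <= S by have := hS fset0; rewrite big_nil.
apply: (@differentiable_quadratic R n expser z D (16 * S)); first by rewrite mulr_ge0.
move=> h h1.
have hlin : has_sum (fun b => expterm b z * (tpi * bdot b h)) (linform D h).
  have -> : (fun b => expterm b z * (tpi * bdot b h)) = (fun b => \sum_i h i 0 * Dt i b).
    apply/funext => b; rewrite /bdot dotE !mulr_sumr; apply: eq_bigr => i _.
    by rewrite /Dt mxE; ring.
  rewrite /linform; elim: (index_enum _) => [|i r IH].
    rewrite big_nil; under [X in has_sum X]funext do rewrite big_nil.
    have := @has_sum_supp R _ fset0 (fun _ : 'cV[int]_n => 0 : C); rewrite big_nil.
    exact.
  rewrite big_cons; under [X in has_sum X]funext do rewrite big_cons.
  by apply: has_sumD IH; rewrite mulrC; exact: has_sumZ.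
have H := has_sumD (has_sum_expser (z + h)) (has_sumZ (-1)
  (has_sumD (has_sum_expser z) hlin)).
have -> : expser (z + h) - expser z - linform D h =
   expser (z + h) + -1 * (expser z + linform D h) by rewrite mulN1r opprD addrA.
apply: (has_sum_abs_le H) => A.
apply: (@le_trans _ _ (\sum_(b <- A) 16 * cnorm h ^+ 2 * (cabs (a b) * expR (M * l1 R b)))).
  apply: ler_sum => b _.
  set x := tpi * bdot b h.
  have -> : expterm b (z + h) + -1 * (expterm b z + expterm b z * x) =
     expterm b z * (cexp x - 1 - x).
    by rewrite /expterm bdotD mulrDr cexpD -/x; ring.
  rewrite cabsM; have hx := cexp_bound2 x.
  have xb : cabs x <= 2 * pi * l1 R b * cnorm h.
    by apply: le_trans (cabs_tpi_bdot b h) _; rewrite mulrAC.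
  set y := 2 * pi * l1 R b in xb.
  have y0 : 0 <= y by rewrite !mulr_ge0 ?l1_ge0.
  have xy : cabs x <= y by apply: le_trans xb _; rewrite ler_piMr.
  have c0 := cabs_ge0 x; have n0 := cnorm_ge0 h.
  have k1 : cabs x ^+ 2 <= y ^+ 2 * cnorm h ^+ 2.
    rewrite -exprMn; apply: lerXn2r xb; rewrite nnegrE //.
    exact: mulr_ge0.
  have k2 : cabs x ^+ 2 * expR (cabs x) <= 4 * expR y * cnorm h ^+ 2 * expR y.
    apply: ler_pM; rewrite ?exprn_ge0 ?expR_ge0 ?ler_expR //.
    apply: le_trans k1 _; rewrite ler_wpM2r ?exprn_ge0 //.
    exact: sqr_le_expR.
  apply: (@le_trans _ _ (cabs (a b) * expR (2 * pi * cnorm z * l1 R b) *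
      (4 * (4 * expR y * cnorm h ^+ 2 * expR y)))).
    apply: ler_pM; rewrite ?cabs_ge0 //; first exact: expterm_bound.
    by apply: le_trans hx _; rewrite ler_wpM2l.
  have -> : M * l1 R b = 2 * pi * cnorm z * l1 R b + y + y.
    by rewrite /M /y; ring.
  rewrite !expRD le_eqVlt; apply/orP; left; apply/eqP; ring.
rewrite -mulr_sumr mulrAC ler_wpM2r ?exprn_ge0 ?cnorm_ge0 //.
by rewrite ler_wpM2l.
Qed.

Lemma bdot_int b (l : 'cV[int]_n) : bdot b (map_mx intr l) = (dot b l)%:~R.
Proof. by rewrite /bdot !dotE rmorph_sum; apply: eq_bigr => i _; rewrite !mxE rmorphM. Qed.

Lemma cexp_tpi_int (m : int) : cexp (tpi * m%:~R) = 1.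
Proof. exact: cexp_periodic. Qed.

Lemma expser_per : zper expser.
Proof.
move=> l z; congr tsum; apply/funext => b.
by rewrite /expterm bdotD mulrDr cexpD bdot_int cexp_tpi_int mulr1.
Qed.

Lemma cexp_bdot_real b (x : 'cV[R]_n) : cexp (tpi * bdot b (complex_mx x)) = chi b x.
Proof.
rewrite /chi; congr cexp.
have -> : bdot b (complex_mx x) = (dot (map_mx intr b) x)%:C.
  rewrite /bdot !dotE rmorph_sum; apply: eq_bigr => i _.
  by rewrite !mxE [RHS](rmorphM (real_complex R)) (rmorph_int (real_complex R)).
by rewrite /tpi !(rmorphM (real_complex R)) (rmorph_nat (real_complex R)); ring.
Qed.

(** On a real slice with base point w the series is an ordinary Fourier series, with
    coefficients expterm b w. *)
Lemma expser_fourier (w : 'cV[C]_n) (x : 'cV[R]_n) :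
  has_sum (fun b => expterm b w * chi b x) (expser (complex_mx x + w)).
Proof.
have := has_sum_expser (complex_mx x + w); congr has_sum; apply/funext => b.
by rewrite /expterm bdotD mulrDr cexpD cexp_bdot_real [chi _ _ * _]mulrC mulrA.
Qed.

Lemma summ_expterm w : summ (fun b => cabs (expterm b w)).
Proof.
apply: summ_le (ha (M := 2 * pi * cnorm w) _); first by move=> b; exact: expterm_bound.
by rewrite !mulr_ge0 ?pi_ge0 ?cnorm_ge0.
Qed.

End ExponentialSeries.

(** * Theta functions *)

Lemma cexpJ (R : realType) (z : R[i]) : (cexp z)^*%C = cexp z^*%C.
Proof.
by case: z => a b; rewrite /cexp /= cosN sinN mulrN.
Qed.

Lemma cexpX (R : realType) (z : R[i]) k : cexp z ^+ k = cexp (k%:R * z).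
Proof.
elim: k => [|k IH]; first by rewrite expr0 mul0r cexp0.
by rewrite exprS IH -cexpD -natr1 mulrDl mul1r addrC.
Qed.

Lemma cexp_real (R : realType) (x : R) : cexp x%:C = (expR x)%:C.
Proof. by rewrite /cexp /= cos0 sin0 mulr1 mulr0. Qed.

Lemma cexp_neq0 (R : realType) (z : R[i]) : cexp z != 0.
Proof.
apply/eqP => h; have := cabs_cexp z; rewrite h cabs0 => /esym/eqP.
by rewrite gt_eqF // expR_gt0.
Qed.

Section Theta.
Variables (R : realType) (n : nat) (Z : 'M[R[i]]_n).
Hypothesis hZ : siegel Z.
Variable k : nat.
Hypothesis k0 : (0 < k)%N.
Local Notation C := R[i].
Local Notation X := (re_mx Z).
Local Notation Y := (im_mx Z).
Local Notation ir b := (map_mx intr b : 'cV[R]_n).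

Lemma Xsym : X^T = X.
Proof. by apply/matrixP => i j; rewrite !mxE -{1}hZ.1 mxE. Qed.

Lemma Ysym : Y^T = Y.
Proof. by apply/matrixP => i j; rewrite !mxE -{1}hZ.1 mxE. Qed.

(** The bilinear form of Z on real vectors, split into its real and imaginary parts. *)
Definition qZ (u v : 'cV[R]_n) : C := dot u (X *m v) +i* dot u (Y *m v).

Lemma qZDl u u' v : qZ (u + u') v = qZ u v + qZ u' v.
Proof. by rewrite /qZ !dotDl. Qed.
Lemma qZDr u v v' : qZ u (v + v') = qZ u v + qZ u v'.
Proof. by rewrite /qZ !mulmxDr !dotDr. Qed.
Lemma qZC u v : qZ u v = qZ v u.
Proof. by rewrite /qZ (dot_symm Xsym) (dot_symm Ysym). Qed.
Lemma qZZl (c : R) u v : qZ (c *: u) v = c%:C * qZ u v.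
Proof. by rewrite /qZ !dotZl; apply: complex_eq => /=; rewrite mul0r ?subr0 ?addr0. Qed.
Lemma qZZr (c : R) u v : qZ u (c *: v) = c%:C * qZ u v.
Proof. by rewrite qZC qZZl qZC. Qed.

Lemma ZE : Z = complex_mx X + 'i%C *: complex_mx Y.
Proof. by apply/matrixP => i j; rewrite !mxE -complexE. Qed.

Lemma dot_complex (u v : 'cV[R]_n) : dot (complex_mx u) (complex_mx v) = (dot u v)%:C.
Proof.
rewrite !dotE rmorph_sum; apply: eq_bigr => i _.
by rewrite !mxE [RHS](rmorphM (real_complex R)).
Qed.

Lemma complex_mxM m (A : 'M[R]_(m, n)) (v : 'cV[R]_n) :
  complex_mx (A *m v) = complex_mx A *m complex_mx v.
Proof. exact: (map_mxM (real_complex R)). Qed.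

Lemma complex_ir (b : 'cV[int]_n) : complex_mx (ir b) = map_mx intr b.
Proof. by apply/colP => i; rewrite !mxE rmorph_int. Qed.

Lemma dot_complex_qZ (u v : 'cV[R]_n) :
  dot (complex_mx u) (Z *m complex_mx v) = qZ u v.
Proof.
rewrite {1}ZE mulmxDl dotDr -scalemxAl dotZr -!complex_mxM !dot_complex /qZ.
by rewrite [RHS]complexE.
Qed.

Lemma bdot_qZ b (v : 'cV[R]_n) : bdot b (Z *m complex_mx v) = qZ (ir b) v.
Proof. by rewrite -dot_complex_qZ complex_ir. Qed.

Lemma bdotDl (b b' : 'cV[int]_n) (z : 'cV[C]_n) : bdot (b + b') z = bdot b z + bdot b' z.
Proof. by rewrite /bdot map_mxD dotDl. Qed.

Lemma ir_scale (c : nat) (b : 'cV[int]_n) : ir (c%:Z *: b) = c%:R *: ir b.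
Proof. by apply/colP => i; rewrite !mxE intrM. Qed.

Lemma irD (b b' : 'cV[int]_n) : ir (b + b') = ir b + ir b'.
Proof. by apply/colP => i; rewrite !mxE intrD. Qed.

Lemma bdotZl (c : nat) (b : 'cV[int]_n) (z : 'cV[C]_n) : bdot (c%:Z *: b) z = c%:R * bdot b z.
Proof.
rewrite /bdot -dotZl; congr dot.
by apply/colP => i; rewrite !mxE intrM.
Qed.

Definition cong (s m : 'cV[int]_n) : bool := [forall i, (k%:Z %| (m i 0 - s i 0)%R)%Z].

Lemma congP s m : reflect (exists b : 'cV[int]_n, m = s + k%:Z *: b) (cong s m).
Proof.
apply: (iffP forallP) => [h|[b ->] i]; last first.
  by rewrite !mxE addrAC subrr add0r dvdz_mulr.
exists (\col_i ((m i 0 - s i 0)%R %/ k%:Z)%Z); apply/colP => i; rewrite !mxE.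
by rewrite mulrC divzK ?h // addrC subrK.
Qed.

Lemma cong_refl s : cong s s.
Proof. by apply/forallP => i; rewrite subrr dvdz0. Qed.

Lemma congD s m r : cong (s + r) (m + r) = cong s m.
Proof. by apply: eq_forallb => i; rewrite !mxE opprD addrACA subrr addr0. Qed.

Lemma cong_shift s m b : cong s (m + k%:Z *: b) = cong s m.
Proof.
apply: eq_forallb => i; rewrite !mxE addrAC; apply: rpredDr.
by rewrite /= dvdz_mulr.
Qed.

(** Congruence is an equivalence relation, in the form of a rewriting rule. *)
Lemma cong_eq s s' m : cong s m -> cong s' m = cong s s'.
Proof.
move=> /congP [b ->]; rewrite cong_shift; apply: eq_forallb => i.
exact: rpredBC.
Qed.

Lemma k_neq0 : (k%:R : R) != 0.
Proof. by rewrite pnatr_eq0 -lt0n. Qed.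

Lemma k_gt0 : 0 < (k%:R : R).
Proof. by rewrite ltr0n. Qed.

Definition texp (m : 'cV[int]_n) : C := (pi / k%:R)%:C * 'i%C * qZ (ir m) (ir m).

(** The coefficients prescribed by the quasi-periodicity: the multipliers relate the
    coefficients at m and m + k b, so a section is free to choose one coefficient in each
    class mod k. *)
Definition tcoef (s m : 'cV[int]_n) : C := if cong s m then cexp (texp m) else 0.

(** A Gaussian for the positive definite form Y beats every exponential. *)
Lemma gauss_summ (c : R) (a : 'cV[int]_n -> C) : 0 < c ->
  (forall m, cabs (a m) <= expR (- (c * dot (ir m) (Y *m ir m)))) ->
  forall M : R, 0 <= M -> summ (fun m => cabs (a m) * expR (M * l1 R m)).
Proof.
move=> c0 ac M M0; have [al al0 hal] := pos_form_lower Ysym hZ.2.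
have [K K0 hK] := gauss_lwt n M (mulr_gt0 c0 al0).
apply: summ_le (summZ K0 (@summ_lwt R n)) => m.
apply: le_trans (hK m); rewrite expRD ler_wpM2r ?expR_ge0 //.
apply: le_trans (ac m) _; rewrite ler_expR lerN2 -mulrA ler_wpM2l ?(ltW c0) //.
by have := hal (ir m); under eq_bigr do rewrite mxE.
Qed.

Lemma cabs_tcoef s m : cabs (tcoef s m) <= expR (- (pi / k%:R * dot (ir m) (Y *m ir m))).
Proof.
rewrite /tcoef; case: ifP => _; last by rewrite cabs0 expR_ge0.
rewrite cabs_cexp ler_expR /texp /qZ cReM cImM cReM /=.
by move: (dot _ _) (dot _ _) (pi / _) => x y p; lra.
Qed.

Lemma tcoef_summ s (M : R) : 0 <= M -> summ (fun m => cabs (tcoef s m) * expR (M * l1 R m)).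
Proof.
by apply: (@gauss_summ (pi / k%:R)); [rewrite divr_gt0 ?pi_gt0 ?k_gt0|exact: cabs_tcoef].
Qed.

(** The theta function of the class of s: in the usual notation, theta with characteristic
    s / k evaluated at k z for the period matrix k Z. *)
Definition theta s : 'cV[C]_n -> C := expser (tcoef s).
Definition th s : 'cV[R]_(n + n) -> C := fun v => theta s (zcoord Z v).

Lemma theta_differentiable s z : differentiableC (theta s) z.
Proof. exact: (expser_differentiable (@tcoef_summ s)). Qed.

Lemma multiplierE (l : 'cV[int]_(n + n)) z : multiplier Z l z =
  cexp (- (tpi R * bdot (dsubmx l) z) - pi%:C * 'i%C * qZ (ir (dsubmx l)) (ir (dsubmx l))).
Proof.
rewrite /multiplier; set b := map_mx intr (dsubmx l).
have -> : dot b (Z *m b) = qZ (ir (dsubmx l)) (ir (dsubmx l)).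
  by rewrite -dot_complex_qZ complex_ir.
by rewrite /bdot -/b /tpi.
Qed.

(** Translation by Z b multiplies the m-th term by an exponential, and the Gaussian
    coefficients turn this into the shift m -> m + k b of the index. *)
Lemma theta_quasiper s (l : 'cV[int]_(n + n)) z :
  theta s (z + (map_mx intr (usubmx l) + Z *m map_mx intr (dsubmx l))) =
  multiplier Z l z ^+ k * theta s z.
Proof.
set b := dsubmx l.
have pt : zper (theta s) by exact: expser_per.
rewrite [map_mx intr (usubmx l) + _]addrC addrA (pt (usubmx l)).
have sM := @tcoef_summ s.
apply: has_sum_uniq (has_sum_expser sM _) _.
have H := has_sumZ (multiplier Z l z ^+ k) (has_sum_expser sM z).
have inj : injective (fun m : 'cV[int]_n => m + k%:Z *: b) by move=> m m' /addIr.
have supp (m : 'cV[int]_n) : (forall j, m <> j + k%:Z *: b) ->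
    multiplier Z l z ^+ k * expterm (tcoef s) m z = 0.
  by move=> h; exfalso; apply: (h (m - k%:Z *: b)); rewrite subrK.
have {H} := (@has_sum_reindex R _ _ _ _ _ inj supp).1 H.
have -> : ((fun m => multiplier Z l z ^+ k * expterm (tcoef s) m z) \o
   (fun m => m + k%:Z *: b)) =
   (fun m => expterm (tcoef s) m (z + Z *m map_mx intr b)).
  apply/funext => m /=; rewrite /expterm /tcoef cong_shift; case: ifP => _; last first.
    by rewrite !mul0r mulr0.
  rewrite multiplierE cexpX -!cexpD; congr cexp.
  rewrite bdotD -(complex_ir b) bdot_qZ bdotDl bdotZl /texp irD ir_scale.
  rewrite !qZDl !qZDr !qZZl !qZZr (qZC (ir b) (ir m)) -/b.
  have pkE : (pi / k%:R)%:C = pi%:C / k%:R :> C.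
    by rewrite (rmorphM (real_complex R)) (fmorphV (real_complex R)) (rmorph_nat (real_complex R)).
  have kE : (k%:R : R)%:C = k%:R by rewrite (rmorph_nat (real_complex R)).
  rewrite pkE !kE.
  have kn : (k%:R : C) != 0 by rewrite pnatr_eq0 -lt0n.
  rewrite /tpi.
  move: (bdot b z) (bdot m z) (qZ (ir b) (ir b)) (qZ (ir m) (ir b)) (qZ (ir m) (ir m)) => x1 x2 x3 x4 x5.
  move: (pi%:C) ('i%C) (k%:R) kn => p i K kn.
  by field.
exact.
Qed.

Lemma zcoordD v (l : 'cV[int]_(n + n)) : zcoord Z (v + map_mx intr l) =
  zcoord Z v + (map_mx intr (usubmx l) + Z *m map_mx intr (dsubmx l)).
Proof.
rewrite /zcoord !linearD /= -map_usubmx -map_dsubmx /complex_mx !map_mxD.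
rewrite mulmxDr -!/(complex_mx _) !complex_ir addrACA; congr (_ + _).
Qed.

End Theta.

(** * The Gaussian integral *)

Section GaussianSeries.
Variables (R : realType) (n : nat) (Z : 'M[R[i]]_n).
Hypothesis hZ : siegel Z.
Variable k : nat.
Hypothesis k0 : (0 < k)%N.
Local Notation C := R[i].
Local Notation X := (re_mx Z).
Local Notation Y := (im_mx Z).
Local Notation ir b := (map_mx intr b : 'cV[R]_n).
Local Notation ic b := (map_mx intr b : 'cV[C]_n).

(** The complex bilinear extension of the form Y. *)
Definition bY (u v : 'cV[C]_n) : C := dot u (complex_mx Y *m v).

Lemma bYDl u u' v : bY (u + u') v = bY u v + bY u' v.
Proof. by rewrite /bY dotDl. Qed.
Lemma bYDr u v v' : bY u (v + v') = bY u v + bY u v'.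
Proof. by rewrite /bY mulmxDr dotDr. Qed.
Lemma bYC u v : bY u v = bY v u.
Proof.
have YC : (complex_mx Y)^T = complex_mx Y.
  by apply/matrixP => i j; rewrite !mxE -{1}hZ.1 mxE.
by rewrite /bY dotC /dot trmx_mul YC mulmxA.
Qed.
Lemma bYZl (c : C) u v : bY (c *: u) v = c * bY u v.
Proof. by rewrite /bY dotZl. Qed.
Lemma bYZr (c : C) u v : bY u (c *: v) = c * bY u v.
Proof. by rewrite bYC bYZl bYC. Qed.
Lemma bY_real (u v : 'cV[R]_n) : bY (complex_mx u) (complex_mx v) = (dot u (Y *m v))%:C.
Proof. by rewrite /bY -complex_mxM dot_complex. Qed.

Lemma icD (b b' : 'cV[int]_n) : ic (b + b') = ic b + ic b'.
Proof. by apply/colP => i; rewrite !mxE intrD. Qed.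

Definition gcoef (s m : 'cV[int]_n) : C :=
  if cong k s m then cexp (- (2 * pi%:C / k%:R) * bY (ic m) (ic m)) else 0.

Lemma gcoef_summ s (M : R) : 0 <= M -> summ (fun m => cabs (gcoef s m) * expR (M * l1 R m)).
Proof.
apply: (@gauss_summ R n Z hZ (2 * pi / k%:R)).
  by rewrite divr_gt0 ?mulr_gt0 ?pi_gt0 ?(k_gt0 R k0).
move=> m; rewrite /gcoef; case: ifP => _; last by rewrite cabs0 expR_ge0.
rewrite cabs_cexp ler_expR -complex_ir bY_real.
have -> : - (2 * pi%:C / k%:R) * (dot (ir m) (Y *m ir m))%:C =
   (- (2 * pi / k%:R * dot (ir m) (Y *m ir m)))%:C.
  rewrite [RHS](rmorphN (real_complex R)) !(rmorphM (real_complex R)).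
  by rewrite (fmorphV (real_complex R)) !(rmorph_nat (real_complex R)) mulNr.
by [].
Qed.

(** The sum over m congruent to s of the Gaussians exp (- 2 pi k Q (w + m / k)), Q being
    the quadratic form of Y. It is written as a Gaussian factor times a theta series, so
    that its convergence and its holomorphy in w follow from those of exponential series. *)
Definition gauss s (w : 'cV[C]_n) : C :=
  cexp (- (2 * pi%:C * k%:R) * bY w w) *
  expser (gcoef s) ((2 * 'i%C) *: (complex_mx Y *m w)).

Definition gterm s (w : 'cV[C]_n) m : C :=
  cexp (- (2 * pi%:C * k%:R) * bY w w) * expterm (gcoef s) m ((2 * 'i%C) *: (complex_mx Y *m w)).

Lemma has_sum_gauss s w : has_sum (gterm s w) (gauss s w).
Proof. by apply: has_sumZ; apply: has_sum_expser; exact: gcoef_summ. Qed.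

Lemma gtermE s w m : cong k s m -> gterm s w m =
  cexp (- (2 * pi%:C * k%:R) * bY w w - 2 * pi%:C / k%:R * bY (ic m) (ic m)
        - 4 * pi%:C * bY (ic m) w).
Proof.
move=> sm; rewrite /gterm /expterm /gcoef sm -!cexpD; congr cexp.
have -> : bdot m ((2 * 'i%C) *: (complex_mx Y *m w)) = 2 * 'i%C * bY (ic m) w.
  by rewrite /bdot dotZr.
have i2 : 'i%C * 'i%C = -1 :> C by rewrite -expr2 sqr_i.
rewrite /tpi; move: (bY w w) (bY (ic m) w) (bY (ic m) (ic m)) => x y z.
have -> : 2 * pi%:C * 'i%C * (2 * 'i%C * y) = 4 * pi%:C * ('i%C * 'i%C) * y by ring.
rewrite i2; ring.
Qed.

Lemma gterm0 s w m : ~~ cong k s m -> gterm s w m = 0.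
Proof. by move=> /negPf sm; rewrite /gterm /expterm /gcoef sm mul0r mulr0. Qed.

(** Translating w by b / k reindexes the sum. *)
Lemma gauss_translate s b w : gauss s (w + k%:R^-1 *: ic b) = gauss (s + b) w.
Proof.
apply: has_sum_uniq (has_sum_gauss s _) _.
have inj : injective (fun m : 'cV[int]_n => m + b) by move=> m m' /addIr.
have supp (m : 'cV[int]_n) : (forall j, m <> j + b) -> gterm (s + b) w m = 0.
  by move=> h; exfalso; apply: (h (m - b)); rewrite subrK.
have := (@has_sum_reindex R _ _ _ _ _ inj supp).1 (has_sum_gauss (s + b) w).
suff -> : gterm (s + b) w \o (fun m => m + b) = gterm s (w + k%:R^-1 *: ic b) by [].
apply/funext => m; rewrite [LHS]/=.
have [sm|sm] := boolP (cong k s m); last first.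
  have sm' : ~~ cong k (s + b) (m + b) by rewrite congD.
  by rewrite (gterm0 _ sm) (gterm0 _ sm').
have sm' : cong k (s + b) (m + b) by rewrite congD.
rewrite (gtermE _ sm) (gtermE _ sm'); congr cexp.
rewrite icD !bYDl !bYDr !bYZl !bYZr (bYC (ic b) (ic m)) (bYC w (ic b)).
have kn : (k%:R : C) != 0 by rewrite pnatr_eq0 -lt0n.
move: (bY w w) (bY (ic b) w) (bY (ic b) (ic b)) (bY (ic m) w) (bY (ic m) (ic b)) (bY (ic m) (ic m)) => x1 x2 x3 x4 x5 x6.
by move: (pi%:C) (k%:R) kn => p K kn; field.
Qed.

Lemma gauss_class s b : gauss (s + k%:Z *: b) = gauss s.
Proof.
have E m : cong k (s + k%:Z *: b) m = cong k s m.
  rewrite -(cong_shift k s m (- b)) -(congD _ s _ (k%:Z *: b)).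
  by rewrite scalerN subrK.
have -> // : gauss (s + k%:Z *: b) = fun w => cexp (- (2 * pi%:C * k%:R) * bY w w) *
  expser (gcoef (s + k%:Z *: b)) ((2 * 'i%C) *: (complex_mx Y *m w)) by [].
have -> // : gcoef (s + k%:Z *: b) = gcoef s.
by apply/funext => m; rewrite /gcoef E.
Qed.

Lemma gauss_per s : zper (gauss s).
Proof.
move=> l w; have := gauss_translate s (k%:Z *: l) w; rewrite gauss_class.
have -> // : k%:R^-1 *: ic (k%:Z *: l) = ic l.
apply/colP => i; rewrite !mxE intrM /= mulrA mulVf ?mul1r //.
by rewrite pnatr_eq0 -lt0n.
Qed.

Lemma bY_continuous (T : topologicalType) (f : T -> 'cV[C^o]_n) :
  continuous f -> ccont (fun x => bY (f x) (f x)).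
Proof.
move=> cf.
have cfi i : ccont (fun x => f x i 0).
  exact: (@continuous_comp_fun T 'cV[C^o]_n C^o f (fun M => M i 0) cf (@continuous_coord C^o n 1 i 0)).
have -> : (fun x => bY (f x) (f x)) =
   (fun x => \sum_i f x i 0 * \sum_j (complex_mx Y) i j * f x j 0).
  by apply/funext => x; rewrite /bY dotE; apply: eq_bigr => i _; rewrite mxE.
apply: ccont_sum => i; apply: ccontM; first exact: cfi.
by apply: ccont_sum => j; apply: ccontZ; exact: cfi.
Qed.

Lemma mulmx_continuous (A : 'M[C]_n) (T : topologicalType) (f : T -> 'cV[C^o]_n) :
  continuous f -> continuous (fun x => A *m f x : 'cV[C^o]_n).
Proof.
move=> cf; apply: continuous_mx => i j.
have -> : (fun x => (A *m f x) i j) = (fun x => \sum_l A i l * f x l j).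
  by apply/funext => x; rewrite mxE.
apply: (@ccont_sum R T _ _ (fun l x => A i l * f x l j)) => l; apply: ccontZ.
exact: (@continuous_comp_fun T 'cV[C^o]_n C^o f (fun M => M l j) cf (@continuous_coord C^o n 1 l j)).
Qed.

Lemma scale_continuous (c : C) (T : topologicalType) (f : T -> 'cV[C^o]_n) :
  continuous f -> continuous (fun x => c *: f x : 'cV[C^o]_n).
Proof.
move=> cf; apply: continuous_mx => i j.
have -> : (fun x => (c *: f x) i j) = (fun x => c * f x i j).
  by apply/funext => x; rewrite mxE.
apply: (@ccontZ R T c (fun x => f x i j)).
exact: (@continuous_comp_fun T 'cV[C^o]_n C^o f (fun M => M i j) cf (@continuous_coord C^o n 1 i j)).
Qed.

Lemma gauss_ccont s : ccont (gauss s : 'cV[C^o]_n -> C).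
Proof.
have cid : continuous (fun w : 'cV[C^o]_n => w) by exact: continuous_id_fun.
apply: ccontM.
  by apply: ccont_cexp; apply: ccontZ; exact: bY_continuous.
apply: (@ccont_compC R 'cV[C^o]_n 'cV[C^o]_n (fun w => (2 * 'i%C) *: (complex_mx Y *m w))).
  by apply: scale_continuous; exact: mulmx_continuous.
by apply: holo_ccont; apply: expser_differentiable; exact: gcoef_summ.
Qed.

Lemma cexp_differentiable z : differentiable (@cexp R : C^o -> C^o) (z : C^o).
Proof.
apply/derivable1_diffP/cvg_ex; exists (cexp z : C^o).
apply/cvgrPdist_le => e e0.
have eE : e = (complex.Re e)%:C by rewrite RRe_real ?gtr0_real.
have re0 : 0 < complex.Re e by rewrite -(ltcR 0) -eE.
set r := complex.Re e in eE re0.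
pose K := 4 * cabs (cexp z) * expR 1 + 1 : R.
have K0 : 0 < K by rewrite ltr_wpDl // !mulr_ge0 ?cabs_ge0 ?expR_ge0.
pose d := Num.min 1 (r / K) : R.
have d0 : 0 < d by rewrite lt_min ltr01 divr_gt0.
have nd : \forall h \near (0 : C^o)^', `|h| < d%:C /\ h != 0.
  near=> h; split; last by near: h; exact: nbhs_dnbhs_neq.
  by near: h; apply: dnbhs0_lt; rewrite (ltcR 0).
apply: filterS nd => h [hd h0].
have h1 : cabs h < d by rewrite -ltcR cabsE.
have hn : 0 < cabs h by rewrite -(ltcR 0) cabsE normr_gt0.
rewrite -cabsE eE lecR.
have -> : cexp z - h^-1 *: (((@cexp R : C^o -> C^o) \o shift (z : C^o)) (h *: (1 : C^o)) - cexp z) =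
   - (h^-1 * (cexp z * (cexp h - 1 - h))).
  rewrite /= /GRing.scale /= mulr1 cexpD; move: (cexp z) (cexp h) => a b.
  by field.
rewrite cabsN !cabsM cabsV ler_pdivrMl // .
have := cexp_bound2 h => hb.
have he : expR (cabs h) <= expR 1.
  by rewrite ler_expR (le_trans (ltW h1)) // /d ge_min lexx.
apply: (@le_trans _ _ (cabs (cexp z) * (4 * (cabs h ^+ 2 * expR 1)))).
  rewrite ler_wpM2l ?cabs_ge0 // (le_trans hb) // ler_pM2l //.
  by rewrite ler_wpM2l ?exprn_ge0 ?cabs_ge0.
have -> : cabs (cexp z) * (4 * (cabs h ^+ 2 * expR 1)) = cabs h * (cabs h * (4 * cabs (cexp z) * expR 1)).
  by ring.
rewrite ler_pM2l //; apply: (@le_trans _ _ (r / K * K)); last by rewrite divfK // gt_eqF.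
apply: ler_pM; rewrite ?cabs_ge0 ?mulr_ge0 ?cabs_ge0 ?expR_ge0 //.
  by rewrite (le_trans (ltW h1)) // /d ge_min lexx orbT.
by rewrite /K lerDl.
Unshelve. all: by end_near.
Qed.

Lemma gauss_sepdiff s : sepdiff (gauss s).
Proof.
move=> w i; apply: cdiff_derivable; set v := delta_mx i 0.
pose q (h : C) : C := - (2 * pi%:C * k%:R) * bY (w + h *: v) (w + h *: v).
have E : (fun h : C => gauss s (w + h *: v)) =
   (fun h => cexp (q h) * expser (gcoef s) ((2 * 'i%C) *: (complex_mx Y *m w) +
      h *: ((2 * 'i%C) *: (complex_mx Y *m v)))).
  apply/funext => h; rewrite /gauss /q; congr (_ * expser _ _).
  by rewrite mulmxDr -scalemxAr scalerDr !scalerA [h * _]mulrC.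
rewrite E; apply: (@derivableM C C^o (fun h => cexp (q h)) _); last first.
  by apply: differentiable_line; apply: expser_differentiable; exact: gcoef_summ.
apply/derivable1_diffP.
apply: (@differentiable_comp C C^o C^o C^o q (@cexp R)); last exact: cexp_differentiable.
apply/derivable1_diffP.
pose c := - (2 * pi%:C * k%:R) : C.
have -> : (q : C^o -> C^o) = cst (c * bY w w : C^o) + cst (c * (2 * bY w v) : C^o) * id +
    cst (c * bY v v : C^o) * (id * id).
  apply/funext => h; rewrite !fctE /q -/c !bYDl !bYDr !bYZl !bYZr (bYC v w) /=.
  by move: (bY w w) (bY w v) (bY v v) => x1 x2 x3; ring.
apply: derivableD; first apply: derivableD.
- exact: derivable_cst.
- by apply: derivableM; [exact: derivable_cst|exact: derivable_id].
- apply: derivableM; first exact: derivable_cst.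
  by apply: derivableM; exact: derivable_id.
Qed.

(** The common squared norm of the theta functions. Its value, a Gaussian integral,
    cancels in the end. *)
Definition nrm : C := torus_int (fun y : 'cV[R]_n => gauss 0 (complex_mx y)).

(** All the Gaussian integrals are one constant: gauss s is a translate of gauss 0, and
    the contour shift moves the argument back to the real points. *)
Lemma gauss_integral s (w : 'cV[C]_n) :
  torus_int (fun y : 'cV[R]_n => gauss s (complex_mx y + w)) = nrm.
Proof.
have E : gauss s = (fun w => gauss 0 (w + k%:R^-1 *: ic s)).
  by apply/funext => x; rewrite gauss_translate add0r.
rewrite (contour_shift w (@gauss_ccont s) (@gauss_per s) (@gauss_sepdiff s)) E.
exact: (contour_shift _ (@gauss_ccont 0) (@gauss_per 0) (@gauss_sepdiff 0)).
Qed.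

(** On real points the series has nonnegative terms, and the term m = 0 is bounded below
    on the cube. *)
Lemma nrm_gt0 : exists2 N : R, 0 < N & nrm = N%:C.
Proof.
pose g (y : 'cV[R]_n) m : R := if cong k 0 m then
   expR (- (2 * pi * k%:R * dot y (Y *m y)) - 2 * pi / k%:R * dot (ir m) (Y *m ir m)
        - 4 * pi * dot (ir m) (Y *m y)) else 0.
have ge y m : gterm 0 (complex_mx y) m = (g y m)%:C.
  rewrite /g; case: ifPn => sm; last by rewrite gterm0.
  rewrite gtermE // -complex_ir !bY_real -cexp_real; congr cexp.
  rewrite !(rmorphB (real_complex R)) !(rmorphN (real_complex R)) !(rmorphM (real_complex R)).
  by rewrite (fmorphV (real_complex R)) !(rmorph_nat (real_complex R)) mulNr.
have g0 y m : 0 <= g y m by rewrite /g; case: ifP => // _; exact: expR_ge0.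
have h y := has_sum_real_ge 0 (has_sum_gauss 0 (complex_mx y)) (ge y) (g0 y).
pose S := \sum_i \sum_j `|Y i j|.
have lower (y : 'cV[R]_n) : (forall i, 0 <= y i 0 <= 1) ->
    expR (- (2 * pi * k%:R * S)) <= complex.Re (gauss 0 (complex_mx y)).
  move=> hy; apply: le_trans (h y).2; rewrite /g cong_refl.
  have -> : ir 0 = 0 by apply/colP => i; rewrite !mxE.
  have d0 (u : 'cV[R]_n) : dot 0 u = 0 by rewrite /dot trmx0 mul0mx mxE.
  rewrite !d0 !mulr0 !subr0 ler_expR lerN2 ler_wpM2l ?mulr_ge0 ?pi_ge0 //.
  rewrite dotE /S; apply: ler_sum => i _; rewrite mxE mulr_sumr; apply: ler_sum => j _.
  have /andP[yi0 yi1] := hy i; have /andP[yj0 yj1] := hy j.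
  rewrite (le_trans (ler_norm _)) // !normrM (ger0_norm yi0) (ger0_norm yj0).
  by rewrite mulrCA ler_piMr // mulr_ile1.
exists (complex.Re nrm); last first.
  apply: complex_eq => //=; rewrite /nrm Im_torus_int.
  by under [X in cube_int X]funext do rewrite (h _).1; exact: cube_int_cst.
rewrite /nrm Re_torus_int.
apply: (@lt_le_trans _ _ (expR (- (2 * pi * k%:R * S)))); first exact: expR_gt0.
rewrite -(cube_int_cst n (expR _)); apply: cube_int_le => //.
  exact: continuous_cst_fun.
have : ccont (fun y : 'cV[R]_n => gauss 0 (complex_mx y)).
  apply: (@ccont_compC R 'cV[R]_n 'cV[C^o]_n (fun y => complex_mx y)); last exact: gauss_ccont.
  by apply: continuous_complex_mx; exact: continuous_id_fun.
by move=> /ccontP [].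
Qed.

End GaussianSeries.

(** * Matrix elements of Fourier modes *)

Section MatrixElements.
Variables (R : realType) (n : nat) (Z : 'M[R[i]]_n).
Hypothesis hZ : siegel Z.
Variable k : nat.
Hypothesis k0 : (0 < k)%N.
Local Notation C := R[i].
Local Notation X := (re_mx Z).
Local Notation Y := (im_mx Z).
Local Notation ir b := (map_mx intr b : 'cV[R]_n).
Local Notation ic b := (map_mx intr b : 'cV[C]_n).

Lemma zcoord_continuous (T : topologicalType) (f : T -> 'cV[R]_(n + n)) :
  continuous f -> continuous (fun x => zcoord Z (f x) : 'cV[C^o]_n).
Proof.
move=> cf; have fi (i : 'I_(n + n)) : ccont (fun x => (f x i 0)%:C).
  by apply: ccont_real; exact: (continuous_comp_fun _ _ cf (@continuous_coord R (n + n) 1 i 0)).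
apply: continuous_mx => i j; rewrite ord1.
have -> : (fun x => zcoord Z (f x) i 0) = (fun x => (f x (lshift n i) 0)%:C +
    \sum_l Z i l * (f x (rshift n l) 0)%:C).
  apply/funext => x; rewrite /zcoord !mxE; congr (_ + _).
  by apply: eq_bigr => l _; rewrite !mxE.
apply: (@ccontD R T (fun x => (f x (lshift n i) 0)%:C)); first exact: fi.
by apply: ccont_sum => l; apply: ccontZ; exact: fi.
Qed.

Lemma zcoord_col_mx (x y : 'cV[R]_n) :
  zcoord Z (col_mx x y) = complex_mx x + Z *m complex_mx y.
Proof. by rewrite /zcoord col_mxKu col_mxKd. Qed.

Lemma th_ccont s : ccont (th Z k s).
Proof.
apply: (@ccont_compC R _ 'cV[C^o]_n (fun v => zcoord Z v) (theta Z k s)).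
  by apply: zcoord_continuous; exact: continuous_id_fun.
by apply: holo_ccont; exact: theta_differentiable.
Qed.

Lemma fourier_mode_chi (rs : 'cV[int]_n * 'cV[int]_n) (v : 'cV[R]_(n + n)) :
  fourier_mode rs v = chi (col_mx rs.1 rs.2) v.
Proof.
rewrite /fourier_mode /chi; congr (cexp (_ * (_ * _)%:C)).
rewrite [RHS]dotE big_split_ord dotE dotC dotE /=; congr (_ + _); apply: eq_bigr => i _.
  by rewrite map_col_mx col_mxEu [usubmx v i 0]mxE mulrC.
by rewrite map_col_mx col_mxEd [dsubmx v i 0]mxE mulrC.
Qed.

Lemma chi_col_mx (r s : 'cV[int]_n) (x y : 'cV[R]_n) :
  chi (col_mx r s) (col_mx x y) = chi r x * chi s y.
Proof.
rewrite /chi -cexpD -mulrDr -rmorphD -mulrDr; congr (cexp (_ * (_ * _)%:C)).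
rewrite !dotE big_split_ord /=; congr (_ + _); apply: eq_bigr => i _.
  by rewrite map_col_mx !col_mxEu.
by rewrite map_col_mx !col_mxEd.
Qed.

Lemma weight_ccont : ccont (fun v : 'cV[R]_(n + n) => ((hermitian_weight Z v) ^+ k)%:C).
Proof.
have -> : (fun v : 'cV[R]_(n + n) => ((hermitian_weight Z v) ^+ k)%:C) =
   (fun v => cexp (- (2 * pi)%:C * bY Z (complex_mx (dsubmx v)) (complex_mx (dsubmx v))) ^+ k).
  apply/funext => v; rewrite (rmorphXn (real_complex R)) /hermitian_weight /= -cexp_real.
  rewrite bY_real; congr (cexp _ ^+ _).
  by rewrite (rmorphN (real_complex R)) (rmorphM (real_complex R)) mulNr.
apply: ccontX; apply: ccont_cexp; apply: ccontZ; apply: bY_continuous.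
apply: continuous_complex_mx; apply: continuous_mx => i j.
have -> : (fun v : 'cV[R]_(n + n) => dsubmx v i j) = (fun v => v (rshift n i) j).
  by apply/funext => v; rewrite mxE.
exact: continuous_coord.
Qed.

Definition phase (rs : 'cV[int]_n * 'cV[int]_n) (s : 'cV[int]_n) : C :=
  cexp (- (pi / k%:R * (dot (ir rs.2) (ir rs.1) + 2 * dot (ir rs.2) (ir s)))%:C * 'i%C).

(** The translation that completes the square when a theta function times a mode is paired
    with another theta function: r / (2 k) - (i / (2 k)) Y^-1 (s - X r), for the mode (r,
    s). *)
Definition shiftvec (rs : 'cV[int]_n * 'cV[int]_n) : 'cV[C]_n :=
  complex_mx ((2 * k%:R)^-1 *: ir rs.1) +
  'i%C *: complex_mx (- (2 * k%:R)^-1 *: (invmx Y *m (ir rs.2 - X *m ir rs.1))).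

Lemma dot_Y_inv (u q : 'cV[R]_n) : dot u (Y *m (invmx Y *m q)) = dot u q.
Proof. by rewrite mulKVmx //; exact: (pos_form_unit hZ.2). Qed.

(** Completing the square. The product of the mode, the Hermitian weight and the terms of
    index m and m + r of the two theta series is a Gaussian term at a translated argument;
    the constant that comes out is the factor eta, times a phase. *)
Lemma term_identity (r s m sg : 'cV[int]_n) (y : 'cV[R]_n) : cong k sg m ->
  chi s y * (cexp (- (2 * pi * dot y (Y *m y)))%:C) ^+ k *
  (cexp (texp Z k m) * cexp (tpi R * qZ Z (ir m) y)) *
  (cexp (texp Z k (m + r)) * cexp (tpi R * qZ Z (ir (m + r)) y))^*%C =
  (Defs.eta Z (r, s) k)%:C * phase (r, s) sg * gterm Z k sg (complex_mx y + shiftvec (r, s)) m.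
Proof.
move=> sm; rewrite gtermE //.
have -> : phase (r, s) sg = phase (r, s) m.
  case/congP: (sm) => b ->; rewrite /phase irD ir_scale dotDr dotZr /=.
  set a := dot (ir s) (ir r); set c := dot (ir s) (ir sg).
  have -> : dot (ir s) (ir b) = (dot s b)%:~R by rewrite dot_intr.
  have kn := k_neq0 R k0.
  have -> : pi / k%:R * (a + 2 * (c + k%:R * (dot s b)%:~R)) =
    pi / k%:R * (a + 2 * c) + 2 * pi * (dot s b)%:~R.
    by move: (dot s b)%:~R => d; field.
  have cD (u v : R) : cexp (- (u + v)%:C * 'i%C) = cexp (- u%:C * 'i%C) * cexp (- v%:C * 'i%C) :> C.
    by rewrite (rmorphD (real_complex R)) opprD mulrDl cexpD.
  rewrite cD.
  have -> : cexp (- (2 * pi * (dot s b)%:~R)%:C * 'i%C) = 1 :> C.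
    rewrite -[RHS](cexp_periodic R (- dot s b)); congr cexp.
    rewrite !(rmorphM (real_complex R)) (rmorph_int (real_complex R)) (rmorph_nat (real_complex R)).
    by rewrite mulrNz; ring.
  by rewrite mulr1.
rewrite /Defs.eta -cexp_real cexpX conjc_mul !cexpJ /chi /phase -!cexpD; congr cexp.
rewrite /texp /qZ /eta_exponent /= /shiftvec /=.
set p := invmx Y *m (ir s - X *m ir r).
have tE : tpi R = (2 * pi)%:C * 'i%C.
  by rewrite /tpi (rmorphM (real_complex R)) (rmorph_nat (real_complex R)).
have kE : k%:R = (k%:R : R)%:C by rewrite (rmorph_nat (real_complex R)).
have e1 : 2 * pi%:C * k%:R = (2 * pi * k%:R)%:C :> C.
  by rewrite kE !(rmorphM (real_complex R)) !(rmorph_nat (real_complex R)).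
have e2 : 2 * pi%:C / k%:R = (2 * pi / k%:R)%:C :> C.
  by rewrite kE !(rmorphM (real_complex R)) (fmorphV (real_complex R)) !(rmorph_nat (real_complex R)).
have e3 : 4 * pi%:C = (4 * pi)%:C :> C.
  by rewrite !(rmorphM (real_complex R)) !(rmorph_nat (real_complex R)).
rewrite e1 e2 e3 tE kE (addrA (complex_mx y)).
set w1 : 'cV[R]_n := y + (2 * k%:R)^-1 *: ir r.
set w2 : 'cV[R]_n := - (2 * k%:R)^-1 *: p.
have -> : complex_mx y + complex_mx ((2 * k%:R)^-1 *: ir r) = complex_mx w1.
  by apply/colP => i; rewrite !mxE rmorphD.
rewrite !bYDl // !bYDr !bYZl !bYZr // -complex_ir !bY_real.
rewrite (dot_symm (Ysym hZ) w2 w1) /w1 /w2.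
rewrite irD !dotDl !mulmxDr !dotDr -!scalemxAr !dotZl !dotZr !dot_Y_inv.
rewrite (dot_symm (Ysym hZ) (ir r) y) (dot_symm (Ysym hZ) (ir r) (ir m)).
rewrite (dot_symm (Xsym hZ) (ir r) (ir m)).
have dNr (u v : 'cV[R]_n) : dot u (- v) = - dot u v.
  by rewrite -scaleN1r dotZr mulN1r.
have dNl (u v : 'cV[R]_n) : dot (- u) v = - dot u v.
  by rewrite dotC dNr dotC.
rewrite !dotDr !dNr dNl (dotC p (ir s)) (dotC p (X *m _)) (dotC y (ir s)).
rewrite (dotC (ir r) (ir s)) (dotC (ir m) (ir s)) (dot_symm (Xsym hZ) y (ir r)).
have kn := k_neq0 R k0; move: kn.
move: (dot (ir s) y) (dot (ir s) (ir m)) (dot (ir s) (ir r)) (dot (ir s) p)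
  (dot (X *m ir r) p) (dot (ir m) (X *m ir m)) (dot (ir m) (Y *m ir m))
  (dot (ir m) (X *m ir r)) (dot (ir m) (Y *m ir r)) (dot (ir r) (X *m ir r))
  (dot (ir r) (Y *m ir r)) (dot (ir m) (X *m y)) (dot (ir m) (Y *m y))
  (dot (ir r) (X *m y)) (dot y (Y *m ir r)) (dot y (Y *m y)) (k%:R : R) pi => *.
(* Both parts are now rational identities in the values of the real forms. *)
by apply: complex_eq => /=; field.
Qed.

Lemma theta_slice_ccont s (w : 'cV[C]_n) : ccont (fun x : 'cV[R]_n => theta Z k s (complex_mx x + w)).
Proof.
apply: (@ccont_compC R _ 'cV[C^o]_n (fun x => complex_mx x + w) (theta Z k s)).
  apply: continuous_mx_translate; apply: continuous_complex_mx.
  exact: continuous_id_fun.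
by apply: holo_ccont; exact: theta_differentiable.
Qed.

Lemma theta_slice_fcoef t (w : 'cV[C]_n) (m : 'cV[int]_n) :
  torus_int (fun x : 'cV[R]_n => chi m x * (theta Z k t (complex_mx x + w))^*%C) =
  (expterm (tcoef Z k t) m w)^*%C.
Proof.
have sM := @tcoef_summ R n Z hZ k k0 t.
rewrite -(fcoef_has_sum (summ_expterm sM w) (expser_fourier sM w) m) /fcoef.
have c : ccont (fun x : 'cV[R]_n => expser (tcoef Z k t) (complex_mx x + w) * chi (- m) x).
  by apply: ccontM; [exact: theta_slice_ccont|exact: ccont_chi].
rewrite -(torus_int_conj c); congr torus_int; apply/funext => x.
by rewrite conjc_mul chiJ opprK mulrC.
Qed.

(** For fixed y, integrating over x pairs the term m of the first series with the term m +
    r of the second. *)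
Lemma theta_product_slice r s t (w : 'cV[C]_n) :
  has_sum (fun m => expterm (tcoef Z k s) m w * (expterm (tcoef Z k t) (m + r) w)^*%C)
   (torus_int (fun x : 'cV[R]_n => chi r x * theta Z k s (complex_mx x + w) *
     (theta Z k t (complex_mx x + w))^*%C)).
Proof.
have sM := @tcoef_summ R n Z hZ k k0 s.
have sM' := @tcoef_summ R n Z hZ k k0 t.
have cw : ccont (fun x : 'cV[R]_n => chi r x * (theta Z k t (complex_mx x + w))^*%C).
  by apply: ccontM; [exact: ccont_chi|apply: ccontJ; exact: theta_slice_ccont].
have [B hB] : exists B : R, forall x : 'cV[R]_n,
    cabs (chi r x * (theta Z k t (complex_mx x + w))^*%C) <= B.
  have sE := summ_expterm sM' w.
  have [B hB] := sE; exists B => x; rewrite cabsM cabs_chi mul1r cabsJ.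
  apply: (has_sum_bound hB _ (expser_fourier sM' w x)).
  by move=> m; rewrite cabsM cabs_chi mulr1.
have H := torus_int_expand (@ccont_chi R n) (fun m v => eq_leE (cabs_chi m v))
  (summ_expterm sM w) (expser_fourier sM w) cw hB.
have e1 : (fun x : 'cV[R]_n => chi r x * theta Z k s (complex_mx x + w) *
     (theta Z k t (complex_mx x + w))^*%C) =
  (fun v => expser (tcoef Z k s) (complex_mx v + w) * (chi r v * (theta Z k t (complex_mx v + w))^*%C)).
  apply/funext => x; rewrite [chi r x * _]mulrC -mulrA; reflexivity.
have e2 : (fun m => expterm (tcoef Z k s) m w * (expterm (tcoef Z k t) (m + r) w)^*%C) =
  (fun m => expterm (tcoef Z k s) m w *
      torus_int (fun v => chi m v * (chi r v * (theta Z k t (complex_mx v + w))^*%C))).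
  apply/funext => m; rewrite -theta_slice_fcoef; congr (_ * torus_int _).
  by apply/funext => x; rewrite chiD mulrA.
by rewrite e1 e2.
Qed.

Lemma theta_product_slice_gauss r s t sg (y : 'cV[R]_n) :
  chi s y * (cexp (- (2 * pi * dot y (Y *m y)))%:C) ^+ k *
  torus_int (fun x : 'cV[R]_n => chi r x * theta Z k sg (complex_mx x + Z *m complex_mx y) *
     (theta Z k t (complex_mx x + Z *m complex_mx y))^*%C) =
  if cong k (sg + r) t then (Defs.eta Z (r, s) k)%:C * phase (r, s) sg *
    gauss Z k sg (complex_mx y + shiftvec (r, s)) else 0.
Proof.
set W := chi s y * _; set w := Z *m complex_mx y.
have H := has_sumZ W (theta_product_slice r sg t w).
apply: has_sum_uniq H _.
have G := has_sumZ ((Defs.eta Z (r, s) k)%:C * phase (r, s) sg)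
   (has_sum_gauss hZ k0 sg (complex_mx y + shiftvec (r, s))).
have step m : cong k sg m -> cong k (sg + r) (m + r) by rewrite congD.
case: ifP => st.
  have -> // : (fun m => W * (expterm (tcoef Z k sg) m w * (expterm (tcoef Z k t) (m + r) w)^*%C)) =
    (fun m => (Defs.eta Z (r, s) k)%:C * phase (r, s) sg *
       gterm Z k sg (complex_mx y + shiftvec (r, s)) m).
  apply/funext => m; have [sm|sm] := boolP (cong k sg m); last first.
    by rewrite (gterm0 _ _ sm) /expterm {1}/tcoef (negPf sm) !mul0r !mulr0.
  have tm : cong k t (m + r) by rewrite (cong_eq _ (step m sm)).
  by rewrite -term_identity // mulrA /expterm /tcoef sm tm !bdot_qZ.
have -> : (fun m => W * (expterm (tcoef Z k sg) m w * (expterm (tcoef Z k t) (m + r) w)^*%C)) =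
    (fun=> 0).
  apply/funext => m; have [sm|sm] := boolP (cong k sg m); last first.
    by rewrite /expterm {1}/tcoef (negPf sm) !mul0r !mulr0.
  have tm : cong k t (m + r) = false by rewrite (cong_eq _ (step m sm)).
  have c0 : (0 : C)^*%C = 0 by apply: complex_eq => //=; rewrite oppr0.
  by rewrite [expterm _ (m + r) w]/expterm /tcoef tm mul0r c0 !mulr0.
have := @has_sum_supp R 'cV[int]_n fset0 (fun=> 0) (fun _ _ => erefl).
by rewrite big_seq_fset0.
Qed.

(** Integrate over x first, where orthogonality of the characters leaves one sum over m;
    the sum is a Gaussian series in y whose complex argument does not affect its integral.
    So the only trace of the mode is the factor eta and a phase. *)
Theorem matrix_element (rs : 'cV[int]_n * 'cV[int]_n) s t :
  section_ip Z k (fun v => fourier_mode rs v * th Z k s v) (th Z k t) =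
  if cong k (s + rs.1) t then (Defs.eta Z rs k)%:C * phase rs s * nrm Z k else 0.
Proof.
case: rs => r q /=; rewrite /section_ip torus_int_col_mx.
pose u (x y : 'cV[R]_n) : C := fourier_mode (r, q) (col_mx x y) * th Z k s (col_mx x y) *
  (th Z k t (col_mx x y))^*%C * ((hermitian_weight Z (col_mx x y)) ^+ k)%:C.
have cu : ccont (fun p : 'cV[R]_n * 'cV[R]_n => u p.1 p.2).
  have cg : ccont (fun v : 'cV[R]_(n + n) => fourier_mode (r, q) v * th Z k s v *
      (th Z k t v)^*%C * ((hermitian_weight Z v) ^+ k)%:C).
    apply: ccontM; [apply: ccontM; [apply: ccontM|]|exact: weight_ccont].
    - have -> : fourier_mode (r, q) = chi (col_mx r q) :> ('cV[R]_(n + n) -> C).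
        by apply/funext => v; rewrite fourier_mode_chi.
      exact: ccont_chi.
    - exact: th_ccont.
    - by apply: ccontJ; exact: th_ccont.
  apply: (@ccont_compC R _ _ (fun p : 'cV[R]_n * 'cV[R]_n => col_mx p.1 p.2) _ _ cg).
  by apply: continuous_col_mx; [exact: continuous_fst|exact: continuous_snd].
rewrite -(torus_int_swap cu).
have -> : (fun y : 'cV[R]_n => torus_int (u^~ y)) =
   (fun y => if cong k (s + r) t then (Defs.eta Z (r, q) k)%:C * phase (r, q) s *
    gauss Z k s (complex_mx y + shiftvec (r, q)) else 0).
  apply/funext => y; rewrite -theta_product_slice_gauss.
  set w := Z *m complex_mx y.
  have c : ccont (fun x : 'cV[R]_n => chi r x * theta Z k s (complex_mx x + w) *
     (theta Z k t (complex_mx x + w))^*%C).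
    apply: ccontM; [apply: ccontM; [exact: ccont_chi|exact: theta_slice_ccont]|].
    by apply: ccontJ; exact: theta_slice_ccont.
  rewrite -(torus_intZ _ c); congr torus_int; apply/funext => x.
  rewrite /u fourier_mode_chi chi_col_mx /th zcoord_col_mx -/w.
  rewrite /hermitian_weight col_mxKd (rmorphXn (real_complex R)) /= -cexp_real.
  move: (theta _ _ _ _) (theta _ _ _ _)^*%C (chi r x) (chi q y) (cexp _ ^+ _) => *; ring.
case: ifP => _; last exact: torus_int_cst.
rewrite torus_intZ; first by rewrite gauss_integral.
apply: (@ccont_compC R _ 'cV[C^o]_n (fun y => complex_mx y + shiftvec (r, q)) (gauss Z k s)).
  apply: continuous_mx_translate; apply: continuous_complex_mx.
  exact: continuous_id_fun.
exact: gauss_ccont.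
Qed.

End MatrixElements.

(** * Theta functions span the sections *)

Section Wave.
Variables (R : realType) (n : nat).
Local Notation C := R[i].

Definition wave (m : 'cV[int]_n) (z : 'cV[C]_n) : C := cexp (tpi R * bdot m z).

(** A single exponential is an exponential series with one term, and inherits its
    properties. *)
Lemma wave_expser m : wave m = expser (fun b => (b == m)%:R).
Proof.
apply/funext => z; rewrite /expser.
have -> : (fun b => expterm (fun b => (b == m)%:R) b z) = (fun b => if b == m then wave m z else 0).
  by apply/funext => b; rewrite /expterm /wave; case: eqP => [->|_]; rewrite ?mul1r ?mul0r.
set f := fun b => _.
have H : has_sum f (\sum_(b <- [fset m]%fset) f b).
  by apply: has_sum_supp => b; rewrite inE /f => /negPf ->.
rewrite big_seq_fset1 {2}/f eqxx in H.
by rewrite (has_sum_tsum H).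
Qed.

Lemma wave_differentiable m z : differentiableC (wave m) z.
Proof.
rewrite wave_expser; apply: expser_differentiable => M M0.
exists (expR (M * l1 R m)) => A.
have -> : \sum_(b <- A) cabs ((b == m)%:R : C) * expR (M * l1 R b) =
   \sum_(b <- A | b == m) expR (M * l1 R m).
  rewrite [RHS]big_mkcond; apply: eq_bigr => b _.
  by case: eqP => [->|_]; rewrite ?cabs_nat ?mul1r ?mul0r.
rewrite big_const_seq iter_addr_0 -/(count_mem m A) count_uniq_mem ?fset_uniq //.
by case: (m \in A); rewrite ?mulr1n ?mulr0n ?expR_ge0.
Qed.

Lemma differentiableCM (f g : 'cV[C]_n -> C) z : differentiableC f z -> differentiableC g z ->
  differentiableC (fun z => f z * g z) z.
Proof. exact: differentiableM. Qed.

Lemma differentiableCB (f g : 'cV[C]_n -> C) z : differentiableC f z -> differentiableC g z ->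
  differentiableC (fun z => f z - g z) z.
Proof. exact: differentiableB. Qed.

Lemma differentiableC_sum (I : finType) (a : I -> C) (f : I -> 'cV[C]_n -> C) z :
  (forall i, differentiableC (f i) z) -> differentiableC (fun z => \sum_i a i * f i z) z.
Proof.
move=> df; elim: (index_enum I) => [|i r IH].
  by under [X in differentiableC X]funext do rewrite big_nil; exact: differentiable_cst.
under [X in differentiableC X]funext do rewrite big_cons.
apply: differentiableD; last exact: IH.
by apply: differentiableCM; [exact: differentiable_cst|exact: df].
Qed.

End Wave.

Section Completeness.
Variables (R : realType) (n : nat) (Z : 'M[R[i]]_n).
Hypothesis hZ : siegel Z.
Variable k : nat.
Hypothesis k0 : (0 < k)%N.
Local Notation C := R[i].
Local Notation X := (re_mx Z).
Local Notation Y := (im_mx Z).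
Local Notation ir b := (map_mx intr b : 'cV[R]_n).
Local Notation ic b := (map_mx intr b : 'cV[C]_n).

(** The imaginary part of Z is invertible, so y is determined by the imaginary part of z,
    then x by its real part. *)
Lemma zcoord_surj z : exists v : 'cV[R]_(n + n), zcoord Z v = z.
Proof.
have Yu := pos_form_unit hZ.2.
pose y := invmx Y *m im_mx z.
exists (col_mx (re_mx z - X *m y) y); rewrite zcoord_col_mx.
have Yy : Y *m y = im_mx z by rewrite /y mulKVmx.
have Xy : re_mx z = (re_mx z - X *m y) + X *m y by rewrite subrK.
apply/colP => i; rewrite [LHS]mxE [complex_mx _ i 0]mxE [(Z *m _) i 0]mxE.
have -> : \sum_j Z i j * complex_mx y j 0 = (X *m y) i 0 +i* (Y *m y) i 0.
  apply: complex_eq; rewrite ?Re_sum ?Im_sum /= mxE; apply: eq_bigr => j _;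
  rewrite !mxE; case: (Z i j) => a b /=; ring.
rewrite Yy; apply: complex_eq => /=; last by rewrite add0r mxE.
by rewrite mxE [(- (X *m y)) i 0]mxE subrK mxE.
Qed.

(** The transformation law of the sections of the k-th power, for functions of z. *)
Definition quasiper (phi : 'cV[C]_n -> C) := forall (l : 'cV[int]_(n + n)) z,
  phi (z + (map_mx intr (usubmx l) + Z *m map_mx intr (dsubmx l))) =
  multiplier Z l z ^+ k * phi z.

Lemma H0_quasiper (phi : 'cV[C]_n -> C) :
  H0 Z k (fun v => phi (zcoord Z v)) -> quasiper phi.
Proof.
by move=> [_ h] l z; have [v <-] := zcoord_surj z; rewrite -zcoordD h.
Qed.

Lemma quasiper_H0 (phi : 'cV[C]_n -> C) : (forall z, differentiableC phi z) ->
  quasiper phi -> H0 Z k (fun v => phi (zcoord Z v)).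
Proof. by move=> d q; split; [exists phi|move=> l v; rewrite zcoordD q]. Qed.

Section Coefficients.
Variable phi : 'cV[C]_n -> C.
Hypothesis dphi : forall z, differentiableC phi z.
Hypothesis qphi : quasiper phi.

Lemma quasiper_per : zper phi.
Proof.
move=> a z; have := qphi (col_mx a 0) z; rewrite col_mxKu col_mxKd multiplierE col_mxKd.
have -> : ic (0 : 'cV[int]_n) = 0 by apply/colP => i; rewrite !mxE.
have -> : ir (0 : 'cV[int]_n) = 0 by apply/colP => i; rewrite !mxE.
rewrite mulmx0 addr0 => ->.
have -> : bdot (0 : 'cV[int]_n) z = 0.
  by rewrite /bdot dotE big1 // => i _; rewrite !mxE mul0r.
have -> : qZ Z (0 : 'cV[R]_n) 0 = 0.
  by rewrite /qZ !mulmx0 /dot !mulmx0 !mxE.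
by rewrite !mulr0 oppr0 addr0 cexp0 expr1n mul1r.
Qed.

(** Fourier coefficients of the restriction to the real points. *)
Definition hcoef m : C := torus_int (fun x : 'cV[R]_n => phi (complex_mx x) * chi (- m) x).

Lemma slice_ccont (w : 'cV[C]_n) : ccont (fun x : 'cV[R]_n => phi (complex_mx x + w)).
Proof.
apply: (@ccont_compC R _ 'cV[C^o]_n (fun x => complex_mx x + w) phi).
  apply: continuous_mx_translate; apply: continuous_complex_mx.
  exact: continuous_id_fun.
exact: holo_ccont.
Qed.

(** The function phi z * wave (- m) z is holomorphic and periodic, so its integral over a
    real slice does not depend on the slice. *)
Lemma hcoef_translate m w :
  torus_int (fun x : 'cV[R]_n => phi (complex_mx x + w) * chi (- m) x) = hcoef m * wave m w.
Proof.
pose G z := phi z * wave (- m) z.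
have dG z : differentiableC G z.
  by apply: differentiableCM; [exact: dphi|exact: wave_differentiable].
have pG : zper G.
  by move=> l z; rewrite /G quasiper_per wave_expser (expser_per _ l).
have wD (b : 'cV[int]_n) (z z' : 'cV[C]_n) : wave b (z + z') = wave b z * wave b z'.
  by rewrite /wave bdotD mulrDr cexpD.
have wN (z : 'cV[C]_n) : wave (- m) z * wave m z = 1.
  rewrite /wave -cexpD -mulrDr -bdotDl addNr.
  have -> : bdot (0 : 'cV[int]_n) z = 0.
    by rewrite /bdot dotE big1 // => i _; rewrite !mxE mul0r.
  by rewrite mulr0 cexp0.
have wr b (x : 'cV[R]_n) : wave b (complex_mx x) = chi b x by exact: cexp_bdot_real.
have e : torus_int (fun x : 'cV[R]_n => G (complex_mx x)) = hcoef m.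
  by congr torus_int; apply/funext => x; rewrite /G wr.
have := etrans (contour_shift w (holo_ccont dG) pG (holo_sepdiff dG)) e => <-.
have -> : (fun x : 'cV[R]_n => phi (complex_mx x + w) * chi (- m) x) =
   (fun x => wave m w * G (complex_mx x + w)).
  apply/funext => x; rewrite /G wD wr.
  rewrite -[LHS]mulr1 -(wN w).
  move: (phi _) (chi _ _) (wave (- m) w) (wave m w) => a b c d; ring.
rewrite torus_intZ; first by rewrite mulrC.
apply: (@ccont_compC R _ 'cV[C^o]_n (fun x => complex_mx x + w) G).
  apply: continuous_mx_translate; apply: continuous_complex_mx.
  exact: continuous_id_fun.
exact: holo_ccont.
Qed.

(** Evaluate the slice through Z b twice: by the transformation law and by the contour
    shift. The coefficients at m and at m + k b differ by a nonzero factor. *)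
Lemma hcoef_shift m b : hcoef m = 0 -> hcoef (m + k%:Z *: b) = 0.
Proof.
move=> m0; have := hcoef_translate m (Z *m ic b); rewrite m0 mul0r.
pose K : C := cexp (- (pi%:C * 'i%C * qZ Z (ir b) (ir b))) ^+ k.
have -> : (fun x : 'cV[R]_n => phi (complex_mx x + Z *m ic b) * chi (- m) x) =
   (fun x => K * (phi (complex_mx x) * chi (- (m + k%:Z *: b)) x)).
  apply/funext => x; have := qphi (col_mx 0 b) (complex_mx x).
  rewrite col_mxKu col_mxKd multiplierE col_mxKd.
  have -> : ic (0 : 'cV[int]_n) = 0 by apply/colP => i; rewrite !mxE.
  rewrite add0r => ->.
  rewrite cexpD exprMn -/K opprD chiD.
  have -> : cexp (- (tpi R * bdot b (complex_mx x))) ^+ k = chi (- (k%:Z *: b)) x.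
    rewrite -cexp_bdot_real cexpX; congr cexp.
    have -> : - (k%:Z *: b) = k%:Z *: (- b) by rewrite scalerN.
    rewrite bdotZl (_ : bdot (- b) _ = - bdot b (complex_mx x)).
      by rewrite !mulrN mulrCA.
    rewrite /bdot !dotE -sumrN; apply: eq_bigr => i _.
    by rewrite !mxE rmorphN mulNr.
  move: (phi _) (chi _ _) (chi _ _) K => *; ring.
have c : ccont (fun x : 'cV[R]_n => phi (complex_mx x) * chi (- (m + k%:Z *: b)) x).
  apply: ccontM; last exact: ccont_chi.
  have := @slice_ccont 0; by under [X in ccont X -> _]funext do rewrite addr0.
rewrite (torus_intZ _ c) => /eqP; rewrite mulf_eq0 => /orP[/eqP e|/eqP //].
by exfalso; move: e => /eqP; rewrite expf_eq0 (negPf (cexp_neq0 _)) andbF.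
Qed.

(** On each real slice all Fourier coefficients vanish. *)
Lemma hcoef_vanish : (forall m, hcoef m = 0) -> forall z, phi z = 0.
Proof.
move=> h z.
have p : zper (fun x : 'cV[R]_n => phi (complex_mx x + z)).
  move=> l x; rewrite -(quasiper_per l (complex_mx x + z)).
  have -> // : complex_mx (x + ir l) + z = complex_mx x + z + ic l.
  by rewrite addrAC -complex_ir; congr (_ + _); apply/colP => i; rewrite !mxE rmorphD.
have := fourier_unique (@slice_ccont z) p _ 0.
have -> : complex_mx (0 : 'cV[R]_n) = 0 by apply/colP => i; rewrite !mxE.
rewrite add0r; apply => m; have := hcoef_translate (- m) z; rewrite opprK => ->.
by rewrite h mul0r.
Qed.

End Coefficients.

Definition rep (j : {ffun 'I_n -> 'I_k}) : 'cV[int]_n := \col_i (nat_of_ord (j i))%:Z.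

Lemma cong_rep i j : cong k (rep i) (rep j) = (i == j).
Proof.
apply/forallP/eqP => [h|-> l]; last by rewrite subrr dvdz0.
apply/ffunP => l; apply: val_inj; have := h l; rewrite !mxE -eqz_mod_dvd.
rewrite !modz_nat eqz_nat !modn_small // => /eqP e; exact: (esym e).
Qed.

Lemma exists_rep m : exists j, cong k (rep j) m.
Proof.
have kz : k%:Z != 0 by rewrite eqz_nat -lt0n.
have h i : (`|((m i 0)%R %% k%:Z)%Z| < k)%N.
  by rewrite -ltz_nat gez0_abs ?modz_ge0 // ltz_pmod.
exists [ffun i => Ordinal (h i)]; apply/forallP => i; rewrite !mxE ffunE /=.
by rewrite gez0_abs ?modz_ge0 // -eqz_mod_dvd modz_mod.
Qed.

Lemma hcoef_theta s m : hcoef (theta Z k s) m = tcoef Z k s m.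
Proof.
have sM := @tcoef_summ R n Z hZ k k0 s.
have := fcoef_has_sum (summ_expterm sM 0) (expser_fourier sM 0) m.
have -> : expterm (tcoef Z k s) m 0 = tcoef Z k s m.
  by rewrite /expterm /bdot /dot mulmx0 mxE mulr0 cexp0 mulr1.
move=> <-; rewrite /hcoef /fcoef; apply: congr1; apply/funext => x.
by rewrite /theta [_ + 0]addr0.
Qed.

(** The coefficients of a section vanish as soon as those at one representative of each
    class mod k do, so subtracting a combination of theta functions that matches these
    coefficients leaves zero. *)
Lemma H0_span s : H0 Z k s ->
  exists a : {ffun 'I_n -> 'I_k} -> C, s = fun v => \sum_j a j * th Z k (rep j) v.
Proof.
move=> [[phi dphi sE] qs].
have sf : s = fun v => phi (zcoord Z v) by apply/funext.
have qphi : quasiper phi by apply: H0_quasiper; rewrite -sf; split => //; exists phi.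
pose a j := hcoef phi (rep j) / tcoef Z k (rep j) (rep j).
pose psi z := phi z - \sum_j a j * theta Z k (rep j) z.
have dsum z : differentiableC (fun z => \sum_j a j * theta Z k (rep j) z) z.
  by apply: differentiableC_sum => j; exact: theta_differentiable.
have dpsi z : differentiableC psi z by apply: differentiableCB.
have qpsi : quasiper psi.
  move=> l z; rewrite /psi qphi mulrBr; congr (_ - _).
  rewrite mulr_sumr; apply: eq_bigr => j _.
  by rewrite theta_quasiper // mulrCA.
have cf (f : 'cV[C]_n -> C) m : (forall z, differentiableC f z) ->
    ccont (fun x : 'cV[R]_n => f (complex_mx x) * chi (- m) x).
  move=> df; apply: ccontM; last exact: ccont_chi.
  have := @slice_ccont f df 0.
  by under [X in ccont X -> _]funext do rewrite addr0.
have hpsi m : hcoef psi m = hcoef phi m - \sum_j a j * tcoef Z k (rep j) m.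
  rewrite /hcoef.
  have -> : (fun x : 'cV[R]_n => psi (complex_mx x) * chi (- m) x) =
     (fun x => phi (complex_mx x) * chi (- m) x -
        \sum_j a j * (theta Z k (rep j) (complex_mx x) * chi (- m) x)).
    apply/funext => x; rewrite /psi mulrBl; congr (_ - _).
    by rewrite mulr_suml; apply: eq_bigr => j _; rewrite mulrA.
  have ct j : ccont (fun x : 'cV[R]_n => theta Z k (rep j) (complex_mx x) * chi (- m) x).
    by apply: cf; exact: theta_differentiable.
  have cat j : ccont (fun x : 'cV[R]_n => a j * (theta Z k (rep j) (complex_mx x) * chi (- m) x)).
    by apply: ccontZ; exact: ct.
  rewrite torus_intB; [|exact: cf|by apply: ccont_sum => j; exact: cat].
  congr (_ - _); rewrite torus_int_sum; last exact: cat.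
  by apply: eq_bigr => j _; rewrite torus_intZ -?hcoef_theta //; exact: ct.
have psi0 := hcoef_vanish dpsi qpsi.
exists a; rewrite sf; apply/funext => v; apply/eqP; rewrite -subr_eq0; apply/eqP.
apply: psi0 => m; have [j /congP [b ->]] := exists_rep m.
apply: hcoef_shift => //; rewrite hpsi (bigD1 j) //= big1.
  have tn : tcoef Z k (rep j) (rep j) != 0 by rewrite /tcoef cong_refl cexp_neq0.
  by rewrite addr0 /a mulfVK // subrr.
by move=> i ij; rewrite /tcoef cong_rep (negPf ij) mulr0.
Qed.

End Completeness.

(** * Operators in an orthogonal basis *)

Section BasisAlgebra.
Variables (R : realType) (T : Type).
Local Notation C := R[i].
Variables (H : set (T -> C)) (ip : (T -> C) -> (T -> C) -> C).
Variables (N : nat) (b : 'I_N -> T -> C) (nu : R).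
Hypothesis nu0 : 0 < nu.
Hypothesis spanP : forall s, H s <-> exists c, s = lincomb b c.
Hypothesis ipbb : forall c c' : 'I_N -> C,
  ip (lincomb b c) (lincomb b c') = nu%:C * \sum_i c i * (c' i)^*%C.

Definition coord (i j : 'I_N) : C := (j == i)%:R.

Lemma nu_neq0 : nu%:C != 0 :> C.
Proof. by rewrite (fmorph_eq0 (real_complex R)) gt_eqF. Qed.

Lemma lincomb_coord i : lincomb b (coord i) = b i.
Proof.
apply/funext => v; rewrite /lincomb (bigD1 i) //= big1 => [|j ji].
  by rewrite /coord eqxx mul1r addr0.
by rewrite /coord (negPf ji) mul0r.
Qed.

Lemma ip_coord c i : ip (lincomb b c) (b i) = nu%:C * c i.
Proof.
rewrite -{1}lincomb_coord ipbb (bigD1 i) //= big1 => [|j ji].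
  by rewrite /coord eqxx conjc_nat mulr1 addr0.
by rewrite /coord (negPf ji) conjc_nat mulr0.
Qed.

Lemma lincomb_inj : injective (lincomb b).
Proof.
move=> c c' e; apply/funext => i; apply: (mulfI nu_neq0).
by rewrite -!ip_coord e.
Qed.

Lemma H_lincomb c : H (lincomb b c).
Proof. by apply/spanP; exists c. Qed.

Lemma basis_b : is_basis H b.
Proof.
split=> [i|s /spanP [c ->]]; first by rewrite -lincomb_coord; exact: H_lincomb.
by exists c; split => // c' /lincomb_inj.
Qed.

Definition has_matrix (A : (T -> C) -> T -> C) (M : 'M[C]_N) :=
  forall c, A (lincomb b c) = lincomb b (fun i => \sum_j M i j * c j).

Lemma lincomb_comp N' (b' : 'I_N' -> T -> C) (P : 'M[C]_(N, N')) (c : 'I_N' -> C) :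
  (forall j, b' j = lincomb b (P^~ j)) ->
  lincomb b' c = lincomb b (fun i => \sum_j P i j * c j).
Proof.
move=> Pb; apply/funext => v; rewrite /lincomb.
transitivity (\sum_j \sum_i P i j * c j * b i v).
  apply: eq_bigr => j _; rewrite Pb /lincomb mulr_sumr; apply: eq_bigr => i _; ring.
by rewrite exchange_big; apply: eq_bigr => i _; rewrite mulr_suml.
Qed.

(** The trace does not depend on the basis: if P and Q are the two changes of basis, the
    matrix M' in the other basis is Q M P, and P Q = 1. *)
Lemma op_trace_matrix A M : has_matrix A M -> op_trace H A = \tr M.
Proof.
move=> hA; apply: xget_unique.
  exists N, b, M; split => //; first exact: basis_b.
  move=> j; rewrite -{1}lincomb_coord hA; congr lincomb; apply/funext => i.
  rewrite (bigD1 j) //= big1 => [|l lj]; first by rewrite /coord eqxx mulr1 addr0.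
  by rewrite /coord (negPf lj) mulr0.
move=> t [N' [b' [M' [[Hb' ub'] hA' ->]]]].
have /choice [P hP] : forall j, exists c, b' j = lincomb b c.
  by move=> j; apply/spanP.
have /choice [Q hQ] : forall i, exists c, b i = lincomb b' c.
  by move=> i; have [Hbi _] := basis_b; have [c [hc _]] := ub' _ (Hbi i); exists c.
pose Pm : 'M[C]_(N, N') := \matrix_(i, j) P j i.
pose Qm : 'M[C]_(N', N) := \matrix_(i, j) Q j i.
have hPm j : b' j = lincomb b (Pm^~ j).
  by rewrite hP; congr lincomb; apply/funext => i; rewrite mxE.
have hQm i : b i = lincomb b' (Qm^~ i).
  by rewrite hQ; congr lincomb; apply/funext => j; rewrite mxE.
have PQ : Pm *m Qm = 1%:M.
  apply/matrixP => i l; have := lincomb_comp (Qm^~ l) hPm; rewrite -hQm.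
  rewrite -{1}lincomb_coord => /lincomb_inj /(congr1 (fun f => f i)).
  by rewrite !mxE /coord => <-.
have b'inj : injective (lincomb b').
  move=> c c' e; have Hc : H (lincomb b' c).
    by apply/spanP; exists (fun i => \sum_j Pm i j * c j); exact: lincomb_comp hPm.
  by have [d [_ ud]] := ub' _ Hc; rewrite -(ud c) // -(ud c').
have QP : Qm *m Pm = 1%:M.
  apply/matrixP => j l; have : b' l = lincomb b' (fun i => (Qm *m Pm) i l).
    rewrite (lincomb_comp _ hPm) {1}hPm; congr lincomb; apply/funext => i.
    have -> : \sum_j Pm i j * (Qm *m Pm) j l = (Pm *m (Qm *m Pm)) i l by rewrite [RHS]mxE.
    by rewrite mulmxA PQ mul1mx.
  have -> : b' l = lincomb b' (fun j => (j == l)%:R).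
    apply/funext => v; rewrite /lincomb (bigD1 l) //= big1 => [|i il].
      by rewrite eqxx mul1r addr0.
    by rewrite (negPf il) mul0r.
  by move=> /b'inj /(congr1 (fun f => f j)) <-; rewrite mxE.
have MP : M *m Pm = Pm *m M'.
  apply/matrixP => i l; have := hA' l; rewrite hPm hA (lincomb_comp _ hPm).
  by move=> /lincomb_inj /(congr1 (fun f => f i)); rewrite !mxE.
have -> : M' = Qm *m (M *m Pm) by rewrite MP mulmxA QP mul1mx.
by rewrite mxtrace_mulC -mulmxA PQ mulmx1.
Qed.

(** In an orthogonal basis whose vectors have equal norms, the adjoint is the conjugate
    transpose. *)
Lemma adjoint_matrix B M : has_matrix B M ->
  has_matrix (adjoint H ip B) (\matrix_(i, j) (M j i)^*%C).
Proof.
move=> hB c; set d := fun i => _.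
have dE : forall e, ip (B (lincomb b e)) (lincomb b c) = ip (lincomb b e) (lincomb b d).
  move=> e; rewrite hB !ipbb; congr (_ * _).
  transitivity (\sum_i \sum_j e j * (M i j * (c i)^*%C)).
    apply: eq_bigr => i _; rewrite mulr_suml; apply: eq_bigr => j _; ring.
  rewrite exchange_big; apply: eq_bigr => j _; rewrite -mulr_sumr; congr (_ * _).
  rewrite /d (rmorph_sum (conjc : {rmorphism C -> C})).
  by apply: eq_bigr => i _; rewrite mxE [RHS]conjc_mul conjcK.
apply: xget_unique.
  by split=> [|s /spanP [e ->]]; [exact: H_lincomb|exact: dE].
move=> p [/spanP [d' ->] h]; congr lincomb; apply/funext => i.
have := h _ (H_lincomb (coord i)); rewrite dE !ipbb => /(mulfI nu_neq0).
have cs (f : 'I_N -> C) : \sum_j coord i j * (f j)^*%C = (f i)^*%C.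
  rewrite (bigD1 i) //= big1 => [|j ji]; first by rewrite /coord eqxx mul1r addr0.
  by rewrite /coord (negPf ji) mul0r.
by rewrite !cs => /(congr1 (@conjc R)); rewrite !conjcK.
Qed.

Lemma hilbert_schmidt_matrix A B MA MB : has_matrix A MA -> has_matrix B MB ->
  hilbert_schmidt H ip A B = \sum_i \sum_j MA i j * (MB i j)^*%C.
Proof.
move=> hA hB; have hB' := adjoint_matrix hB.
have hAB : has_matrix (A \o adjoint H ip B) (MA *m \matrix_(i, j) (MB j i)^*%C).
  move=> c; rewrite /= hB' hA; congr lincomb; apply/funext => i.
  transitivity (\sum_j \sum_l MA i j * (MB l j)^*%C * c l).
    by apply: eq_bigr => j _; rewrite mulr_sumr; apply: eq_bigr => l _; rewrite mxE mulrA.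
  rewrite exchange_big; apply: eq_bigr => l _; rewrite -mulr_suml mxE; congr (_ * _).
  by apply: eq_bigr => j _; rewrite mxE.
rewrite /hilbert_schmidt (op_trace_matrix hAB) /mxtrace; apply: eq_bigr => i _.
by rewrite mxE; apply: eq_bigr => j _; rewrite mxE.
Qed.

(** The hypothesis says that d is the vector of the products of u with the basis, divided
    by nu. It is stated for the differences u - p, so that no linearity of the form has to
    be assumed. *)
Lemma orth_proj_lincomb u (d : 'I_N -> C) :
  (forall c c', ip (u \- lincomb b c) (lincomb b c') = nu%:C * \sum_i (d i - c i) * (c' i)^*%C) ->
  orth_proj H ip u = lincomb b d.
Proof.
move=> hu; apply: xget_unique.
  split=> [|t /spanP [c' ->]]; first exact: H_lincomb.
  by rewrite hu big1 ?mulr0 // => i _; rewrite subrr mul0r.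
move=> p [/spanP [c ->] h]; congr lincomb; apply/funext => i.
have := h _ (H_lincomb (coord i)); rewrite hu (bigD1 i) //= big1 => [|j ji].
  rewrite /coord eqxx conjc_nat mulr1 addr0 => /eqP.
  by rewrite mulf_eq0 (negPf nu_neq0) /= subr_eq0 => /eqP.
by rewrite /coord (negPf ji) conjc_nat mulr0.
Qed.

End BasisAlgebra.

(** * The matrix of a Toeplitz operator *)

Lemma has_sum_sum (R : realType) (I : choiceType) (J : Type) (r : seq J)
    (f : J -> I -> R[i]) (l : J -> R[i]) : (forall j, has_sum (f j) (l j)) ->
  has_sum (fun i => \sum_(j <- r) f j i) (\sum_(j <- r) l j).
Proof.
move=> h; elim: r => [|j r IH].
  rewrite big_nil; under [X in has_sum X]funext do rewrite big_nil.
  have := @has_sum_supp R I fset0 (fun _ => 0 : R[i]) (fun _ _ => erefl).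
  by rewrite big_seq_fset0.
rewrite big_cons; under [X in has_sum X]funext do rewrite big_cons.
exact: has_sumD (h j) IH.
Qed.

Lemma totally_is_filter (I : choiceType) : Filter (@totally I).
Proof. by case: (@totally_filter I). Qed.

Lemma mulcJ_cabs (R : realType) (z : R[i]) : z * z^*%C = (cabs z ^+ 2)%:C.
Proof. by rewrite (rmorphXn (real_complex R)) /= cabsE sqr_normc. Qed.

Section ToeplitzMatrix.
Variables (R : realType) (n : nat) (Z : 'M[R[i]]_n).
Hypothesis hZ : siegel Z.
Variable k : nat.
Hypothesis k0 : (0 < k)%N.
Local Notation C := R[i].
Local Notation N := #|{ffun 'I_n -> 'I_k}|.
Local Notation ip := (section_ip Z k).

(** An enumeration of the representatives by an ordinal type, as bases and matrices
    require. *)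
Definition sg (i : 'I_N) : 'cV[int]_n := rep (enum_val i).
Definition bas (i : 'I_N) : 'cV[R]_(n + n) -> C := th Z k (sg i).

Lemma cong_sg i j : cong k (sg i) (sg j) = (i == j).
Proof. by rewrite /sg cong_rep (inj_eq enum_val_inj). Qed.

Lemma exists_sg m : exists i, cong k (sg i) m.
Proof.
by have [j hj] := exists_rep k0 m; exists (enum_rank j); rewrite /sg enum_rankK.
Qed.

Lemma bas_ccont i : ccont (bas i).
Proof. exact: th_ccont. Qed.

Lemma lincomb_ccont c : ccont (lincomb bas c).
Proof. by apply: ccont_sum => i; apply: ccontZ; exact: bas_ccont. Qed.

Lemma section_ccont u t : ccont u -> ccont t ->
  ccont (fun v : 'cV[R]_(n + n) => u v * (t v)^*%C * ((hermitian_weight Z v) ^+ k)%:C).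
Proof.
move=> cu ct; apply: ccontM; last exact: weight_ccont.
by apply: ccontM; [exact: cu|apply: ccontJ; exact: ct].
Qed.

Lemma section_ip_suml (I : finType) (c : I -> C) (w : I -> 'cV[R]_(n + n) -> C) t :
  (forall i, ccont (w i)) -> ccont t ->
  ip (fun v => \sum_i c i * w i v) t = \sum_i c i * ip (w i) t.
Proof.
move=> cw ct; rewrite /section_ip.
have -> : (fun v => (\sum_i c i * w i v) * (t v)^*%C * ((hermitian_weight Z v) ^+ k)%:C) =
   (fun v => \sum_i c i * (w i v * (t v)^*%C * ((hermitian_weight Z v) ^+ k)%:C)).
  by apply/funext => v; rewrite !mulr_suml; apply: eq_bigr => i _; rewrite !mulrA.
have cwt i := section_ccont (cw i) ct.
rewrite torus_int_sum => [|i]; last by apply: ccontZ; exact: cwt.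
by apply: eq_bigr => i _; rewrite (torus_intZ _ (cwt i)).
Qed.

Lemma section_ipB u u' t : ccont u -> ccont u' -> ccont t ->
  ip (u \- u') t = ip u t - ip u' t.
Proof.
move=> cu cu' ct; rewrite /section_ip -(torus_intB (section_ccont cu ct) (section_ccont cu' ct)).
by congr torus_int; apply/funext => v; rewrite /= !mulrBl.
Qed.

Lemma section_ip_lincombr u c : ccont u ->
  ip u (lincomb bas c) = \sum_i ip u (bas i) * (c i)^*%C.
Proof.
move=> cu; rewrite /section_ip.
have -> : (fun v => u v * (lincomb bas c v)^*%C * ((hermitian_weight Z v) ^+ k)%:C) =
   (fun v => \sum_i (c i)^*%C * (u v * (bas i v)^*%C * ((hermitian_weight Z v) ^+ k)%:C)).
  apply/funext => v; rewrite /lincomb (rmorph_sum (conjc : {rmorphism C -> C})).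
  rewrite mulr_sumr mulr_suml; apply: eq_bigr => i _.
  by rewrite rmorphM /= (mulrCA (u v)) -!mulrA.
have cwt i := section_ccont cu (@bas_ccont i).
rewrite torus_int_sum => [|i]; last by apply: ccontZ; exact: cwt.
by apply: eq_bigr => i _; rewrite (torus_intZ _ (cwt i)) mulrC.
Qed.

Lemma fourier_mode0 : fourier_mode (0, 0) = (fun=> 1) :> ('cV[R]_(n + n) -> C).
Proof.
apply/funext => v; rewrite fourier_mode_chi /= (_ : col_mx 0 0 = 0) ?chi0 //.
by rewrite col_mx0.
Qed.

Lemma eta0 : Defs.eta Z (0, 0) k = 1.
Proof.
rewrite /Defs.eta /eta_exponent /=.
have -> : map_mx intr (0 : 'cV[int]_n) = 0 :> 'cV[R]_n by apply/colP => i; rewrite !mxE.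
by rewrite !mulmx0 subr0 mulmx0 /dot !mulmx0 mxE addr0 mulr0 oppr0 expR0.
Qed.

Lemma phase0 (s : 'cV[int]_n) : phase R k (0, 0) s = 1.
Proof.
rewrite /phase /=.
have -> : map_mx intr (0 : 'cV[int]_n) = 0 :> 'cV[R]_n by apply/colP => i; rewrite !mxE.
by rewrite /dot trmx0 !mul0mx !mxE mulr0 addr0 mulr0 oppr0 mul0r cexp0.
Qed.

Lemma ip_bas i j : ip (bas i) (bas j) = if i == j then nrm Z k else 0.
Proof.
have := matrix_element hZ k0 (0, 0) (sg i) (sg j).
rewrite fourier_mode0 eta0 phase0 addr0 cong_sg !mul1r => <-.
by congr (section_ip _ _ _); apply/funext => v; rewrite mul1r.
Qed.

Lemma spanP s : H0 Z k s <-> exists c, s = lincomb bas c.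
Proof.
split=> [/(H0_span hZ k0) [a ->]|[c ->]].
  exists (fun i => a (enum_val i)); apply/funext => v; rewrite /lincomb.
  by rewrite big_enum_val.
pose phi z := \sum_i c i * theta Z k (sg i) z.
apply: (@quasiper_H0 R n Z k phi).
  by move=> z; apply: differentiableC_sum => i; exact: theta_differentiable.
move=> l z; rewrite mulr_sumr; apply: eq_bigr => i _.
by rewrite theta_quasiper // mulrCA.
Qed.

Section Norm.
Variable nu : R.
Hypothesis nu0 : 0 < nu.
Hypothesis nrmE : nrm Z k = nu%:C.

Lemma ip_lincomb_bas c j : ip (lincomb bas c) (bas j) = nu%:C * c j.
Proof.
rewrite section_ip_suml; [|exact: bas_ccont|exact: bas_ccont].
rewrite (bigD1 j) //= big1 => [|i ij]; last by rewrite ip_bas (negPf ij) mulr0.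
by rewrite ip_bas eqxx addr0 nrmE mulrC.
Qed.

Lemma ip_lincomb c c' :
  ip (lincomb bas c) (lincomb bas c') = nu%:C * \sum_i c i * (c' i)^*%C.
Proof.
rewrite section_ip_lincombr; last exact: lincomb_ccont.
by rewrite mulr_sumr; apply: eq_bigr => i _; rewrite ip_lincomb_bas mulrA.
Qed.

Lemma orth_proj_bas u : ccont u ->
  orth_proj (H0 Z k) ip u = lincomb bas (fun i => ip u (bas i) / nu%:C).
Proof.
move=> cu; apply: (orth_proj_lincomb nu0 spanP) => c c'.
have cc := @lincomb_ccont c.
rewrite section_ip_lincombr; last by apply: ccontB; [exact: cu|exact: cc].
rewrite mulr_sumr; apply: eq_bigr => i _.
rewrite (section_ipB cu cc (@bas_ccont i)) ip_lincomb_bas.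
have kn := nu_neq0 nu0; move: (ip u (bas i)) (c i) (c' i)^*%C (nu%:C) kn => x y z w kn.
by field.
Qed.

(** The matrix of the Toeplitz operator of the renormalized mode: a weighted shift of the
    theta basis. *)
Definition mode_mx (rs : 'cV[int]_n * 'cV[int]_n) (i j : 'I_N) : C :=
  if cong k (sg j + rs.1) (sg i) then phase R k rs (sg j) else 0.

(** The factor eta of the matrix elements cancels against its inverse, produced by the
    operator E at h = 1 / k. *)
Lemma toeplitz_mode rs c :
  toeplitz Z k (E_eval Z (k%:R^-1) (fourier_mode rs)) (lincomb bas c) =
  lincomb bas (fun i => \sum_j mode_mx rs i j * c j).
Proof.
have cF : ccont (fourier_mode rs : 'cV[R]_(n + n) -> C).
  have -> : fourier_mode rs = chi (col_mx rs.1 rs.2) :> ('cV[R]_(n + n) -> C).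
    by apply/funext => v; rewrite fourier_mode_chi.
  exact: ccont_chi.
have cFb j : ccont (fun v => fourier_mode rs v * bas j v).
  by apply: ccontM; [exact: cF|exact: bas_ccont].
set et : C := ((Defs.eta Z rs k)^-1)%:C.
rewrite /toeplitz E_eval_fourier_mode.
have -> : (fun v => et * fourier_mode rs v) \* lincomb bas c =
  (fun v => \sum_j (et * c j) * (fourier_mode rs v * bas j v)).
  apply/funext => v; rewrite /= /lincomb mulr_sumr; apply: eq_bigr => j _.
  move: (fourier_mode rs v) (bas j v) (c j) => *; ring.
rewrite orth_proj_bas; last by apply: ccont_sum => j; apply: ccontZ; exact: cFb.
congr lincomb; apply/funext => i.
rewrite section_ip_suml; [|exact: cFb|exact: bas_ccont].
rewrite mulr_suml; apply: eq_bigr => j _.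
rewrite matrix_element // /mode_mx; case: ifP => _; last by rewrite !mulr0 !mul0r.
have kn := nu_neq0 nu0; rewrite nrmE.
have : et * (Defs.eta Z rs k)%:C = 1.
  rewrite /et -(rmorphM (real_complex R)) mulVf //.
  by rewrite /Defs.eta gt_eqF ?expR_gt0.
move: (phase _ _ _ _) (c j) (nu%:C) kn et (_%:C) => x y w kn e f ef.
have -> : e * y * (f * x * w) / w = (e * f) * (x * y) by field.
by rewrite ef mul1r.
Qed.

Lemma cabs_mode_mx rs i j : cabs (mode_mx rs i j) <= 1.
Proof.
rewrite /mode_mx; case: ifP => _; last by rewrite cabs0.
rewrite /phase cabs_cexp -expR0 ler_expR.
by move: (_ / _ * _ : R) => x /=; lra.
Qed.

Variable F : 'cV[R]_(n + n) -> C.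
Hypothesis sF : summ (fun rs => cabs (fourier_coef F rs)).

Lemma mode_summ i j : summ (fun rs => cabs (fourier_coef F rs * mode_mx rs i j)).
Proof.
apply: summ_le sF => rs; rewrite cabsM ler_piMr ?cabs_ge0 //; exact: cabs_mode_mx.
Qed.

Definition toeplitz_mx : 'M[C]_N :=
  \matrix_(i, j) tsum (fun rs => fourier_coef F rs * mode_mx rs i j).

Lemma toeplitz_mx_sum i j : has_sum (fun rs => fourier_coef F rs * mode_mx rs i j) (toeplitz_mx i j).
Proof. by rewrite mxE; apply: tsumP; exact: mode_summ. Qed.

Lemma lincombB c c' : lincomb bas c \- lincomb bas c' = lincomb bas (fun i => c i - c' i).
Proof.
by apply/funext => v; rewrite /lincomb /= -sumrB; apply: eq_bigr => i _; rewrite mulrBl.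
Qed.

Lemma ip_diff c c' : let e := lincomb bas c \- lincomb bas c' in
  ip e e = (nu * \sum_i cabs (c i - c' i) ^+ 2)%:C.
Proof.
rewrite /= lincombB ip_lincomb (rmorphM (real_complex R)) (rmorph_sum (real_complex R)).
by congr (_ * _); apply: eq_bigr => i _; rewrite mulcJ_cabs.
Qed.

(** Convergence in the norm of the space of sections is convergence of the coordinates, as
    there are finitely many of them. *)
Lemma cvg_coords c (S : {fset 'cV[int]_n * 'cV[int]_n} -> 'I_N -> C) :
  ((fun A => ip (lincomb bas c \- lincomb bas (S A)) (lincomb bas c \- lincomb bas (S A)) : C^o)
     @ totally --> (0 : C^o)) <->
  (forall i (e : R), 0 < e -> exists A, forall B, (A `<=` B)%fset -> cabs (S B i - c i) < e).
Proof.
pose D A := nu * \sum_i cabs (c i - S A i) ^+ 2.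
have D0 A : 0 <= D A by rewrite mulr_ge0 ?(ltW nu0) // sumr_ge0 // => i _; rewrite exprn_ge0 ?cabs_ge0.
have DE : (fun A => ip (lincomb bas c \- lincomb bas (S A)) (lincomb bas c \- lincomb bas (S A)) : C^o)
    = (fun A => (D A)%:C : C^o).
  by apply/funext => A; have := ip_diff c (S A) => /= ->.
rewrite DE; split=> [/(cvg_cabsP (F := totally)) h i e e0|h].
  have {}h := h (totally_is_filter _).
  have [A _ hA] := h _ (mulr_gt0 nu0 (exprn_gt0 2 e0)); exists A => B AB.
  have := hA B AB; rewrite subr0 cabs_real ger0_norm // /D ltr_pM2l // => hB.
  rewrite -(ltr_pXn2r (n := 2)) ?nnegrE ?cabs_ge0 ?(ltW e0) //.
  apply: le_lt_trans hB; rewrite cabs_sub (bigD1 i) //= lerDl sumr_ge0 // => j _.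
  by rewrite exprn_ge0 ?cabs_ge0.
apply/(cvg_cabsP (F := totally)); first exact: totally_is_filter.
move=> e e0.
pose K := nu * (N%:R + 1); have K0 : 0 < K by rewrite mulr_gt0 // ltr_wpDl.
pose d := Num.min 1 (e / K).
have d0 : 0 < d by rewrite lt_min ltr01 divr_gt0.
have /choice [A hA] : forall i, exists A, forall B, (A `<=` B)%fset -> cabs (S B i - c i) < d.
  by move=> i; exact: h.
exists (\bigcup_(i <- index_enum 'I_N) A i)%fset => // B /= AB.
rewrite subr0 cabs_real ger0_norm //.
have di i : cabs (c i - S B i) ^+ 2 <= d.
  have hi : cabs (c i - S B i) <= d.
    rewrite cabs_sub ltW //; apply: hA; apply: fsubset_trans AB.
    by apply: bigfcup_sup => //; rewrite mem_index_enum.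
  apply: le_trans (_ : cabs (c i - S B i) * 1 <= d); last by rewrite mulr1.
  rewrite expr2 ler_wpM2l ?cabs_ge0 //; apply: le_trans hi _.
  by rewrite ge_min lexx.
apply: (@le_lt_trans _ _ (nu * (N%:R * d))).
  rewrite /D ler_pM2l //; apply: le_trans (ler_sum _ (fun i _ => di i)) _.
  by rewrite sumr_const card_ord mulr_natl.
apply: (@lt_le_trans _ _ (K * d)).
  by rewrite /K -mulrA ltr_pM2l // ltr_pM2r // ltrDl.
have : d <= e / K by rewrite ge_min lexx orbT.
by rewrite ler_pdivlMr // mulrC.
Qed.

(** The entries of the partial sums converge absolutely since the entries of the modes
    have modulus at most 1; the limit is unique because coordinates are. *)
Lemma toeplitz_E_matrix : has_matrix bas (toeplitz_E Z k F) toeplitz_mx.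
Proof.
move=> c; set d : 'I_N -> C := fun i => \sum_j toeplitz_mx i j * c j.
pose S (A : {fset 'cV[int]_n * 'cV[int]_n}) (i : 'I_N) : C :=
  \sum_(rs <- A) \sum_j c j * (fourier_coef F rs * mode_mx rs i j).
have SE A : (fun v => partial_sum (fun rs => fourier_coef F rs *
    toeplitz Z k (E_eval Z (k%:R^-1) (fourier_mode rs)) (lincomb bas c) v) A) =
  lincomb bas (S A).
  apply/funext => v; rewrite /partial_sum /lincomb.
  transitivity (\sum_(rs <- A) \sum_i
     (\sum_j c j * (fourier_coef F rs * mode_mx rs i j)) * bas i v).
    rewrite big_seq_fsetE; apply: eq_bigr => rs _.
    rewrite toeplitz_mode /lincomb mulr_sumr; apply: eq_bigr => i _.
    rewrite mulrA mulr_sumr; congr (_ * _); apply: eq_bigr => j _; ring.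
  by rewrite exchange_big; apply: eq_bigr => i _; rewrite /S mulr_suml.
have hd i : has_sum (fun rs => \sum_j c j * (fourier_coef F rs * mode_mx rs i j)) (d i).
  have -> : d i = \sum_j c j * toeplitz_mx i j by apply: eq_bigr => j _; rewrite mulrC.
  by apply: has_sum_sum => j; apply: has_sumZ; exact: toeplitz_mx_sum.
apply: xget_unique.
  split; first by apply/spanP; exists d.
  under [X in X @ _ --> _]funext do rewrite SE.
  apply/cvg_coords => i; exact: (hd i).
move=> p [/spanP [d' ->] h]; congr lincomb; apply/funext => i.
have {}h : (fun A => ip (lincomb bas d' \- lincomb bas (S A)) (lincomb bas d' \- lincomb bas (S A)) : C^o)
     @ totally --> (0 : C^o).
  by move: h; under [X in X @ _ --> _]funext do rewrite SE.
apply: has_sum_uniq (hd i); exact: (cvg_coords d' S).1 h i.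
Qed.

End Norm.
End ToeplitzMatrix.

(** * Fourier coefficients of smooth functions *)

Section IntegrationByParts.
Variables (R : realType) (d : nat).
Implicit Types (f g u : 'cV[R]_d -> R).
Local Notation e i := (delta_mx i 0 : 'cV[R]_d).

Lemma is_derive_on_line f i v (t : R) : (forall w, derivable f w (e i)) ->
  is_derive t (1 : R) (fun s => f (v + s *: e i)) ('D_(e i) f (v + t *: e i)).
Proof.
move=> df; have := df (v + t *: e i).
have E : (fun h : R => h^-1 *: ((f \o shift (v + t *: e i)) (h *: e i) - f (v + t *: e i))) =
  (fun h : R => h^-1 *: (((fun s => f (v + s *: e i)) \o shift t) (h *: 1) - f (v + t *: e i))).
  apply/funext => h /=; congr (_ *: (f _ - _)).
  by rewrite [h *: 1]mulr1 scalerDl addrCA.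
rewrite /derivable E => D.
by split=> //; rewrite /derive -E.
Qed.

(** The product is periodic, so its derivative integrates to zero. *)
Lemma cube_int_by_parts f g f' g' (i : 'I_d) :
  continuous f -> continuous f' -> continuous g -> continuous g' -> zper f -> zper g ->
  (forall v (t : R), is_derive t (1 : R) (fun s => f (v + s *: e i)) (f' (v + t *: e i))) ->
  (forall v (t : R), is_derive t (1 : R) (fun s => g (v + s *: e i)) (g' (v + t *: e i))) ->
  cube_int (fun v => f' v * g v) = - cube_int (fun v => f v * g' v).
Proof.
move=> cf cf' cg cg' pf pg df dg; apply/eqP; rewrite -addr_eq0; apply/eqP.
have c1 : continuous (fun v => f' v * g v) by apply: continuousM_fun.
have c2 : continuous (fun v => f v * g' v) by apply: continuousM_fun.
rewrite -(cube_intD c1 c2).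
apply: (@cube_int_deriv0 R d (fun v => f v * g v) (fun v => f' v * g v + f v * g' v) i).
- by apply: continuousM_fun.
- by apply: continuousD_fun.
- by move=> l v; rewrite pf pg.
move=> v t; have H := is_deriveM (df v t) (dg v t).
by apply: (@is_derive_eq _ _ _ _ _ _ _ _ H); rewrite /GRing.scale /= addrC mulrC.
Qed.

Lemma is_derive_phase (a b t : R) :
  is_derive t (1 : R) (fun s => cos (a + s * b)) (- (b * sin (a + t * b))) /\
  is_derive t (1 : R) (fun s => sin (a + s * b)) (b * cos (a + t * b)).
Proof.
have dl : is_derive t 1 (fun s : R => a + s * b) b.
  have H := is_deriveD (is_derive_cst a t 1) (is_deriveM (is_derive_id t 1) (is_derive_cst b t 1)).
  by apply: (@is_derive_eq _ _ _ _ _ _ _ _ H); rewrite add0r scaler0 add0r [_ *: _]mulr1.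
split.
  have H := @is_derive1_comp R cos (fun s : R => a + s * b) t _ _ (is_derive_cos _) dl.
  by apply: (@is_derive_eq _ _ _ _ _ _ _ _ H); rewrite mulNr mulrC.
have H := @is_derive1_comp R sin (fun s : R => a + s * b) t _ _ (is_derive_sin _) dl.
by apply: (@is_derive_eq _ _ _ _ _ _ _ _ H); rewrite mulrC.
Qed.

Lemma derive_zper f i : zper f -> zper ('D_(e i) f).
Proof.
move=> pf l v; rewrite /derive.
suff -> : (fun h : R => h^-1 *: ((f \o shift (v + map_mx intr l)) (h *: e i) - f (v + map_mx intr l))) =
  (fun h : R => h^-1 *: ((f \o shift v) (h *: e i) - f v)) by [].
by apply/funext => h /=; rewrite addrA !pf.
Qed.

Lemma is_Ck_comb m f g (c : R) : is_Ck m f -> is_Ck m g -> is_Ck m (fun v => f v - c * g v).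
Proof.
elim: m f g => [|m IH] f g /= [cf df] [cg dg].
  by split => //; apply: continuousB_fun => //; exact: continuousZ_fun.
split; first by apply: continuousB_fun => //; exact: continuousZ_fun.
move=> i; have [df1 df2] := df i; have [dg1 dg2] := dg i.
have E v : is_derive v (e i) (fun v => f v - c * g v) ('D_(e i) f v - c * 'D_(e i) g v).
  have h1 := derivableP (df1 v); have h2 := derivableP (dg1 v).
  have -> : (fun v => f v - c * g v) = f - c \*: g by [].
  by apply: is_derive_eq.
split=> [v|]; first by case: (E v).
have -> : 'D_(e i) (fun v => f v - c * g v) = (fun v => 'D_(e i) f v - c * 'D_(e i) g v).
  by apply/funext => v; case: (E v).
exact: IH.
Qed.

End IntegrationByParts.

Section Decay.
Variables (R : realType) (d : nat).
Local Notation C := R[i].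
Implicit Types (u : 'cV[R]_d -> C).
Local Notation e i := (delta_mx i 0 : 'cV[R]_d).

(** The operator partial_deriv for a vector space of any dimension. *)
Definition pderiv (i : 'I_d) u : 'cV[R]_d -> C := fun v =>
  'D_(e i) (fun w => complex.Re (u w)) v +i* 'D_(e i) (fun w => complex.Im (u w)) v.

Lemma smooth_pderiv i u : smooth u -> smooth (pderiv i u).
Proof.
move=> su m; have [[_ h1] [_ h2]] := su m.+1.
by split; [exact: (h1 i).2|exact: (h2 i).2].
Qed.

Lemma smooth_comb u w (c : R) : smooth u -> smooth w -> smooth (fun v => u v - c%:C * w v).
Proof.
move=> su sw m; have [u1 u2] := su m; have [w1 w2] := sw m.
have -> : (fun v => complex.Re (u v - c%:C * w v)) = (fun v => complex.Re (u v) - c * complex.Re (w v)).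
  by apply/funext => v; case: (u v) (w v) => [a b] [a' b'] /=; rewrite mul0r subr0.
have -> : (fun v => complex.Im (u v - c%:C * w v)) = (fun v => complex.Im (u v) - c * complex.Im (w v)).
  by apply/funext => v; case: (u v) (w v) => [a b] [a' b'] /=; rewrite mul0r addr0.
by split; exact: is_Ck_comb.
Qed.

Lemma smooth_ccont u : smooth u -> ccont u.
Proof. by move=> su; have [[c1 _] [c2 _]] := su 0%N; apply/ccontP. Qed.

Lemma zper_ReIm u : zper u -> zper (fun v => complex.Re (u v)) /\ zper (fun v => complex.Im (u v)).
Proof. by move=> pu; split=> l v; rewrite pu. Qed.

Lemma pderiv_zper i u : zper u -> zper (pderiv i u).
Proof.
move=> /zper_ReIm [p1 p2] l v; rewrite /pderiv.
by rewrite (derive_zper _ p1) (derive_zper _ p2).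
Qed.

(** Integration by parts, on the real and imaginary parts separately. *)
Lemma fcoef_pderiv i u m : smooth u -> zper u ->
  fcoef (pderiv i u) m = 2 * pi%:C * 'i%C * (m i 0)%:~R * fcoef u m.
Proof.
move=> su pu; have sd := smooth_pderiv i su.
have [[cf df] [ch dh]] := su 1%N; have [[cf' _] [ch' _]] := sd 0%N.
have [pf ph] := zper_ReIm pu.
set f := fun v => complex.Re (u v) in cf df pf cf'.
set h := fun v => complex.Im (u v) in ch dh ph ch'.
pose th (v : 'cV[R]_d) : R := 2 * pi * dot (map_mx intr m) v.
pose c v := cos (th v); pose s v := sin (th v).
pose b : R := 2 * pi * (m i 0)%:~R.
have thl v (t : R) : th (v + t *: e i) = th v + t * b.
  rewrite /th dotDr mulrDr; congr (_ + _); rewrite /dot -scalemxAr mxE -colE !mxE /b.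
  by rewrite mulrCA.
have chiM v : chi (- m) v = c v -i* s v.
  by rewrite -chiJ chiE.
have cc : continuous c.
  have := @ccont_chi R d m => /ccontP[+ _].
  by under [X in continuous X -> _]funext do rewrite chiE /=.
have cs : continuous s.
  have := @ccont_chi R d m => /ccontP[_].
  by under [X in continuous X -> _]funext do rewrite chiE /=.
have pc : zper c by move=> l v; have := chi_per m l v; rewrite !chiE => -[].
have ps : zper s by move=> l v; have := chi_per m l v; rewrite !chiE => -[].
have dc v (t : R) : is_derive t (1 : R) (fun x => c (v + x *: e i)) (- (b * s (v + t *: e i))).
  rewrite /c /s thl (funext (fun x => congr1 cos (thl v x))).
  exact: (is_derive_phase _ _ _).1.
have ds v (t : R) : is_derive t (1 : R) (fun x => s (v + x *: e i)) (b * c (v + t *: e i)).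
  rewrite /c /s thl (funext (fun x => congr1 sin (thl v x))).
  exact: (is_derive_phase _ _ _).2.
have cbs : continuous (fun v => - (b * s v)).
  by apply: continuousN_fun; exact: continuousZ_fun.
have cbc : continuous (fun v => b * c v) by exact: continuousZ_fun.
have hf v (t : R) := is_derive_on_line v t (df i).1.
have hh v (t : R) := is_derive_on_line v t (dh i).1.
have bl (x y : 'cV[R]_d -> R) : continuous x -> continuous y ->
    cube_int (fun v => x v * (b * y v)) = b * cube_int (fun v => x v * y v).
  move=> cx cy; rewrite -cube_intZ; last exact: continuousM_fun.
  by congr cube_int; apply/funext => v; rewrite mulrCA.
have bln (x y : 'cV[R]_d -> R) : continuous x -> continuous y ->
    cube_int (fun v => x v * - (b * y v)) = - (b * cube_int (fun v => x v * y v)).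
  move=> cx cy; rewrite -bl // -[RHS]mulN1r -cube_intZ.
    by congr cube_int; apply/funext => v; rewrite mulrN mulN1r.
  by apply: continuousM_fun => //; exact: continuousZ_fun.
have E1 := cube_int_by_parts cf cf' cc cbs pf pc hf dc.
have E2 := cube_int_by_parts cf cf' cs cbc pf ps hf ds.
have E3 := cube_int_by_parts ch ch' cc cbs ph pc hh dc.
have E4 := cube_int_by_parts ch ch' cs cbc ph ps hh ds.
rewrite bln // opprK in E1; rewrite bln // opprK in E3.
rewrite bl // in E2; rewrite bl // in E4.
have split (w : 'cV[R]_d -> C) : continuous (fun v => complex.Re (w v)) ->
    continuous (fun v => complex.Im (w v)) -> fcoef w m =
    (cube_int (fun v => complex.Re (w v) * c v) + cube_int (fun v => complex.Im (w v) * s v)) +i*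
    (cube_int (fun v => complex.Im (w v) * c v) - cube_int (fun v => complex.Re (w v) * s v)).
  move=> c1 c2; apply: complex_eq; rewrite /fcoef ?Re_torus_int ?Im_torus_int.
    rewrite /= -cube_intD; [|exact: continuousM_fun|exact: continuousM_fun].
    congr cube_int; apply/funext => v; rewrite chiM; case: (w v) => x y /=.
    by rewrite mulrN opprK.
  rewrite /= -mulN1r -cube_intZ; last exact: continuousM_fun.
  rewrite -cube_intD; [|exact: continuousM_fun|]; last first.
    by apply: continuousZ_fun; exact: continuousM_fun.
  congr cube_int; apply/funext => v; rewrite chiM; case: (w v) => x y /=.
  by rewrite mulrN mulN1r addrC.
rewrite (split _ cf' ch') (split _ cf ch).
rewrite E1 E2 E3 E4.
have -> : 2 * pi%:C * 'i%C * (m i 0)%:~R = b%:C * 'i%C :> C.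
  rewrite /b !(rmorphM (real_complex R)) (rmorph_int (real_complex R)) (rmorph_nat (real_complex R)).
  by rewrite mulrAC.
move: (cube_int _) (cube_int _) (cube_int _) (cube_int _) => x1 x2 x3 x4.
apply: complex_eq => /=; ring.
Qed.

(** The integral of |Re u| + |Im u| bounds both parts of every coefficient. *)
Lemma fcoef_bounded u : ccont u -> exists2 K : R, 0 <= K & forall m, cabs (fcoef u m) <= K.
Proof.
move=> cu; pose w v := `|complex.Re (u v)| + `|complex.Im (u v)|.
have [c1 c2] : continuous (fun v => complex.Re (u v)) /\ continuous (fun v => complex.Im (u v)).
  exact/ccontP.
have cn (x : 'cV[R]_d -> R) : continuous x -> continuous (fun v => `|x v|).
  by move=> cx; apply: (continuous_comp_fun x (fun y : R => `|y|)) => // y; exact: norm_continuous.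
have cw : continuous w by apply: continuousD_fun; exact: cn.
have cNw : continuous (fun v => -1 * w v) by exact: continuousZ_fun.
have key (x : 'cV[R]_d -> R) : continuous x -> (forall v, `|x v| <= w v) -> `|cube_int x| <= cube_int w.
  move=> cx xw; rewrite ler_norml; apply/andP; split.
    rewrite -mulN1r -cube_intZ //; apply: cube_int_le => // v _.
    by have := xw v; rewrite ler_norml => /andP[+ _]; rewrite mulN1r.
  by apply: cube_int_le => // v _; apply: le_trans (xw v); exact: ler_norm.
have w0 : 0 <= cube_int w.
  by apply: le_trans (key _ (@continuous_cst_fun _ _ (0 : R)) _) => // v; rewrite normr0 addr_ge0.
exists (cube_int w *+ 2) => [|m]; first exact: mulrn_wge0.
have [d1 d2] : continuous (fun v => complex.Re (u v * chi (- m) v)) /\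
    continuous (fun v => complex.Im (u v * chi (- m) v)).
  by apply/ccontP; apply: ccontM; [exact: cu|exact: ccont_chi].
have uw v : cabs (u v * chi (- m) v) <= w v.
  by rewrite cabsM cabs_chi mulr1; exact: cabs_le_ReIm.
apply: le_trans (cabs_le_ReIm _) _; rewrite mulr2n /fcoef Re_torus_int Im_torus_int.
apply: lerD; apply: key => // v; apply: le_trans (uw v); [exact: Re_le_cabs|exact: Im_le_cabs].
Qed.

(** The operator 1 - (d/dv_i)^2 / (4 pi^2). It multiplies the m-th Fourier coefficient by
    1 + m_i^2, so applying it in every direction gains the summable weight. *)
Definition bessel (i : 'I_d) u : 'cV[R]_d -> C := fun v =>
  u v - ((4 * pi ^+ 2)^-1)%:C * pderiv i (pderiv i u) v.

Lemma bessel_smooth i u : smooth u -> smooth (bessel i u).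
Proof. by move=> su; apply: smooth_comb => //; do 2!apply: smooth_pderiv. Qed.

Lemma bessel_zper i u : zper u -> zper (bessel i u).
Proof.
by move=> pu l v; rewrite /bessel pu (pderiv_zper i (pderiv_zper i pu)).
Qed.

Lemma fcoef_bessel i u m : smooth u -> zper u ->
  fcoef (bessel i u) m = (1 + (m i 0)%:~R ^+ 2)%:C * fcoef u m.
Proof.
move=> su pu; have s1 := smooth_pderiv i su; have s2 := smooth_pderiv i s1.
have p1 := pderiv_zper i pu.
have c0 : ccont (fun v => u v * chi (- m) v).
  by apply: ccontM; [exact: smooth_ccont|exact: ccont_chi].
have c2 : ccont (fun v => pderiv i (pderiv i u) v * chi (- m) v).
  by apply: ccontM; [exact: smooth_ccont|exact: ccont_chi].
pose a : C := ((4 * pi ^+ 2)^-1)%:C.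
have ca2 : ccont (fun v => a * (pderiv i (pderiv i u) v * chi (- m) v)) by apply: ccontZ; exact: c2.
have -> : fcoef (bessel i u) m = fcoef u m - a * fcoef (pderiv i (pderiv i u)) m.
  rewrite /fcoef -(torus_intZ _ c2) -(torus_intB c0 ca2); congr torus_int.
  by apply/funext => v; rewrite /bessel mulrBl -mulrA.
rewrite !fcoef_pderiv //.
have i2 : 'i%C * 'i%C = -1 :> C by rewrite -expr2 sqr_i.
have aE : a * (4 * pi%:C ^+ 2) = 1.
  have -> : 4 * pi%:C ^+ 2 = (4 * pi ^+ 2)%:C :> C.
    by rewrite (rmorphM (real_complex R)) (rmorphXn (real_complex R)) (rmorph_nat (real_complex R)).
  rewrite -(rmorphM (real_complex R)) mulVf //.
  by rewrite mulf_neq0 ?pnatr_eq0 // expf_neq0 // gt_eqF // pi_gt0.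
have -> : (1 + (m i 0)%:~R ^+ 2)%:C = 1 + (m i 0)%:~R ^+ 2 :> C.
  by rewrite (rmorphD (real_complex R)) (rmorphXn (real_complex R)) /= (rmorph_int (real_complex R)).
move: (fcoef u m) ((m i 0)%:~R) => x y.
have -> : a * (2 * pi%:C * 'i%C * y * (2 * pi%:C * 'i%C * y * x)) =
   (a * (4 * pi%:C ^+ 2)) * ('i%C * 'i%C) * (y ^+ 2 * x) by ring.
rewrite aE i2; ring.
Qed.

(** Apply the operators above in all directions; the coefficients of the result are
    bounded. *)
Lemma smooth_fcoef_summ u : smooth u -> zper u -> summ (fun m => cabs (fcoef u m)).
Proof.
move=> su pu.
have [w [sw pw hw]] : exists w, [/\ smooth w, zper w &
    forall m, fcoef w m = (\prod_i (1 + (m i 0)%:~R ^+ 2))%:C * fcoef u m].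
  elim: (index_enum _) => [|i r [w [sw pw hw]]].
    by exists u; split => // m; rewrite big_nil mul1r.
  exists (bessel i w); split; [exact: bessel_smooth|exact: bessel_zper|move=> m].
  by rewrite fcoef_bessel // hw big_cons (rmorphM (real_complex R)) mulrA.
have [K K0 hK] := fcoef_bounded (smooth_ccont sw).
apply: summ_le (summZ K0 (@summ_lwt R d)) => m.
have P0 : 0 < \prod_i (1 + (m i 0)%:~R ^+ 2) :> R.
  by apply: prodr_gt0 => i _; rewrite ltr_pwDl // sqr_ge0.
have -> : lwt R m = (\prod_i (1 + (m i 0)%:~R ^+ 2))^-1.
  by rewrite /lwt -prodfV.
rewrite ler_pdivlMr //; have := hK m; rewrite hw cabsM cabs_real ger0_norm ?(ltW P0) //.
by rewrite mulrC.
Qed.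

End Decay.

Section Coordinates.
Variables (R : realType) (n : nat).

(** In the coordinates dual to the basis the lattice consists of the integer vectors. *)
Lemma in_coords_zper (V : vectType R) (omega : V -> V -> R) (Lambda : set V)
    (lam : 'I_(n + n) -> V) (f : V -> R[i]) :
  symplectic_lattice_basis omega Lambda lam -> Cinfty_torus Lambda lam f ->
  zper (in_coords lam f).
Proof.
move=> hlam [pf _] l v; rewrite /in_coords -(pf (\sum_i (l i 0)%:~R *: lam i) (\sum_i v i 0 *: lam i)).
  congr f; rewrite -big_split; apply: eq_bigr => i _.
  by rewrite !mxE scalerDl.
by rewrite (lam_lattice hlam); exists (fun i => l i 0).
Qed.

(** A Fourier mode is the character indexed by the concatenation of r and s, and the
    pairing conjugates it. *)
Lemma fourier_coefE (f : 'cV[R]_(n + n) -> R[i]) rs :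
  fourier_coef f rs = fcoef f (col_mx rs.1 rs.2).
Proof.
rewrite /fourier_coef /torus_ip /fcoef; congr torus_int; apply/funext => v.
by rewrite fourier_mode_chi chiJ.
Qed.

End Coordinates.

(** * The limit of the Hilbert-Schmidt product *)

Section ModePairing.
Variables (R : realType) (n k : nat).
Hypothesis k0 : (0 < k)%N.
Local Notation C := R[i].
Local Notation N := #|{ffun 'I_n -> 'I_k}|.
Local Notation modes := ('cV[int]_n * 'cV[int]_n)%type.
Implicit Types p q : modes.

Lemma congC (s m : 'cV[int]_n) : cong k s m = cong k m s.
Proof. exact: (cong_eq s (cong_refl k m)). Qed.

(** A translation permutes the classes mod k. *)
Lemma sum_sg_translate (h : 'cV[int]_n -> C) (e : 'cV[int]_n) :
  (forall s m, cong k s m -> h s = h m) ->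
  \sum_(i < N) h (sg i + e) = \sum_(i < N) h (sg i).
Proof.
move=> hc; have /choice [t ht] : forall i : 'I_N, exists j : 'I_N, cong k (sg j) (sg i + e).
  by move=> i; exact: exists_sg.
have tinj : injective t.
  move=> i i' E; apply/eqP; rewrite -(cong_sg (k := k)) -(congD k _ _ e).
  have h2 := ht i'; rewrite -E in h2.
  by rewrite (cong_eq (sg i + e) h2) ht.
rewrite [RHS](reindex_inj tinj); apply: eq_bigr => i _.
by apply: hc; rewrite congC; exact: ht.
Qed.

(** For a common r the phases differ by a constant and a character of the group (Z/k)^n
    evaluated at s. *)
Lemma phase_ratio r (a b s : 'cV[int]_n) :
  phase R k (r, a) s * (phase R k (r, b) s)^*%C =
  cexp (- (pi / k%:R * (dot (a - b) r)%:~R)%:C * 'i%C) *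
  cexp (- (2 * pi / k%:R * (dot (a - b) s)%:~R)%:C * 'i%C).
Proof.
rewrite /phase cexpJ -!cexpD /= !dot_intr; congr cexp.
have E (x : 'cV[int]_n) : dot (a - b) x = dot a x - dot b x.
  by rewrite dotDl; congr (_ + _); rewrite !dotE -sumrN; apply: eq_bigr => i _; rewrite mxE mulNr.
rewrite !E !intrB.
move: (dot a r)%:~R (dot b r)%:~R (dot a s)%:~R (dot b s)%:~R (pi : R) (k%:R^-1 : R) => *.
by apply: complex_eq => /=; ring.
Qed.

Lemma cabs_phase p s : cabs (phase R k p s) = 1.
Proof.
rewrite /phase cabs_cexp -[RHS]expR0; congr expR.
by move: (_ / _ * _ : R) => x /=; lra.
Qed.

(** By cos (2 x) = 1 - 2 sin^2 x and the positivity of sin on (0, pi). *)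
Lemma cexp_root_neq1 (t : int) : t != 0 -> (`|t| < k)%N ->
  cexp (- (2 * pi / k%:R * t%:~R)%:C * 'i%C) != 1 :> C.
Proof.
move=> t0 tk; apply/eqP => /(congr1 (@complex.Re R)).
have kn := k_neq0 R k0; have kp := k_gt0 R k0.
pose x : R := pi / k%:R * t%:~R.
have -> : complex.Re (cexp (- (2 * pi / k%:R * t%:~R)%:C * 'i%C)) = cos (x *+ 2).
  rewrite /cexp /= -cosN; set a := (_ * _ * _ : R).
  have -> : - a * 0 - - 0 * 1 = 0 by ring.
  rewrite expR0 mul1r; congr cos; rewrite /x /a mulr2n; ring.
rewrite cos_mulr2n => E.
have x0 : 0 < `|x| < pi.
  rewrite /x normrM (ger0_norm (divr_ge0 (pi_ge0 R) (ltW kp))).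
  have tn : `|t%:~R| = (`|t|%N)%:R :> R by rewrite -intr_norm -abszE.
  rewrite tn mulrAC ltr_pdivrMr // ltr_pM2l ?pi_gt0 // ltr_nat tk andbT.
  by rewrite divr_gt0 // mulr_gt0 ?pi_gt0 // ltr0n absz_gt0.
have s2 : sin `|x| ^+ 2 = 0.
  have -> : sin `|x| ^+ 2 = sin x ^+ 2.
    by case: (ger0P x) => _ //; rewrite sinN sqrrN.
  rewrite sin2cos2; move: E; rewrite /= mulr2n; lra.
by have := exprn_gt0 2 (sin_gt0_pi x0); rewrite s2 ltxx.
Qed.

(** Orthogonality of the characters of (Z/k)^n. Translating the index by a basis vector
    multiplies the sum by a root of unity other than 1. *)
Lemma sum_roots (t : 'cV[int]_n) : (exists2 i, t i 0 != 0 & (`|(t i 0)%R| < k)%N) ->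
  \sum_(j < N) cexp (- (2 * pi / k%:R * (dot t (sg j))%:~R)%:C * 'i%C) = 0 :> C.
Proof.
move=> [i t0 tk].
pose h (m : 'cV[int]_n) : C := cexp (- (2 * pi / k%:R * (dot t m)%:~R)%:C * 'i%C).
have kn := k_neq0 R k0.
have hD m m' : h (m + m') = h m * h m'.
  have cD (u v : R) : cexp (- (u + v)%:C * 'i%C) = cexp (- u%:C * 'i%C) * cexp (- v%:C * 'i%C) :> C.
    by rewrite (rmorphD (real_complex R)) opprD mulrDl cexpD.
  by rewrite /h dotDr intrD mulrDr cD.
have hk b : h (k%:Z *: b) = 1.
  rewrite /h -[RHS](cexp_periodic R (- dot t b)); congr cexp.
  have -> : dot t (k%:Z *: b) = k%:Z * dot t b by rewrite /dot -scalemxAr mxE.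
  rewrite intrM mulrNz; have -> : (k%:Z)%:~R = k%:R :> R by [].
  rewrite -(rmorph_int (real_complex R) (dot t b)); move: ((dot t b)%:~R : R) => x.
  move: (pi : R) (k%:R : R) kn => P K kn.
  by apply: complex_eq => /=; field.
have hc s m : cong k s m -> h s = h m by case/congP => b ->; rewrite hD hk mulr1.
have := sum_sg_translate (delta_mx i 0) hc.
under eq_bigr do rewrite hD; rewrite -mulr_suml => /eqP; rewrite -subr_eq0.
rewrite -[X in _ - X]mulr1 -mulrBr mulf_eq0 => /orP[/eqP // | ].
rewrite subr_eq0 => /eqP E; have := cexp_root_neq1 t0 tk.
rewrite -E /h (_ : dot t (delta_mx i 0) = t i 0) ?eqxx //.
by rewrite /dot -colE !mxE.
Qed.

(** The unnormalized Hilbert-Schmidt product of two renormalized modes. *)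
Definition mode_pair p q : C :=
  \sum_(i < N) \sum_(j < N) mode_mx R p i j * (mode_mx R q i j)^*%C.

(** Each column of a shift matrix has one nonzero entry, so the two matrices either meet
    in every column or in none. *)
Lemma mode_pairE p q : mode_pair p q =
  if cong k p.1 q.1 then \sum_(j < N) phase R k p (sg j) * (phase R k q (sg j))^*%C else 0.
Proof.
have c0 : (0 : C)^*%C = 0 by apply: complex_eq => //=; rewrite oppr0.
have congT (a b s : 'cV[int]_n) : cong k (s + a) (s + b) = cong k a b.
  by rewrite ![s + _]addrC congD.
rewrite /mode_pair exchange_big /=; case: ifP => pq; last first.
  rewrite big1 // => j _; rewrite big1 // => i _; rewrite /mode_mx.
  case: ifP => [h|_]; last by rewrite mul0r.
  case: ifP => [h'|_]; last by rewrite c0 mulr0.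
  have : cong k (sg j + p.1) (sg j + q.1).
    by rewrite -(cong_eq _ h).
  by rewrite congT pq.
apply: eq_bigr => j _; have [i hi] := exists_sg k0 (sg j + p.1).
have hij i' : cong k (sg j + p.1) (sg i') = (i' == i).
  by rewrite congC (cong_eq _ hi) cong_sg eq_sym.
have hij' i' : cong k (sg j + q.1) (sg i') = (i' == i).
  have hpq : cong k (sg j + p.1) (sg j + q.1) by rewrite congT.
  have hi' : cong k (sg i) (sg j + q.1) by rewrite (cong_eq _ hpq) hij.
  by rewrite congC (cong_eq _ hi') cong_sg eq_sym.
rewrite (bigD1 i) //= big1 => [|i' ii']; last by rewrite /mode_mx hij (negPf ii') mul0r.
by rewrite /mode_mx hij hij' eqxx addr0.
Qed.

Lemma card_theta_index : N = (k ^ n)%N.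
Proof. by rewrite card_ffun !card_ord. Qed.

Lemma cabs_mode_pair p q : cabs (k%:R ^- n * mode_pair p q) <= 1.
Proof.
have kn : 0 < k%:R ^+ n :> R by rewrite exprn_gt0 // ltr0n.
rewrite cabsM cabsV cabsX cabs_nat ler_pdivrMl // mulr1 mode_pairE.
case: ifP => _; last by rewrite cabs0 ltW.
apply: le_trans (cabs_sum _ _ _) _.
under eq_bigr do rewrite cabsM cabsJ !cabs_phase mulr1.
by rewrite sumr_const card_ord card_theta_index natrX.
Qed.

Lemma mode_pair_self p : k%:R ^- n * mode_pair p p = 1.
Proof.
rewrite mode_pairE cong_refl.
under eq_bigr do rewrite mulcJ_cabs cabs_phase expr1n.
rewrite sumr_const card_ord card_theta_index natrX mulVf //.
by rewrite expf_neq0 // pnatr_eq0 -lt0n.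
Qed.

(** Once k exceeds the differences of the indices, congruence of the first indices is
    equality, and the second ones give a nontrivial character. *)
Lemma mode_pair_neq p q : p != q ->
  (forall i, (`|(p.1 i 0 - q.1 i 0)%R| < k)%N) ->
  (forall i, (`|(p.2 i 0 - q.2 i 0)%R| < k)%N) -> mode_pair p q = 0.
Proof.
case: p q => r a [r' b] /= pq h1 h2; rewrite mode_pairE /=; case: ifP => // rr.
have E : r = r'.
  apply/colP => i; move/forallP/(_ i): rr; rewrite dvdzE -opprB abszN /= => hd.
  apply/eqP; rewrite -subr_eq0 -absz_eq0; apply: contraLR (h1 i) => ne.
  by rewrite -leqNgt dvdn_leq // lt0n.
move: pq; rewrite -{}E => pq.
under eq_bigr do rewrite phase_ratio.
rewrite -mulr_sumr sum_roots ?mulr0 //.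
have ab : a - b != 0 by rewrite subr_eq0; apply: contra pq => /eqP ->.
case: (pickP (fun i => (a - b) i 0 != 0)) => [i hi|h0].
  by exists i => //; rewrite !mxE.
case/eqP: ab; apply/colP => i; have := h0 i; rewrite mxE => /negbFE/eqP ->.
by rewrite mxE.
Qed.

End ModePairing.

(** For each pair of modes the limit is attained for k large. *)
Lemma mode_pair_cvg (R : realType) (n : nat) (p q : 'cV[int]_n * 'cV[int]_n) :
  (fun k : nat => k%:R ^- n * mode_pair R k p q : R[i]^o) @ \oo --> ((p == q)%:R : R[i]^o).
Proof.
pose M := (\max_i `|(p.1 i ord0 - q.1 i ord0)%R| + \max_i `|(p.2 i ord0 - q.2 i ord0)%R|)%N.
apply/cvg_cabsP => e e0.
near=> k.
have kM : (M < k)%N by near: k; exact: nbhs_infty_gt.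
have k0 : (0 < k)%N by apply: leq_ltn_trans kM.
suff -> : k%:R ^- n * mode_pair R k p q = (p == q)%:R by rewrite subrr cabs0.
have [<-|pq] := eqVneq p q; first exact: mode_pair_self.
rewrite mode_pair_neq ?mulr0 // => i; apply: leq_ltn_trans kM.
  by apply: leq_trans (leq_addr _ _); exact: (leq_bigmax i).
by apply: leq_trans (leq_addl _ _); exact: (leq_bigmax i).
Unshelve. all: by end_near.
Qed.

Lemma cvg_mull (K : numFieldType) (u : nat -> K^o) (l c : K^o) :
  u @ \oo --> l -> (fun k => c * u k : K^o) @ \oo --> (c * l : K^o).
Proof. by move=> ul; apply: cvgM; [exact: cvg_cst|exact: ul]. Qed.

Section Limit.
Variables (R : realType) (n : nat) (Z : 'M[R[i]]_n).
Hypothesis hZ : siegel Z.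
Local Notation C := R[i].
Local Notation modes := ('cV[int]_n * 'cV[int]_n)%type.
Variables F G : 'cV[R]_(n + n) -> C.
Hypothesis sF : summ (fun p => cabs (fourier_coef F p)).
Hypothesis sG : summ (fun p => cabs (fourier_coef G p)).

(** The pairing of the first operator with a single mode, so that the double series can be
    treated one index at a time. *)
Definition half_pair (k : nat) (q : modes) : C := k%:R ^- n *
  \sum_i \sum_j toeplitz_mx k F i j * (mode_mx R (k := k) q i j)^*%C.

Lemma half_pair_sum k q : (0 < k)%N ->
  has_sum (fun p => fourier_coef F p * (k%:R ^- n * mode_pair R k p q)) (half_pair k q).
Proof.
move=> k0.
have -> : (fun p => fourier_coef F p * (k%:R ^- n * mode_pair R k p q)) =
  (fun p => k%:R ^- n * \sum_i \sum_j (mode_mx R (k := k) q i j)^*%C *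
     (fourier_coef F p * mode_mx R p i j)).
  apply/funext => p; rewrite mulrCA; congr (_ * _).
  rewrite /mode_pair mulr_sumr; apply: eq_bigr => i _.
  by rewrite mulr_sumr; apply: eq_bigr => j _; rewrite [LHS]mulrA [LHS]mulrC.
apply: has_sumZ; apply: has_sum_sum => i; apply: has_sum_sum => j.
by rewrite mulrC; apply: has_sumZ; exact: toeplitz_mx_sum.
Qed.

Lemma HS_sum k : (0 < k)%N ->
  has_sum (fun q => (fourier_coef G q)^*%C * half_pair k q)
    (k%:R ^- n * HS_ip Z k (toeplitz_E Z k F) (toeplitz_E Z k G)).
Proof.
move=> k0; have [nu nu0 nrmE] := nrm_gt0 hZ k0.
rewrite /HS_ip (hilbert_schmidt_matrix nu0 (spanP hZ k0) (ip_lincomb hZ k0 nrmE)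
  (toeplitz_E_matrix hZ k0 nu0 nrmE sF) (toeplitz_E_matrix hZ k0 nu0 nrmE sG)).
have -> : (fun q => (fourier_coef G q)^*%C * half_pair k q) =
  (fun q => k%:R ^- n * \sum_i \sum_j toeplitz_mx k F i j *
     (fourier_coef G q * mode_mx R q i j)^*%C).
  apply/funext => q; rewrite /half_pair mulrCA; congr (_ * _).
  rewrite mulr_sumr; apply: eq_bigr => i _.
  rewrite mulr_sumr; apply: eq_bigr => j _; rewrite conjc_mul mulrCA; reflexivity.
apply: has_sumZ; apply: has_sum_sum => i; apply: has_sum_sum => j.
by apply: has_sumZ; apply: has_sum_conj; exact: toeplitz_mx_sum.
Qed.

(** Dominated convergence over the modes of the first operator: only the mode q survives. *)
Lemma half_pair_cvg q :
  (fun k => half_pair k q : C^o) @ \oo --> (fourier_coef F q : C^o).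
Proof.
apply: (@has_sum_dominated R _ _ _ _ (fun k p => fourier_coef F p * (k%:R ^- n * mode_pair R k p q))
  (fun k => half_pair k q) (fun p => fourier_coef F p * (p == q)%:R) _
  (fun p => cabs (fourier_coef F p))).
- by move=> p; exact: cabs_ge0.
- exact: sF.
- near=> k; have k0 : (0 < k)%N by near: k; exact: nbhs_infty_gt.
  by move=> p; rewrite cabsM ler_piMr ?cabs_ge0 //; exact: cabs_mode_pair.
- by move=> p; rewrite cabsM ler_piMr ?cabs_ge0 // cabs_nat; case: (p == q).
- by near=> k; apply: half_pair_sum; near: k; exact: nbhs_infty_gt.
- have := @has_sum_supp R modes [fset q]%fset (fun p => fourier_coef F p * (p == q)%:R).
  rewrite big_seq_fset1 eqxx mulr1; apply => p; rewrite inE => /negPf ->.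
  by rewrite mulr0.
- by move=> p; apply: cvg_mull; exact: mode_pair_cvg.
Unshelve. all: by end_near.
Qed.

(** Dominated convergence a second time, now over the modes of the second operator; the
    sum of the moduli of the coefficients of F bounds the pairings uniformly in k. *)
Lemma HS_cvg l : has_sum (fun p => fourier_coef F p * (fourier_coef G p)^*%C) l ->
  (fun k : nat => k%:R ^- n * HS_ip Z k (toeplitz_E Z k F) (toeplitz_E Z k G) : C^o) @ \oo
  --> (l : C^o).
Proof.
move=> hl; have [M hM] := sF.
have M0 : 0 <= M by have := hM fset0; rewrite big_seq_fset0.
have hb k q : (0 < k)%N -> cabs (half_pair k q) <= M.
  move=> k0; apply: (has_sum_bound hM _ (half_pair_sum q k0)) => p.
  by rewrite cabsM ler_piMr ?cabs_ge0 //; exact: cabs_mode_pair.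
apply: (@has_sum_dominated R _ _ _ _ (fun k q => (fourier_coef G q)^*%C * half_pair k q) _
  (fun q => (fourier_coef G q)^*%C * fourier_coef F q) _
  (fun q => M * cabs (fourier_coef G q))).
- by move=> q; rewrite mulr_ge0 ?cabs_ge0.
- exact: summZ.
- near=> k; have k0 : (0 < k)%N by near: k; exact: nbhs_infty_gt.
  by move=> q; rewrite cabsM cabsJ mulrC ler_wpM2r ?cabs_ge0 // hb.
- move=> q; rewrite cabsM cabsJ mulrC ler_wpM2r ?cabs_ge0 //.
  by apply: le_trans (hM [fset q]%fset); rewrite big_seq_fset1.
- by near=> k; apply: HS_sum; near: k; exact: nbhs_infty_gt.
- by have -> : (fun q => (fourier_coef G q)^*%C * fourier_coef F q) =
    (fun p => fourier_coef F p * (fourier_coef G p)^*%C) by apply/funext => q; rewrite mulrC.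
- by move=> q; apply: cvg_mull; exact: half_pair_cvg.
Unshelve. all: by end_near.
Qed.

End Limit.

Lemma col_mx_pair_inj n :
  injective (fun p : 'cV[int]_n * 'cV[int]_n => col_mx p.1 p.2).
Proof. by move=> [r s] [r' s'] /= /eq_col_mx [-> ->]. Qed.

Lemma has_sum_modes (R : realType) (n : nat) (c : 'cV[int]_(n + n) -> R[i]) (l : R[i]) :
  has_sum c l -> has_sum (fun p : 'cV[int]_n * 'cV[int]_n => c (col_mx p.1 p.2)) l.
Proof.
have supp m : (forall p : 'cV[int]_n * 'cV[int]_n, m <> col_mx p.1 p.2) -> c m = 0.
  by move=> hm; case: (hm (usubmx m, dsubmx m)); rewrite /= vsubmxK.
exact: (has_sum_reindex l (@col_mx_pair_inj n) supp).1.
Qed.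

Theorem corollary2 (R : realType) (n : nat)
    (V : vectType R) (omega : V -> V -> R) (Lambda : set V)
    (lam : 'I_(n + n) -> V)
    (hlam : symplectic_lattice_basis omega Lambda lam)
    (Z : 'M[R[i]]_n) (hZ : siegel Z)
    (f g : V -> R[i])
    (hf : Cinfty_torus Lambda lam f) (hg : Cinfty_torus Lambda lam g) :
  (fun k : nat => (k%:R ^- n : R[i]) *
     HS_ip Z k (toeplitz_E Z k (in_coords lam f))
               (toeplitz_E Z k (in_coords lam g)) : R[i]^o) @ \oo
  --> (torus_ip (in_coords lam f) (in_coords lam g) : R[i]^o).
Proof.
have pf := in_coords_zper hlam hf; have pg := in_coords_zper hlam hg.
have sf := smooth_fcoef_summ hf.2 pf; have sg := smooth_fcoef_summ hg.2 pg.
have sm (u : 'cV[R]_(n + n) -> R[i]) : summ (fun m => cabs (fcoef u m)) ->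
    summ (fun p => cabs (fourier_coef u p)).
  move=> su; have := summ_inj (@col_mx_pair_inj n) su; rewrite /comp.
  by under [X in summ X -> _]funext do rewrite -fourier_coefE.
apply: HS_cvg; [exact: hZ|exact: sm|exact: sm|].
have := has_sum_modes (fourier_parseval (smooth_ccont hf.2) pf sf (smooth_ccont hg.2) pg sg).
by under [X in has_sum X _ -> _]funext do rewrite -!fourier_coefE.
Qed.
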